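(* Consider the system $y' = A(x;\lambda)y$, and let Assumptions (A), (B), (C), (D) stated in the context hold. Suppose that for some fixed interval $[\lambda_1,\lambda_2]\subset I$, $\lambda_1<\lambda_2$, Assumption (E) stated in the context holds as well. If $\mathcal{N}_{\#}([\lambda_1,\lambda_2])$ denotes the number of eigenvalues (in the sense defined in the context) that the system has on the interval $[\lambda_1,\lambda_2]$, counted without multiplicity, then $$\mathcal{N}_{\#}([\lambda_1,\lambda_2]) \ge \Big| \operatorname{Ind}(g(\cdot;\lambda_2),h^+(\lambda_2);[-\infty,+\infty]) - \operatorname{Ind}(g(\cdot;\lambda_1),h^+(\lambda_1);[-\infty,+\infty]) + \operatorname{Ind}(g^-(\cdot),h^+(\cdot);[\lambda_1,\lambda_2]) - \mathfrak{m}\Big|,$$ where the indices and the boundary invariant $\mathfrak{m}$ are as defined in the context.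
   Context: **System and Assumptions (A)-(D).** Let $n\ge 2$, let $I\subset\mathbb{R}$ be an open interval, and consider $y'(x)=A(x;\lambda)y(x)$, $x\in\mathbb{R}$, $\lambda\in I$, $y\in\mathbb{R}^n$. (A) For some open $\Omega\subset\mathbb{C}$ containing $I$, $A\in C(\mathbb{R}\times\Omega,\mathbb{C}^{n\times n})$, $A(x;\lambda)\in\mathbb{R}^{n\times n}$ for $(x,\lambda)\in\mathbb{R}\times I$, and $\lambda\mapsto A(x;\lambda)$ is analytic on $\Omega$ for every $x$. (B) For each $\lambda\in\Omega$ the limits $A_\pm(\lambda)=\lim_{x\to\pm\infty}A(x;\lambda)$ exist, uniformly on compact subsets of $\Omega$. (C) For each $\lambda\in\Omega$ each of $A_\pm(\lambda)$ has a unique eigenvalue $\mu_\pm(\lambda)$ of largest real part, which is simple: $\operatorname{Re}\mu_\pm(\lambda)>\max\{\operatorname{Re}\nu:\nu\in\sigma(A_\pm(\lambda)),\nu\ne\mu_\pm(\lambda)\}$. Moreover $\mu_\pm$ is analytic on $\Omega$, and there are analytic choices of right (column) eigenvectors $v^\pm(\lambda)$ and left (row) eigenvectors $w^\pm(\lambda)$ of $A_\pm(\lambda)$ for $\mu_\pm(\lambda)$ with $w^\pm(\lambda)v^\pm(\lambda)=1$ (real for $\lambda\in I$). (D) With $E(x;\lambda)=A(x;\lambda)-A_-(\lambda)$ for $x<0$ and $A(x;\lambda)-A_+(\lambda)$ for $x>0$, $\int_{\mathbb{R}}|E(x;\lambda)|dx$ is finite for all $\lambda\in\Omega$ and converges uniformly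 on compact subsets of $\Omega$. **Wedge convention.** $v\in\mathbb{R}^n$ is identified with the 1-form $\sum v_ie_i$; a vector written with a calligraphic letter, $\mathcal{V}\in\mathbb{R}^n$, is identified with the $(n-1)$-form $\mathcal{V}_1e_1\wedge\dots\wedge e_{n-1}+\mathcal{V}_2e_1\wedge\dots\wedge e_{n-2}\wedge e_n+\dots+\mathcal{V}_ne_2\wedge\dots\wedge e_n$ (so $\mathcal V_j$ is the coefficient of the product omitting $e_{n+1-j}$). We write $v\wedge\mathcal{V}$ for the scalar $\sum_{i=1}^n(-1)^{i+1}v_i\mathcal{V}_{n+1-i}$. $|\cdot|$ is the Euclidean norm. **Solutions.** $\eta^-(x;\lambda)$ is the unique solution of the system with $\lim_{x\to-\infty}e^{-\mu_-(\lambda)x}\eta^-(x;\lambda)=v^-(\lambda)$. $\{y_i^+(x;\lambda)\}_{i=1}^n$ is a basis of solutions with $\lim_{x\to+\infty}e^{-\mu_+(\lambda)x}y_n^+(x;\lambda)=v^+(\lambda)$ and with $y_1^+,\dots,y_{n-1}^+$ spanning the $(n-1)$-dimensional space of solutions that are $o(e^{\mu_+(\lambda)x})$ as $x\to+\infty$. Put $\mathcal{Y}^+=y_1^+\wedge\dots\wedge y_{n-1}^+$ and $\tilde{\mathcal{Y}}^+(x;\lambda)=e^{-\int_0^x\operatorname{tr}A(\xi;\lambda)d\xi}\mathcal{Y}^+(x;\lambda)$, with the basis normalized so that $\lim_{x\to+\infty}e^{\mu_+(\lambda)x}\tilde{\mathcal{Y}}^+(x;\lambda)=\tilde{\mathcal{V}}^+(\lambda)$,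 where $\tilde{\mathcal{V}}^+_j(\lambda)=(-1)^{n-j}w^+_{n+1-j}(\lambda)$. Fix an invertible $M\in\mathbb{R}^{n\times n}$ and put $\mathcal{Y}_M^+=(My_1^+)\wedge\dots\wedge(My_{n-1}^+)$, $\tilde{\mathcal{Y}}_M^+(x;\lambda)=e^{-\int_0^x\operatorname{tr}A(\xi;\lambda)d\xi}\mathcal{Y}_M^+(x;\lambda)$, $\tilde{\mathcal{V}}_M^+(\lambda)=\lim_{x\to+\infty}e^{\mu_+(\lambda)x}\tilde{\mathcal{Y}}_M^+(x;\lambda)$. Let $g(x;\lambda)=\operatorname{Span}\{\eta^-(x;\lambda)\}$ and $h(x;\lambda)=\operatorname{Span}\{y_1^+(x;\lambda),\dots,y_{n-1}^+(x;\lambda)\}$. **Eigenvalues.** $\lambda\in I$ is called an eigenvalue if there is a nontrivial solution lying both in $\operatorname{Span}\{\eta^-(\cdot;\lambda)\}$ and in $\operatorname{Span}\{y_1^+(\cdot;\lambda),\dots,y_{n-1}^+(\cdot;\lambda)\}$. If the eigenvalues in $[\lambda_1,\lambda_2]$ do not form a discrete set, then by convention $\mathcal{N}_{\#}([\lambda_1,\lambda_2])=+\infty$, and the lower bound is regarded as holding. **Normalized functions.** $\tilde\psi_1^c(x;\lambda)=\dfrac{\eta^-(x;\lambda)\wedge\mathcal{Y}^+(c;\lambda)}{|\eta^-(x;\lambda)||\mathcal{Y}^+(c;\lambda)|}$, $\tilde\psi_2^c(x;\lambda)=\dfrac{\eta^-(x;\lambda)\wedge\mathcal{Y}_M^+(c;\lambda)}{|\eta^-(x;\lambda)||\mathcal{Y}^+(c;\lambda)|}$;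 $\tilde\psi_1^+(x;\lambda)=\dfrac{\eta^-(x;\lambda)\wedge\tilde{\mathcal{V}}^+(\lambda)}{|\eta^-(x;\lambda)||\tilde{\mathcal{V}}^+(\lambda)|}$, $\tilde\psi_2^+(x;\lambda)=\dfrac{\eta^-(x;\lambda)\wedge\tilde{\mathcal{V}}_M^+(\lambda)}{|\eta^-(x;\lambda)||\tilde{\mathcal{V}}^+(\lambda)|}$ (the limits of $\tilde\psi_i^c$ as $c\to+\infty$); $\tilde\psi_i^{+,-}(\lambda)=\lim_{x\to-\infty}\tilde\psi_i^+(x;\lambda)$, i.e. $\tilde\psi_1^{+,-}=\dfrac{v^-\wedge\tilde{\mathcal{V}}^+}{|v^-||\tilde{\mathcal{V}}^+|}$, $\tilde\psi_2^{+,-}=\dfrac{v^-\wedge\tilde{\mathcal{V}}_M^+}{|v^-||\tilde{\mathcal{V}}^+|}$; and $\tilde\psi_i^{+,+}(\lambda)=\lim_{x\to+\infty}\tilde\psi_i^+(x;\lambda)$ when this limit exists. **Assumption (E) on $[\lambda_1,\lambda_2]$.** (1) For $i=1,2$ the limits $\tilde\psi_1^{+,+}(\lambda_i)$ and $\tilde\psi_2^{+,+}(\lambda_i)$ exist; (2) for $i=1,2$, $\tilde\psi_1^+(x;\lambda_i)$ and $\tilde\psi_2^+(x;\lambda_i)$ do not simultaneously vanish at any $x\in\mathbb{R}$, and $\tilde\psi_1^{+,+}(\lambda_i)$, $\tilde\psi_2^{+,+}(\lambda_i)$ do not simultaneously vanish; (3) $\tilde\psi_1^{+,-}(\lambda)$,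 $\tilde\psi_2^{+,-}(\lambda)$ do not simultaneously vanish at any $\lambda\in[\lambda_1,\lambda_2]$; (4) there is $c_0>0$ such that for all $c\ge c_0$ and all $\lambda\in[\lambda_1,\lambda_2]$, $\tilde\psi_1^c(c;\lambda)$ and $\tilde\psi_2^c(c;\lambda)$ do not simultaneously vanish. **Hyperplane index.** For a continuous pair $(a_1,a_2):[\alpha,\beta]\to\mathbb{R}^2\setminus\{0\}$, the index of $t\mapsto[a_1(t):a_2(t)]\in\mathbb{R}P^1$ is its signed count of passages through $[0:1]$: set $p=(a_2,a_1)/\sqrt{a_1^2+a_2^2}$ if $a_2\le0$ and $p=-(a_2,a_1)/\sqrt{a_1^2+a_2^2}$ if $a_2>0$, on the left half circle with $(0,1)$ and $(0,-1)$ identified, and count passages of $p$ through $(-1,0)$, counterclockwise $+1$, clockwise $-1$; a departure from $(-1,0)$ contributes $-1$ if clockwise and $0$ if counterclockwise, an arrival at $(-1,0)$ contributes $+1$ if counterclockwise and $0$ if clockwise. Equivalently, if $\theta$ is continuous with $(\cos\theta,\sin\theta)=(a_2,a_1)/\sqrt{a_1^2+a_2^2}$, the index is $\lfloor\theta(\beta)/\pi\rfloor-\lfloor\theta(\alpha)/\pi\rfloor$. On $[-\infty,+\infty]$ the same definition is used, with values at $\pm\infty$ being the limits (assumed to exist and be nonzero). $\operatorname{Ind}(g(\cdot;\lambda),h^+(\lambda);[-\infty,+\infty])$ is the index of $x\mapsto[\tilde\psi_1^+(x;\lambda):\tilde\psi_2^+(x;\lambda)]$ as $x$ goes from $-\infty$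 to $+\infty$, endpoints included. $\operatorname{Ind}(g^-(\cdot),h^+(\cdot);[\lambda_1,\lambda_2])$ is the index of $\lambda\mapsto[\tilde\psi_1^{+,-}(\lambda):\tilde\psi_2^{+,-}(\lambda)]$, $\lambda$ from $\lambda_1$ to $\lambda_2$. For finite arguments, $\operatorname{Ind}(g(x;\cdot),h(c;\cdot);[\lambda_1,\lambda_2])$ and $\operatorname{Ind}(g(\cdot;\lambda),h(c;\lambda);[a,b])$ are the indices of $[\tilde\psi_1^c(x;\lambda):\tilde\psi_2^c(x;\lambda)]$ as $\lambda$ goes from $\lambda_1$ to $\lambda_2$, respectively as $x$ goes from $a$ to $b$. **Boundary invariant.** Under (A)-(E) there is $C>0$ such that for all $c\ge C$ the quantity $$\operatorname{Ind}(g(-c;\cdot),h(c;\cdot);[\lambda_1,\lambda_2])+\operatorname{Ind}(g(\cdot;\lambda_2),h(c;\lambda_2);[-c,c])-\operatorname{Ind}(g(c;\cdot),h(c;\cdot);[\lambda_1,\lambda_2])-\operatorname{Ind}(g(\cdot;\lambda_1),h(c;\lambda_1);[-c,c])$$ is constant in $c$; this constant is $\mathfrak{m}$. *)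

(* Defs.v *)
From HB Require Import structures.
From mathcomp Require Import all_boot all_order all_algebra.
From mathcomp Require Import all_classical all_reals all_analysis.
From mathcomp Require Import complex.
Set Implicit Arguments.
Unset Strict Implicit.
Unset Printing Implicit Defensive.
Import Order.TTheory GRing.Theory Num.Theory.
Import numFieldNormedType.Exports.
Local Open Scope classical_set_scope.
Local Open Scope complex_scope.
Local Open Scope ring_scope.

(* The dimension of the system is n.+1, with 0 < n assumed in the theorem.
   The topology on R[i] is found by the library on the alias R[i]^o.
   The formulas below use indices from 0 instead of 1, so that the 1-based
   index (dimension + 1 - j) becomes rev_ord j. *)

Section Norms.
Variable R : realType.

Definition vnorm (m : nat) (v : 'cV[R]_m) : R :=
  Num.sqrt (\sum_i v i 0 ^+ 2).

Definition cmxnorm (m p : nat) (B : 'M[R[i]]_(m, p)) : R :=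
  Num.sqrt (\sum_i \sum_j Normc.normc (B i j) ^+ 2).

Definition oriented_integral (a b : R) (f : R -> R) : R :=
  if a <= b then \int[lebesgue_measure]_(t in `[a, b]) f t
  else - \int[lebesgue_measure]_(t in `[b, a]) f t.

End Norms.

Section ComplexAssumptions.
Variables (R : realType) (n : nat).
Implicit Types (Omega : set R[i]^o) (I : set R).
Implicit Types (A : R -> R[i] -> 'M[R[i]]_n.+1) (Am Ap : R[i] -> 'M[R[i]]_n.+1).

(* Analytic = complex differentiable; used on open sets only. *)
Definition analytic_on Omega (f : R[i] -> R[i]) : Prop :=
  forall l, Omega l -> derivable (f : R[i]^o -> R[i]^o) l 1.

Definition analytic_mx_on Omega (m p : nat) (B : R[i] -> 'M[R[i]]_(m, p)) : Prop :=
  forall i j, analytic_on Omega (fun l => B l i j).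

Definition assumption_A Omega I A : Prop :=
  [/\ open Omega,
      forall l, I l -> Omega l%:C,
      {within [set p : R * R[i]^o | Omega p.2],
        continuous (fun p : R * R[i]^o => A p.1 p.2 : 'M[R[i]^o]_n.+1)},
      forall x l, I l -> A x l%:C \is a mxOver Num.real &
      forall x, analytic_mx_on Omega (A x)].

Definition limit_matrix Omega A (F : set_system R) (B : R[i] -> 'M[R[i]]_n.+1) :=
  (forall l, Omega l ->
     (fun x => A x l : 'M[R[i]^o]_n.+1) @ F --> (B l : 'M[R[i]^o]_n.+1)) /\
  (forall K : set R[i]^o, compact K -> K `<=` Omega ->
     {uniform K, (A : R -> R[i]^o -> 'M[R[i]^o]_n.+1) @ F -->
                 (B : R[i]^o -> 'M[R[i]^o]_n.+1)}).

Definition assumption_B Omega A Am Ap : Prop :=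
  limit_matrix Omega A -oo Am /\ limit_matrix Omega A +oo Ap.

Definition dominant_eigenvalue (B : 'M[R[i]]_n.+1) (mu : R[i]) : Prop :=
  [/\ eigenvalue B mu,
      mup mu (char_poly B) = 1%N &
      forall nu, eigenvalue B nu -> nu != mu -> complex.Re nu < complex.Re mu].

Definition dominant_eigendata Omega I (B : R[i] -> 'M[R[i]]_n.+1)
    (mu : R[i] -> R[i]) (v : R[i] -> 'cV[R[i]]_n.+1) (w : R[i] -> 'rV[R[i]]_n.+1) :=
  [/\ forall l, Omega l -> dominant_eigenvalue (B l) (mu l),
      analytic_on Omega mu,
      analytic_mx_on Omega v /\ analytic_mx_on Omega w,
      forall l, Omega l ->
        [/\ B l *m v l = mu l *: v l, w l *m B l = mu l *: w l & w l *m v l = 1%:M] &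
      forall l, I l -> (v l%:C \is a mxOver Num.real) /\ (w l%:C \is a mxOver Num.real)].

Definition assumption_C Omega I Am Ap (muminus muplus : R[i] -> R[i])
    (vm vp : R[i] -> 'cV[R[i]]_n.+1) (wm wp : R[i] -> 'rV[R[i]]_n.+1) : Prop :=
  dominant_eigendata Omega I Am muminus vm wm /\ dominant_eigendata Omega I Ap muplus vp wp.

Definition Eterm A Am Ap (x : R) (l : R[i]) : 'M[R[i]]_n.+1 :=
  if x < 0 then A x l - Am l else A x l - Ap l.

Definition assumption_D Omega A Am Ap : Prop :=
  (forall l, Omega l ->
     (\int[lebesgue_measure]_x (cmxnorm (Eterm A Am Ap x l))%:E < +oo)%E) /\
  (forall K : set R[i]^o, compact K -> K `<=` Omega ->
     forall eps : R, 0 < eps -> exists2 T : R, 0 < T & forall l, K l ->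
       (\int[lebesgue_measure]_(x in [set x : R | (T <= `|x|)%R])
          (cmxnorm (Eterm A Am Ap x l))%:E <= eps%:E)%E).

End ComplexAssumptions.

Section Wedge.
Variables (R : realType) (n : nat).

(* Coordinates of c_1 /\ ... /\ c_n for the columns c_i of Y: the coordinate j
   is the coefficient of the product omitting e_(rev_ord j). *)
Definition wedge_cols (Y : 'M[R]_(n.+1, n)) : 'cV[R]_n.+1 :=
  \col_j \det (row' (rev_ord j) Y : 'M[R]_n).

Definition wedge_pair (v V : 'cV[R]_n.+1) : R :=
  \sum_(i < n.+1) (-1) ^+ i * v i 0 * V (rev_ord i) 0.

Definition npair (v U W : 'cV[R]_n.+1) : R :=
  wedge_pair v U / (vnorm v * vnorm W).

End Wedge.

(* Index of t |-> [a1 t : a2 t]: signed count of its passages through [0 : 1],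
   where the continuous angle theta of (a2, a1) is a multiple of pi; with the
   floors, arrivals count only when counterclockwise and departures only when
   clockwise.  A vanishing pair has no angle, as then the right-hand sides are
   0.  All angles give the same k, so xget selects the only one; the default
   value 0 is taken only when no angle exists. *)
Section Index.
Variable R : realType.

Definition angle_lift (D : set R) (a1 a2 theta : R -> R) : Prop :=
  {within D, continuous theta} /\
  forall t, D t ->
    cos (theta t) = a2 t / Num.sqrt (a1 t ^+ 2 + a2 t ^+ 2) /\
    sin (theta t) = a1 t / Num.sqrt (a1 t ^+ 2 + a2 t ^+ 2).

Definition hyp_index (a1 a2 : R -> R) (a b : R) : int :=
  xget 0 [set k : int | exists theta, angle_lift `[a, b] a1 a2 theta /\
    k = Num.floor (theta b / pi) - Num.floor (theta a / pi)].

Definition hyp_index_infty (a1 a2 : R -> R) : int :=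
  xget 0 [set k : int | exists theta (tm tp : R),
    [/\ angle_lift setT a1 a2 theta, theta @ -oo --> tm, theta @ +oo --> tp &
        k = Num.floor (tp / pi) - Num.floor (tm / pi)]].

End Index.

Section RealSystem.
Variables (R : realType) (n : nat).
Variables (A : R -> R[i] -> 'M[R[i]]_n.+1).

Definition remx (m p : nat) (B : R[i] -> 'M[R[i]]_(m, p)) (l : R) : 'M[R]_(m, p) :=
  map_mx (@complex.Re R) (B l%:C).

(* The dominant eigenvalues are real on I, so this is mu itself. *)
Definition reev (mu : R[i] -> R[i]) (l : R) : R := complex.Re (mu l%:C).

Definition is_solution (l : R) (z : R -> 'cV[R]_n.+1) : Prop :=
  forall x : R, is_derive x (1 : R) z (remx (A x) l *m z x).

Definition is_eta (muminus : R[i] -> R[i]) (vm : R[i] -> 'cV[R[i]]_n.+1)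
    (eta : R -> R -> 'cV[R]_n.+1) (l : R) : Prop :=
  is_solution l (eta ^~ l) /\
  (fun x => expR (- reev muminus l * x) *: eta x l) @ -oo --> remx vm l.

Variable muplus : R[i] -> R[i].
Variable wp : R[i] -> 'rV[R[i]]_n.+1.
Variable eta : R -> R -> 'cV[R]_n.+1.
Variable y : 'I_n.+1 -> R -> R -> 'cV[R]_n.+1.
Variable M : 'M[R]_n.+1.

(* y_1, ..., y_n; the last element of the basis is y ord_max. *)
Definition yfirst (j : 'I_n) : R -> R -> 'cV[R]_n.+1 := y (widen_ord (leqnSn n) j).

Definition in_span_eta (l : R) (z : R -> 'cV[R]_n.+1) : Prop :=
  exists k : R, forall x, z x = k *: eta x l.

Definition in_span_yfirst (l : R) (z : R -> 'cV[R]_n.+1) : Prop :=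
  exists c : 'I_n -> R, forall x, z x = \sum_(j < n) c j *: yfirst j x l.

Definition solution_basis (l : R) : Prop :=
  (forall i, is_solution l (y i ^~ l)) /\
  (forall z, is_solution l z ->
     exists! c : 'cV[R]_n.+1, forall x, z x = \sum_i c i 0 *: y i x l).

Definition subdominant (l : R) (z : R -> 'cV[R]_n.+1) : Prop :=
  (fun x => expR (- reev muplus l * x) *: z x) @ +oo --> (0 : 'cV[R]_n.+1).

Definition yfirst_mx (x l : R) : 'M[R]_(n.+1, n) :=
  \matrix_(i, j) yfirst j x l i 0.

Definition cY (x l : R) : 'cV[R]_n.+1 := wedge_cols (yfirst_mx x l).
Definition cYM (x l : R) : 'cV[R]_n.+1 := wedge_cols (M *m yfirst_mx x l).

Definition trfactor (x l : R) : R :=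
  expR (- oriented_integral 0 x (fun xi => \tr (remx (A xi) l))).

Definition tY (x l : R) : 'cV[R]_n.+1 := trfactor x l *: cY x l.
Definition tYM (x l : R) : 'cV[R]_n.+1 := trfactor x l *: cYM x l.

Definition tV (l : R) : 'cV[R]_n.+1 :=
  \col_j ((-1) ^+ (rev_ord j) * remx wp l 0 (rev_ord j)).
Definition tVM (l : R) : 'cV[R]_n.+1 :=
  lim ((fun x => expR (reev muplus l * x) *: tYM x l) @ +oo).

Definition is_ybasis (vp : R[i] -> 'cV[R[i]]_n.+1) (l : R) : Prop :=
  [/\ solution_basis l,
      (fun x => expR (- reev muplus l * x) *: y ord_max x l) @ +oo --> remx vp l,
      forall z, is_solution l z -> (subdominant l z <-> in_span_yfirst l z) &
      (fun x => expR (reev muplus l * x) *: tY x l) @ +oo --> tV l].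

Definition psi1c (c x l : R) : R := npair (eta x l) (cY c l) (cY c l).
Definition psi2c (c x l : R) : R := npair (eta x l) (cYM c l) (cY c l).
Definition psi1p (x l : R) : R := npair (eta x l) (tV l) (tV l).
Definition psi2p (x l : R) : R := npair (eta x l) (tVM l) (tV l).
Definition psi1pm (l : R) : R := lim (psi1p ^~ l @ -oo).
Definition psi2pm (l : R) : R := lim (psi2p ^~ l @ -oo).
Definition psi1pp (l : R) : R := lim (psi1p ^~ l @ +oo).
Definition psi2pp (l : R) : R := lim (psi2p ^~ l @ +oo).

Definition assumption_E_at (l : R) : Prop :=
  [/\ cvg (psi1p ^~ l @ +oo), cvg (psi2p ^~ l @ +oo),
      forall x, ~ (psi1p x l = 0 /\ psi2p x l = 0) &
      ~ (psi1pp l = 0 /\ psi2pp l = 0)].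

Definition assumption_E (l1 l2 : R) : Prop :=
  [/\ assumption_E_at l1, assumption_E_at l2,
      forall l, l1 <= l <= l2 -> ~ (psi1pm l = 0 /\ psi2pm l = 0) &
      exists2 c0 : R, 0 < c0 & forall c l, c0 <= c -> l1 <= l <= l2 ->
        ~ (psi1c c c l = 0 /\ psi2c c c l = 0)].

Definition Ind_line (l : R) : int := hyp_index_infty (psi1p ^~ l) (psi2p ^~ l).

Definition Ind_minus (l1 l2 : R) : int := hyp_index psi1pm psi2pm l1 l2.

(* Ind(g(x;.), h(c;.); [l1, l2]) and Ind(g(.;l), h(c;l); [a, b]). *)
Definition Ind_shelf (x c l1 l2 : R) : int :=
  hyp_index (psi1c c x) (psi2c c x) l1 l2.

Definition Ind_side (l c a b : R) : int :=
  hyp_index (fun x => psi1c c x l) (fun x => psi2c c x l) a b.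

Definition box_index (l1 l2 c : R) : int :=
  Ind_shelf (- c) c l1 l2 + Ind_side l2 c (- c) c
  - Ind_shelf c c l1 l2 - Ind_side l1 c (- c) c.

(* The eventually constant value of box_index, which is unique. *)
Definition boundary_invariant (l1 l2 : R) : int :=
  xget 0 [set m : int | exists2 C : R, 0 < C &
                        forall c, C <= c -> box_index l1 l2 c = m].

Definition is_eigenvalue (l : R) : Prop :=
  exists z : R -> 'cV[R]_n.+1,
    [/\ is_solution l z, exists x, z x <> 0, in_span_eta l z & in_span_yfirst l z].

(* Cardinality of the set of eigenvalues; +oo when that set is infinite, in
   particular when it is not discrete. *)
Definition eigenvalue_count (l1 l2 : R) : \bar R :=
  counting [set l : R | l1 <= l <= l2 /\ is_eigenvalue l].

End RealSystem.

(* Main.v *)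
Require Import Defs.
From mathcomp Require Import all_boot all_order all_algebra.
From mathcomp Require Import all_classical all_reals all_analysis.
From mathcomp Require Import finmap perm measurable_realfun.
From mathcomp Require Import complex ring lra zify.
Set Implicit Arguments.
Unset Strict Implicit.
Unset Printing Implicit Defensive.
Import Order.TTheory GRing.Theory Num.Theory.
Import numFieldNormedType.Exports.
Local Open Scope classical_set_scope.
Local Open Scope complex_scope.
Local Open Scope ring_scope.

(** The quotient pairs that define the indices are all of one kind.  The
    (n-1)-form tilde Y(c) is turned into a row vector z(c) (adj_row), which
    solves the adjoint system z' = - z A because the trace factor cancels the
    trace term in the derivative of a determinant (is_derive_wedge).  The
    identity covec_wedge_mul shows that multiplication by M acts on this row
    vector as det M times right multiplication by the inverse of M.  So every
    pair (psi_1, psi_2) is a positive multiple of (form1 r e, form2 M r e) with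
    r = z(c) or r = w^+ (its rescaled limit) and e = eta(x) or e = v^- (its
    rescaled limit).

    Two facts make the counting work.  The index of a pair of forms only
    depends on floors of angle / pi, and these floors jump only where the
    first form vanishes (sin_eq0_or_sign_floor); hence two paths whose planar
    directions stay within a right angle of each other, and whose first
    coordinates have the same sign at the ends, have the same index.  On the
    other hand form1 (z c) (eta c) is independent of c (crossingE): it is the
    Evans function, and it vanishes only at eigenvalues
    (crossing0_eigenvalue).

    Consider the box with sides x in [-c, c] and lambda in [l1, l2].  The top
    shelf x = c carries the pair of forms of (z(c), eta(c)), whose first entry
    is the Evans function.  Its index Q does not depend on c, as the pair moves
    continuously in c without vanishing and the signs at the ends are fixed
    (homotopy_index_constant); each unit of |Q| forces a zero of the Evans
    function, so |Q| is at most the number of eigenvalues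
    (index_le_counting, far_shelf).  The three other sides converge, as c
    tends to infinity, to the paths at infinity in the statement: the bottom
    shelf to lambda |-> (w^+, v^-), the two vertical sides to
    x |-> (w^+, eta(x)).  Each side may gain or lose whole turns near its
    corners, but the same corner belongs to a shelf and to a vertical side and
    the corrections cancel (side_corner, three_sides).  So for large c the box
    index is K - Q, where K is the signed sum of the indices at infinity; hence the
    boundary invariant is K - Q, and the quantity to be bounded is |Q|.

    The analytic part is the convergence just used, uniformly in lambda.  After
    rescaling by exp(- mu x), eta solves a system whose limit matrix B - mu has
    the simple eigenvalue 0 and all other eigenvalues in the left half plane.
    A rank-one update moves the eigenvalue 0 to -1 (deflated_spectrum), so a
    Lyapunov form exists (lyapunov); adding the square of the dominant
    coordinate gives a quadratic energy that does not increase along B - mu and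
    can be chosen uniformly for nearby parameters (energy_form).  Gronwall's
    inequality for this energy, with the integrable perturbation as rate, gives
    the uniform convergence at infinity and the joint continuity of solutions
    in (x, lambda) (rescaled_cvg_joint, solution_continuous_joint).  Reversing x
    and transposing, the same result applies to z at +oo (adj_asymptotics). *)

(** * Removing a simple eigenvalue by a rank-one update *)

Section Deflation.

(** The matrix determinant lemma, multiplied by p so that p need not be
    invertible: the determinant of the bordered matrix K below is computed in
    two ways, each by a product with a block triangular matrix. *)
Lemma det_scalar_add_rank1 (T : comPzRingType) m (p : T) (v : 'cV[T]_m) (w : 'rV[T]_m) :
  \det (p%:M + v *m w) * p = (p + (w *m v) 0 0) * p ^+ m.
Proof.
pose K : 'M[T]_(1 + m) := block_mx 1%:M (- w) v p%:M.
have dK : \det K = \det (p%:M + v *m w).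
  have -> : K = block_mx 1%:M 0 v 1%:M *m block_mx 1%:M (- w) 0 (p%:M + v *m w).
    rewrite mulmx_block !mul1mx !mul0mx !mulmx1 !addr0 mulmxN; congr block_mx.
    by rewrite addrCA addNr addr0.
  by rewrite det_mulmx det_lblock det_ublock !det1 !mul1r.
rewrite -dK.
have -> : \det K * p = \det (K *m block_mx p%:M 0 (- v) 1%:M).
  by rewrite det_mulmx det_lblock det1 mulr1 det_scalar expr1.
have -> : K *m block_mx p%:M 0 (- v) 1%:M
        = block_mx (p%:M + w *m v) (- w) 0 p%:M.
  rewrite mulmx_block !mul1mx !mulmx0 !mulmx1 !add0r !mulmxN mulNmx opprK.
  congr block_mx.
  by rewrite mul_scalar_mx mul_mx_scalar subrr.
by rewrite det_ublock det_scalar det_mx11 !mxE eqxx.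
Qed.

(** As (X - B) v = (X - mu) v, multiplying X - B by the rank-one update
    (X - mu) + v w of a scalar matrix gives (X - mu) (X - (B - v w)); the
    identity follows by taking determinants. *)
Lemma char_poly_deflate (F : fieldType) m (B : 'M[F]_m) mu (v : 'cV_m) (w : 'rV_m) :
  B *m v = mu *: v -> w *m v = 1%:M ->
  char_poly (B - v *m w) * ('X - mu%:P) = char_poly B * ('X - mu%:P + 1).
Proof.
move=> Bv wv; set p : {poly F} := 'X - mu%:P.
pose vP := map_mx polyC v; pose wP := map_mx polyC w.
have pN0 : p ^+ m != 0 by rewrite expf_neq0 // polyXsubC_eq0.
have wvP : (wP *m vP) 0 0 = 1 by rewrite -map_mxM wv !mxE.
have Bpv : char_poly_mx B *m vP = p *: vP.
  rewrite /char_poly_mx mulmxBl mul_scalar_mx -map_mxM Bv map_mxZ.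
  by rewrite -scalerBl.
have E : char_poly_mx B *m (p%:M + vP *m wP) = p *: char_poly_mx (B - v *m w).
  rewrite mulmxDr mul_mx_scalar mulmxA Bpv -scalemxAl -scalerDr.
  congr (_ *: _); rewrite /char_poly_mx map_mxB map_mxM.
  by rewrite opprB addrA addrAC.
have /(congr1 (fun M => \det M * p)) := E.
rewrite det_mulmx detZ -mulrA det_scalar_add_rank1 wvP => E2.
apply: (mulIf pN0); rewrite /char_poly.
move: E2; rewrite -!/(char_poly _) => E2.
by rewrite -[RHS]mulrA E2 mulrC mulrA.
Qed.

(** On the right-hand side of char_poly_deflate mu has multiplicity 1, and the
    factor X - mu on the left already accounts for it. *)
Lemma deflate_simple_eigenvalue (F : fieldType) m (B : 'M[F]_m) mu
    (v : 'cV_m) (w : 'rV_m) :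
  mup mu (char_poly B) = 1%N -> B *m v = mu *: v -> w *m v = 1%:M ->
  ~~ eigenvalue (B - v *m w) mu.
Proof.
move=> mup1 Bv wv; rewrite eigenvalue_root_char.
have cB0 : char_poly B != 0 by rewrite monic_neq0 // char_poly_monic.
have := char_poly_deflate Bv wv.
move/(congr1 (mup mu)).
have c0 : char_poly (B - v *m w) != 0 by rewrite monic_neq0 // char_poly_monic.
have X0 : 'X - mu%:P != 0 by rewrite polyXsubC_eq0.
have Nr : ~~ root ('X - mu%:P + 1) mu.
  by rewrite /root !hornerE subrr add0r oner_eq0.
have Y0 : 'X - mu%:P + 1 != 0 by apply: contraNneq Nr => ->; rewrite root0.
rewrite !mupM // mup1 (mupNroot Nr) addn0.
have := mup_XsubCX 1 mu mu; rewrite expr1 eqxx => ->.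
by rewrite addn1 => -[] /eqP; rewrite -leqn0 leqNgt -XsubC_dvd // dvdp_XsubCl.
Qed.

(** Let u be a left eigenvector for nu.  Applying the relation to v gives
    u v = 0 or nu = -1.  If u v = 0, then u is a left eigenvector of B for
    mu + nu, which by dominance has a smaller real part than mu unless nu = 0;
    and nu = 0 is excluded by the simplicity of mu. *)
Lemma deflated_spectrum (R : realType) n (B : 'M[R[i]]_n.+1) mu
    (v : 'cV_n.+1) (w : 'rV_n.+1) :
  dominant_eigenvalue B mu ->
  B *m v = mu *: v -> w *m B = mu *: w -> w *m v = 1%:M ->
  forall nu, eigenvalue (B - mu%:M - v *m w) nu -> complex.Re nu < 0.
Proof.
case=> _ mup1 dom Bv wB wv nu /eigenvalueP[u].
rewrite !mulmxBr mul_mx_scalar => Eu u0.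
have uv0 : u *m v = 0 \/ nu = -1.
  have := congr1 (mulmx ^~ v) Eu; rewrite !mulmxBl -!mulmxA Bv wv !mulmx1.
  rewrite -scalemxAr -!scalemxAl subrr sub0r => E.
  have [->|uv] := eqVneq (u *m v) 0; [by left|right].
  apply/eqP; rewrite -subr_eq0 opprK; apply: contraNT uv => nu1.
  have : (nu + 1) *: (u *m v) = 0 by rewrite scalerDl scale1r -E addNr.
  by move/eqP; rewrite scaler_eq0 (negbTE nu1).
case: uv0 => [uv0|->]; last by rewrite raddfN /= ltrN10.
move: (Eu); rewrite mulmxA uv0 mul0mx subr0 => Eu2.
have Eu3 : u *m B = (mu + nu) *: u by rewrite scalerDl -Eu2 addrC subrK.
have [nu0|nu0] := eqVneq nu 0.
  have /negP[] := deflate_simple_eigenvalue mup1 Bv wv.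
  apply/eigenvalueP; exists u => //.
  by rewrite mulmxBr mulmxA uv0 mul0mx subr0 Eu3 nu0 addr0.
have : eigenvalue B (mu + nu) by apply/eigenvalueP; exists u.
move/dom => /(_ _); rewrite -subr_eq0 addrAC subrr add0r nu0 raddfD /= => /(_ isT).
by rewrite gtrDl.
Qed.

End Deflation.

(** * A Lyapunov form for a stable matrix *)

Lemma trig_eigenvalue (F : fieldType) n (T : 'M[F]_n) i :
  is_trig_mx T -> eigenvalue T (T i i).
Proof.
move=> trigT; rewrite eigenvalue_root_char char_poly_trig // /root horner_prod.
by rewrite (bigD1 i) //= hornerXsubC subrr mul0r.
Qed.

Section Lyapunov.
Variable R : realType.
Local Notation normc := Normc.normc.
Local Notation cplx := (map_mx (@real_complex R)).

Lemma Re_le_normc (z : R[i]) : complex.Re z <= normc z.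
Proof.
case: z => a b /=; apply: le_trans (ler_norm _) _.
by rewrite -sqrtr_sqr ler_wsqrtr // lerDl sqr_ge0.
Qed.

Lemma normc_conj (z : R[i]) : normc (z^*)%C = normc z.
Proof. by case: z => a b /=; rewrite sqrrN. Qed.

Lemma normc_ge0 (z : R[i]) : 0 <= normc z.
Proof. by case: z => a b; exact: sqrtr_ge0. Qed.

Lemma Re_conj_mul_self (z : R[i]) : complex.Re ((z^*)%C * z) = normc z ^+ 2.
Proof.
case: z => a b /=; rewrite sqr_sqrtr ?addr_ge0 ?sqr_ge0 //; ring.
Qed.

Lemma unitary_normc_sum n (P : 'M[R[i]]_n) (x : 'cV[R]_n) :
  P \is unitarymx ->
  \sum_i normc ((P *m cplx x) i 0) ^+ 2 = \sum_i x i 0 ^+ 2.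
Proof.
move=> uP.
have H (V : 'cV[R[i]]_n) : \sum_i normc (V i 0) ^+ 2
    = complex.Re (((map_mx conjc V)^T *m V) 0 0).
  rewrite mxE raddf_sum /=; apply: eq_bigr => i _.
  by rewrite !mxE Re_conj_mul_self.
have Hx : \sum_i x i 0 ^+ 2 = \sum_i normc (cplx x i 0) ^+ 2.
  apply: eq_bigr => i _; rewrite mxE /= expr0n addr0.
  by rewrite sqr_sqrtr ?sqr_ge0.
rewrite Hx !H; congr (complex.Re (_ 0 0)).
rewrite map_mxM trmx_mul /= -mulmxA [X in _ *m X]mulmxA.
have -> : (map_mx conjc P)^T *m P = 1%:M.
  rewrite -(mulVmx (unitarymx_unit uP)) invmx_unitary //.
  by congr (_ *m _); apply/matrixP => i j; rewrite !mxE.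
by rewrite mul1mx.
Qed.

(** On real vectors, the Hermitian form that is diagonal with weights c in the
    coordinates P x is represented by a real symmetric matrix. *)
Lemma weighted_gram_form n (P : 'M[R[i]]_n) (c : 'I_n -> R) (x y : 'cV[R]_n) :
  (x^T *m (\matrix_(j, k) \sum_i c i * complex.Re ((P i j)^*%C * P i k)) *m y) 0 0
  = \sum_i c i * complex.Re (((P *m cplx x) i 0)^*%C * (P *m cplx y) i 0).
Proof.
rewrite mxE; under eq_bigr do rewrite mxE mulr_suml.
under [RHS]eq_bigr => i _.
  rewrite !mxE rmorph_sum /= big_distrlr /= raddf_sum mulr_sumr.
  under eq_bigr do rewrite raddf_sum mulr_sumr.
  over.
rewrite [RHS]exchange_big /=; under [RHS]eq_bigr do rewrite exchange_big /=.
rewrite exchange_big; apply: eq_bigr => j _; apply: eq_bigr => k _ /=.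
rewrite !mxE mulr_sumr mulr_suml; apply: eq_bigr => i _.
case: (P i j) => a b; case: (P i k) => a' b' /=; ring.
Qed.

Lemma sqr_norm_le_sum n (x : 'cV[R]_n) : `|x| ^+ 2 <= \sum_i x i 0 ^+ 2.
Proof.
change (mx_norm x ^+ 2 <= \sum_i x i 0 ^+ 2).
have [->|/mx_norm_neq0 [[i j]]] := eqVneq (mx_norm x) 0.
  by rewrite expr0n /= sumr_ge0 // => i _; exact: sqr_ge0.
move=> -> /=; rewrite (ord1 j) real_normK ?num_real //.
by rewrite (bigD1 i) //= lerDl sumr_ge0 // => k _; exact: sqr_ge0.
Qed.

(** Triangularize, P H = T P with P unitary and T lower triangular.  Weighting
    the squared coordinates of P x by even powers of a small d multiplies the
    entries of T below the diagonal by powers of d, so that they become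
    negligible against the diagonal, whose real parts are at most - k0. *)
Lemma lyapunov n (H : 'M[R]_n.+1) :
  (forall nu, eigenvalue (cplx H) nu -> complex.Re nu < 0) ->
  exists (S : 'M[R]_n.+1) (k : R), [/\ 0 < k, S^T = S,
    forall x : 'cV_n.+1, k * `|x| ^+ 2 <= (x^T *m S *m x) 0 0 &
    forall x : 'cV_n.+1, (x^T *m S *m (H *m x)) 0 0 <= - k * `|x| ^+ 2].
Proof.
move=> stab; have [P uP trigT] := Schur (cplx H) (ltn0Sn n).
have Pu := unitarymx_unit uP.
set T := conjmx P (cplx H); have {}trigT : is_trig_mx T by [].
have PH : P *m cplx H = T *m P.
  by rewrite /T conjumx // -!mulmxA mulVmx // mulmx1.
have diagT i : complex.Re (T i i) < 0.
  apply/stab/(@eigenvalue_conjmx _ _ _ P); rewrite ?row_free_unit //.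
    exact: stablemx_unit.
  exact: trig_eigenvalue.
pose k0 := \big[Order.min/1]_i (- complex.Re (T i i)).
have k0_gt0 : 0 < k0 by apply: lt_bigmin => // i _; rewrite oppr_gt0.
have k0P i : complex.Re (T i i) <= - k0.
  by rewrite lerNr; apply: bigmin_le_cond.
(* An upper bound for the entries of T. *)
pose L := 1 + \sum_i \sum_j normc (T i j).
have L_gt0 : 0 < L.
  rewrite ltr_pwDl // sumr_ge0 // => i _; rewrite sumr_ge0 // => j _.
  exact: normc_ge0.
have LP i j : normc (T i j) <= L.
  rewrite /L (bigD1 i) //= (bigD1 j) //= !addrA addrAC.
  rewrite -addrA [1 + _]addrC -addrA lerDl.
  rewrite !addr_ge0 ?sumr_ge0 // => *; rewrite ?sumr_ge0 // => *; exact: normc_ge0.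
(* The off-diagonal terms add up to at most L d (n + 1) times the form, which
   by this choice is at most half of what the diagonal provides. *)
pose d := Num.min 1 (k0 / (2 * L * n.+1%:R)).
have d_gt0 : 0 < d by rewrite lt_min ltr01 divr_gt0 // !mulr_gt0.
have d_le1 : d <= 1 by rewrite ge_min lexx.
have dP : L * d * n.+1%:R <= k0 / 2.
  have : d <= k0 / (2 * L * n.+1%:R) by rewrite ge_min lexx orbT.
  rewrite ler_pdivlMr ?mulr_gt0 // => hd.
  by rewrite ler_pdivlMr //; apply: le_trans hd; rewrite le_eqVlt; apply/orP; left; apply/eqP; ring.
pose c (i : 'I_n.+1) := d ^+ i ^+ 2.
pose S := \matrix_(j, k) \sum_i c i * complex.Re ((P i j)^*%C * P i k).
pose U (x : 'cV[R]_n.+1) := P *m cplx x.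
pose V x (i : 'I_n.+1) := d ^+ i * normc (U x i 0).
have V_ge0 (x : 'cV[R]_n.+1) i : 0 <= V x i by rewrite mulr_ge0 ?normc_ge0 // exprn_ge0 // ltW.
have SE (x : 'cV[R]_n.+1) : (x^T *m S *m x) 0 0 = \sum_i V x i ^+ 2.
  rewrite weighted_gram_form; apply: eq_bigr => i _.
  by rewrite Re_conj_mul_self -exprMn.
have c_ge i : d ^+ n ^+ 2 <= c i.
  have := ltn_ord i; rewrite ltnS => lein.
  rewrite /c lerXn2r ?nnegrE ?exprn_ge0 ?(ltW d_gt0) //.
  by rewrite ler_wiXn2l // ltW.
have SP (x : 'cV[R]_n.+1) : d ^+ n ^+ 2 * `|x| ^+ 2 <= (x^T *m S *m x) 0 0.
  rewrite SE; apply: (@le_trans _ _ (d ^+ n ^+ 2 * \sum_i x i 0 ^+ 2)).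
    by rewrite ler_wpM2l ?sqr_sqrtr ?sqr_norm_le_sum // sqr_ge0.
  rewrite -(unitary_normc_sum x uP) mulr_sumr; apply: ler_sum => i _.
  by rewrite /V exprMn ler_wpM2r ?sqr_ge0 //; exact: c_ge.
have UH (x : 'cV[R]_n.+1) : U (H *m x) = T *m U x by rewrite /U map_mxM mulmxA PH -mulmxA.
have off (x : 'cV[R]_n.+1) i j : i != j ->
    c i * complex.Re ((U x i 0)^*%C * (T i j * U x j 0))
      <= L * d * ((V x i ^+ 2 + V x j ^+ 2) / 2).
  move=> neij; have [ltij|leji] := ltnP i j.
    move/is_trig_mxP: trigT => /(_ i j ltij) ->.
    rewrite mul0r mulr0 /= mulr0; apply: mulr_ge0; first by rewrite mulr_ge0 // ltW.
    by rewrite divr_ge0 // addr_ge0 // sqr_ge0.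
  have {leji neij}ltji : (j < i)%N by rewrite ltn_neqAle leji andbT eq_sym.
  apply: (@le_trans _ _ (c i * (normc (U x i 0) * (L * normc (U x j 0))))).
    rewrite ler_wpM2l ?sqr_ge0 //; apply: le_trans (Re_le_normc _) _.
    rewrite !Normc.normcM normc_conj ler_wpM2l ?normc_ge0 //.
    by rewrite ler_wpM2r ?normc_ge0.
  have -> : c i * (normc (U x i 0) * (L * normc (U x j 0)))
           = L * d ^+ (i - j) * (V x i * V x j).
    have Ei : d ^+ i = d ^+ (i - j) * d ^+ j by rewrite -exprD subnK // ltnW.
    rewrite /V /c [d ^+ i ^+ 2]expr2 {1}Ei.
    by move: (d ^+ i) (d ^+ j) (d ^+ (i - j)) => *; ring.
  apply: ler_pM.
  - by rewrite mulr_ge0 ?exprn_ge0 // ltW.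
  - exact: mulr_ge0.
  - rewrite ler_wpM2l ?(ltW L_gt0) // -{2}[d]expr1 ler_wiXn2l ?(ltW d_gt0) //.
    by rewrite subn_gt0.
  by have := sqr_ge0 (V x i - V x j); rewrite sqrrB; lra.
have SHP (x : 'cV[R]_n.+1) : (x^T *m S *m (H *m x)) 0 0 <= - (k0 / 2) * (x^T *m S *m x) 0 0.
  rewrite SE weighted_gram_form -!/(U _) UH.
  apply: (@le_trans _ _ (\sum_i (- k0 * V x i ^+ 2
     + \sum_j L * d * ((V x i ^+ 2 + V x j ^+ 2) / 2)))).
    apply: ler_sum => i _; rewrite [(T *m U x) i 0]mxE mulr_sumr raddf_sum mulr_sumr.
    rewrite (bigD1 i) //=; apply: lerD.
      have -> : complex.Re ((U x i 0)^*%C * (T i i * U x i 0))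
        = complex.Re (T i i) * normc (U x i 0) ^+ 2.
        rewrite -Re_conj_mul_self.
        by case: (U x i 0) => a b; case: (T i i) => a' b' /=; ring.
      rewrite mulrCA /c -exprMn; apply: ler_wpM2r; first exact: sqr_ge0.
      exact: k0P.
    apply: (@le_trans _ _ (\sum_(j < n.+1 | j != i) L * d * ((V x i ^+ 2 + V x j ^+ 2) / 2))).
      by apply: ler_sum => j; rewrite eq_sym => /off.
    rewrite [leRHS](bigD1 i) //= lerDr mulr_ge0 //; first by rewrite mulr_ge0 // ltW.
    by rewrite divr_ge0 // addr_ge0 // sqr_ge0.
  rewrite big_split /= -mulr_sumr.
  under [X in _ + X]eq_bigr do rewrite -mulr_sumr -mulr_suml big_split /= sumr_const card_ord.
  rewrite -mulr_sumr -mulr_suml big_split /= sumrMnl sumr_const card_ord.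
  set Q := \sum_i V x i ^+ 2.
  have Q0 : 0 <= Q by rewrite sumr_ge0 // => i _; exact: sqr_ge0.
  have -> : L * d * ((Q *+ n.+1 + Q *+ n.+1) / 2) = L * d * n.+1%:R * Q.
    by rewrite -mulr_natr; field.
  have := ler_wpM2r Q0 dP; lra.
exists S, (Num.min 1 (k0 / 2) * (d ^+ n ^+ 2)); split.
- by rewrite mulr_gt0 ?exprn_gt0 // lt_min ltr01 divr_gt0.
- apply/matrixP => j k; rewrite !mxE; apply: eq_bigr => i _; congr (_ * _).
  by case: (P i j) => a b; case: (P i k) => a' b' /=; ring.
- move=> x; apply: le_trans (SP x); rewrite -mulrA ler_piMl ?ge_min ?lexx //.
  by rewrite mulr_ge0 ?sqr_ge0.
move=> x; apply: le_trans (SHP x) _; rewrite !mulNr lerN2 -mulrA.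
apply: ler_pM => //; rewrite ?ge_min ?lexx ?orbT //.
  by rewrite le_min ler01 divr_ge0 // ltW.
by rewrite mulr_ge0 ?sqr_ge0.
Qed.

End Lyapunov.

(** * Limits and derivatives of matrix-valued functions *)

Section MatrixAnalysis.
Variable R : realType.

Lemma mx_entry_le_norm m p (A : 'M[R]_(m, p)) i j : `|A i j| <= `|A|.
Proof.
rewrite [leRHS]/Num.Def.normr/= mx_normrE.
exact: (le_bigmax _ (fun ij => `|A ij.1 ij.2|) (i, j)).
Qed.

Lemma mx_norm_leP m p (A : 'M[R]_(m, p)) e : 0 <= e ->
  (forall i j, `|A i j| <= e) -> `|A| <= e.
Proof.
move=> e0 Ae; rewrite [leLHS]/Num.Def.normr/= mx_normrE.
by apply: bigmax_le => // -[i j] _; exact: Ae.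
Qed.

Lemma mulmx_norm_le m p q (A : 'M[R]_(m, p)) (B : 'M[R]_(p, q)) :
  `|A *m B| <= p%:R * (`|A| * `|B|).
Proof.
apply: mx_norm_leP => [|i j]; first by rewrite !mulr_ge0.
rewrite mxE; apply: le_trans (ler_norm_sum _ _ _) _.
apply: (@le_trans _ _ (\sum_(k < p) `|A| * `|B|)).
  apply: ler_sum => k _; rewrite normrM.
  by apply: ler_pM => //; exact: mx_entry_le_norm.
by rewrite sumr_const card_ord mulr_natl.
Qed.

Lemma trmx_norm m p (A : 'M[R]_(m, p)) : `|A^T| = `|A|.
Proof.
by apply/eqP; rewrite eq_le; apply/andP; split; apply: mx_norm_leP => // i j;
  [rewrite mxE | rewrite -[A]trmxK mxE trmxK]; exact: mx_entry_le_norm.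
Qed.

Lemma cvg_mxP (T : Type) (F : set_system T) {FF : Filter F} m p (f : T -> 'M[R]_(m, p)) (A : 'M[R]_(m, p)) :
  (f @ F --> A) <-> forall i j, (fun t => f t i j) @ F --> A i j.
Proof.
split.
- move=> /cvgrPdist_le fA i j; apply/cvgrPdist_le => e e0.
  near=> t; apply: le_trans (near (fA e e0) t _) => //.
  by have := mx_entry_le_norm (A - f t) i j; rewrite !mxE.
- move=> fA; apply/cvgrPdist_le => e e0.
  have : \forall t \near F, forall i j, `|A i j - f t i j| <= e.
    by apply: filter_forall => i; apply: filter_forall => j; move/cvgrPdist_le: (fA i j); exact.
  apply: filterS => t At; apply: mx_norm_leP => [|i j]; first exact: ltW.
  by rewrite !mxE.
Unshelve. all: by end_near. Qed.

Lemma cvg_finite_sum (T : Type) (F : set_system T) {FF : Filter F} (J : finType) (f : J -> T -> R)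
    (l : J -> R) : (forall j, f j @ F --> l j) ->
  (fun t => \sum_j f j t) @ F --> \sum_j l j.
Proof.
move=> fl; rewrite (_ : (fun t => _) = \sum_j f j).
  by elim/big_ind2 : _ => [|*|//]; [exact: cvg_cst | exact: cvgD].
by apply/funext => t; rewrite fct_sumE.
Qed.

Lemma cvg_mulmx (T : Type) (F : set_system T) {FF : Filter F} m p q (f : T -> 'M[R]_(m, p))
    (g : T -> 'M[R]_(p, q)) (A : 'M[R]_(m, p)) (B : 'M[R]_(p, q)) :
  f @ F --> A -> g @ F --> B -> (fun t => f t *m g t) @ F --> A *m B.
Proof.
move=> /cvg_mxP fA /cvg_mxP gB; apply/cvg_mxP => i j; rewrite mxE.
under eq_fun do rewrite mxE.
by apply: cvg_finite_sum => k; apply: cvgM; [exact: fA | exact: gB].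
Qed.

Lemma cvg_trmx (T : Type) (F : set_system T) {FF : Filter F} m p (f : T -> 'M[R]_(m, p)) (A : 'M[R]_(m, p)) :
  f @ F --> A -> (fun t => (f t)^T) @ F --> A^T.
Proof.
move=> /cvg_mxP fA; apply/cvg_mxP => i j; rewrite mxE.
by under eq_fun do rewrite mxE; exact: fA.
Qed.

Lemma cvg_addmx (T : Type) (F : set_system T) {FF : Filter F} m p (f g : T -> 'M[R]_(m, p))
    (A B : 'M[R]_(m, p)) :
  f @ F --> A -> g @ F --> B -> (fun t => f t + g t) @ F --> A + B.
Proof. exact: cvgD. Qed.

Lemma cvg_submx (T : Type) (F : set_system T) {FF : Filter F} m p (f g : T -> 'M[R]_(m, p))
    (A B : 'M[R]_(m, p)) :
  f @ F --> A -> g @ F --> B -> (fun t => f t - g t) @ F --> A - B.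
Proof. exact: cvgB. Qed.

Lemma cvg_scalar_mx (T : Type) (F : set_system T) {FF : Filter F} m (f : T -> R) (a : R) :
  f @ F --> a -> (fun t => (f t)%:M : 'M[R]_m) @ F --> (a%:M : 'M[R]_m).
Proof.
move=> fa; apply/cvg_mxP => i j; rewrite mxE; under eq_fun do rewrite mxE.
by case: (i == j); [exact: fa | exact: cvg_cst].
Qed.

Lemma is_derive_mxP m p (f : R -> 'M[R]_(m, p)) (x : R) df :
  is_derive x 1 f df <-> forall i j, is_derive x 1 (fun t => f t i j) (df i j).
Proof.
split=> [[fx <-] i j|H].
  split; first by move/derivable_mxP: fx; exact.
  by rewrite derive_mx // mxE.
have fx : derivable f x 1 by apply/derivable_mxP => i j; case: (H i j).
split=> //; rewrite derive_mx //; apply/matrixP => i j; rewrite mxE.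
by case: (H i j).
Qed.

Lemma is_derive_mulmx m p q (f : R -> 'M[R]_(m, p)) (g : R -> 'M[R]_(p, q)) (x : R) df dg :
  is_derive x 1 f df -> is_derive x 1 g dg ->
  is_derive x 1 (fun t => f t *m g t) (df *m g x + f x *m dg).
Proof.
move=> /is_derive_mxP fx /is_derive_mxP gx; apply/is_derive_mxP => i j.
have -> : (fun t => (f t *m g t) i j)
    = \sum_(k < p) ((fun t => f t i k) * (fun t => g t k j)).
  by apply/funext => t; rewrite mxE fct_sumE.
rewrite !mxE -big_split /=.
have D k := is_deriveM (fx i k) (gx k j).
apply: (is_derive_eq (is_derive_sum D)).
by apply: eq_bigr => k _; rewrite addrC; congr (_ + _); exact: mulrC.
Qed.

Lemma is_derive_trmx m p (f : R -> 'M[R]_(m, p)) (x : R) df :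
  is_derive x 1 f df -> is_derive x 1 (fun t => (f t)^T) df^T.
Proof.
move=> /is_derive_mxP fx; apply/is_derive_mxP => i j; rewrite mxE.
by under eq_fun do rewrite mxE; exact: fx.
Qed.

(** g exp (- C Th) does not increase.  The rate is given with a primitive Th,
    so that no integral has to be formed. *)
Lemma gronwall (g dg Th e : R -> R) (C a b : R) : a <= b ->
  (forall x : R, is_derive x 1 g (dg x)) -> (forall x : R, is_derive x 1 Th (e x)) ->
  (forall x, a <= x <= b -> dg x <= C * e x * g x) ->
  g b <= g a * expR (C * (Th b - Th a)).
Proof.
move=> ab Dg DTh le_dg.
pose h x := g x * expR (- C * Th x).
have Dh (x : R) : is_derive x 1 h ((dg x - C * e x * g x) * expR (- C * Th x)).
  have ? := Dg x; have ? := DTh x.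
  apply: is_derive_eq; rewrite /GRing.scale /=; ring.
have hle : h b <= h a.
  apply: (@ler0_derive1_le_cc _ h a b) => //; rewrite ?bound_itvE //.
  - move=> x; rewrite in_itv /= => /andP[ax xb].
    rewrite derive1E derive_val mulr_le0_ge0 ?expR_ge0 // subr_le0.
    by apply: le_dg; rewrite !ltW.
  - apply: derivable_within_continuous => x _; by case: (Dh x).
have E : g b = h b * expR (C * Th b).
  by rewrite /h -mulrA -expRD mulNr addNr expR0 mulr1.
rewrite E mulrBr addrC expRD mulrA; apply: ler_wpM2r; first exact: expR_ge0.
by apply: le_trans hle _; rewrite /h mulNr.
Qed.

End MatrixAnalysis.

(** * An energy form adapted to a dominant eigenvalue *)

Section QuadraticForms.
Variables (R : realType) (m : nat).
Implicit Types (S : 'M[R]_m) (x y : 'cV[R]_m).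

Definition bform S x y : R := (x^T *m S *m y) 0 0.

Lemma bformDr S x y y' : bform S x (y + y') = bform S x y + bform S x y'.
Proof. by rewrite /bform mulmxDr mxE. Qed.

Lemma bformDm S S' x y : bform (S + S') x y = bform S x y + bform S' x y.
Proof. by rewrite /bform mulmxDr mulmxDl mxE. Qed.

Lemma bformC S x y : S^T = S -> bform S x y = bform S y x.
Proof.
move=> SS; rewrite /bform -[in RHS](trmxK (y^T *m S *m x)) [in RHS]mxE.
by rewrite !trmx_mul SS trmxK mulmxA.
Qed.

Lemma bform_le S x y : `|bform S x y| <= m%:R ^+ 2 * `|S| * (`|x| * `|y|).
Proof.
apply: le_trans (mx_entry_le_norm _ _ _) _; apply: le_trans (mulmx_norm_le _ _) _.
rewrite expr2 -!mulrA ler_wpM2l //.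
apply: (@le_trans _ _ (m%:R * (`|x^T| * `|S|) * `|y|)).
  by rewrite ler_wpM2r // mulmx_norm_le.
by rewrite trmx_norm -!mulrA ler_wpM2l // mulrCA.
Qed.

Lemma is_derive_bform S (d : R -> 'cV[R]_m) (d' : 'cV[R]_m) (t : R) : S^T = S ->
  is_derive t 1 d d' -> is_derive t 1 (fun s => bform S (d s) (d s)) (2 * bform S (d t) d').
Proof.
move=> SS Dd.
have DS : is_derive t 1 (fun s => (d s)^T *m S) (d'^T *m S).
  apply: is_derive_eq (is_derive_mulmx (is_derive_trmx Dd) (is_derive_cst S t 1)) _.
  by rewrite mulmx0 addr0.
have /is_derive_mxP/(_ 0 0) := is_derive_mulmx DS Dd.
move=> D; apply: (is_derive_eq D).
by rewrite mxE -!/(bform _ _ _) (bformC d') // mulr2n mulrDl mul1r.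
Qed.

End QuadraticForms.

Section Energy.
Variables (R : realType) (n : nat) (l0 : R).
Variables (Bm : R -> 'M[R]_n.+1) (mu : R -> R).
Variables (v : R -> 'cV[R]_n.+1) (w : R -> 'rV[R]_n.+1).
Local Notation cplx := (map_mx (@real_complex R)).

(** Subtracting mu puts the dominant eigenvalue at 0; subtracting the
    projection v w then moves it to -1, which makes the matrix stable. *)
Definition deflated l := Bm l - (mu l)%:M - v l *m w l.

(** The form is the square of the dominant coordinate w x plus a Lyapunov form
    S0 of the deflated matrix on the complementary part x - v w x.  Since
    w (Bm - mu) = 0, the first summand does not change along Bm - mu, which acts
    on the complementary part as the deflated matrix.  Only v and w
    vary with the parameter, S0 is taken at l0: its strict inequality survives
    a small change of the deflated matrix. *)
Lemma energy_form :
  (\forall l \near l0, [/\ Bm l *m v l = mu l *: v l, w l *m Bm l = mu l *: w l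
                        & w l *m v l = 1%:M]) ->
  {for l0, continuous Bm} -> {for l0, continuous mu} ->
  {for l0, continuous v} -> {for l0, continuous w} ->
  (forall nu, eigenvalue (cplx (deflated l0)) nu -> complex.Re nu < 0) ->
  exists (S : R -> 'M[R]_n.+1) (k K : R), [/\ 0 < k, 0 < K &
    \forall l \near l0, [/\ (S l)^T = S l,
      (forall x : 'cV_n.+1, k * `|x| ^+ 2 <= bform (S l) x x),
      (forall x y : 'cV_n.+1, `|bform (S l) x y| <= K * (`|x| * `|y|)) &
      (forall x, bform (S l) x ((Bm l - (mu l)%:M) *m x) <= 0)]].
Proof.
move=> eigen cB cmu cv cw stab.
have [S0 [k0 [k0_gt0 S0S S0P S0H]]] := lyapunov stab.
pose P l : 'M[R]_n.+1 := 1%:M - v l *m w l.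
pose S l : 'M[R]_n.+1 := (w l)^T *m w l + (P l)^T *m S0 *m P l.
have cvw : v l *m w l @[l --> l0] --> v l0 *m w l0 by exact: cvg_mulmx.
have cP : P l @[l --> l0] --> P l0 by apply: cvg_submx cvw; exact: cvg_cst.
have cS : S l @[l --> l0] --> S l0.
  apply: cvg_addmx; first exact: (cvg_mulmx (cvg_trmx cw) cw).
  exact: (cvg_mulmx (cvg_mulmx (cvg_trmx cP) (cvg_cst S0)) cP).
have cH : deflated l @[l --> l0] --> deflated l0.
  apply: cvg_submx cvw; apply: cvg_submx; first exact: cB.
  exact: cvg_scalar_mx.
have eigen0 := nbhs_singleton eigen.
have SE l x y : bform (S l) x y
    = (w l *m x) 0 0 * (w l *m y) 0 0 + bform S0 (P l *m x) (P l *m y).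
  rewrite /S bformDm /bform !trmx_mul !mulmxA; congr (_ + _).
  by rewrite -mulmxA -trmx_mul [LHS]mxE big_ord1 [(_^T) _ _]mxE.
(* Coercivity at l0: x is v l0 times its dominant coordinate plus the
   complementary part r, and both are controlled by the form. *)
pose V := `|v l0| ^+ 2 + k0^-1.
have V_gt0 : 0 < V by rewrite ltr_wpDl ?invr_gt0 // sqr_ge0.
pose k1 := (2 * V)^-1.
have k1_gt0 : 0 < k1 by rewrite invr_gt0 mulr_gt0.
have pos0 (x : 'cV[R]_n.+1) : k1 * `|x| ^+ 2 <= bform (S l0) x x.
  rewrite SE; set a := (w l0 *m x) 0 0; set r := P l0 *m x.
  have xE : x = v l0 *m (w l0 *m x) + r.
    by rewrite /r mulmxBl mul1mx mulmxA addrC subrK.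
  have nx : `|x| <= `|v l0| * `|a| + `|r|.
    rewrite {1}xE; apply: le_trans (ler_normD _ _) _; rewrite lerD2r.
    apply: le_trans (mulmx_norm_le _ _) _; rewrite mul1r ler_wpM2l //.
    by apply: mx_norm_leP => // i j; rewrite !ord1.
  have r2 := S0P r; rewrite -/(bform _ _ _) in r2.
  apply: (@le_trans _ _ (k1 * (2 * (`|v l0| ^+ 2 * a ^+ 2 + `|r| ^+ 2)))).
    rewrite ler_wpM2l ?(ltW k1_gt0) //.
    have : `|x| ^+ 2 <= (`|v l0| * `|a| + `|r|) ^+ 2.
      by apply: lerXn2r => //; rewrite ?nnegrE ?addr_ge0 ?mulr_ge0.
    have := sqr_ge0 (`|v l0| * `|a| - `|r|); rewrite -[a ^+ 2]real_normK ?num_real //.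
    rewrite sqrrB sqrrD exprMn; lra.
  apply: (@le_trans _ _ (a ^+ 2 + k0 * `|r| ^+ 2)); last by rewrite lerD2l.
  rewrite mulrCA /k1 invfM mulrA mulrA divff ?mul1r ?gt_eqF //.
  rewrite mulrC ler_pdivrMr // /V.
  have -> : (a ^+ 2 + k0 * `|r| ^+ 2) * (`|v l0| ^+ 2 + k0^-1) =
    `|v l0| ^+ 2 * a ^+ 2 + `|r| ^+ 2 + (a ^+ 2 * k0^-1 + k0 * `|r| ^+ 2 * `|v l0| ^+ 2).
    by field; rewrite gt_eqF.
  rewrite lerDl; apply: addr_ge0.
    by apply: mulr_ge0; rewrite ?sqr_ge0 // invr_ge0 ltW.
  by apply: mulr_ge0; rewrite ?sqr_ge0 //; apply: mulr_ge0; rewrite ?sqr_ge0 // ltW.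
pose N : R := n.+1%:R ^+ 2.
have N_gt0 : 0 < N by rewrite exprn_gt0.
exists S; exists (k1 / 2); exists (N * (`|S l0| + 1)).
have K_gt0 : 0 < N * (`|S l0| + 1) by rewrite mulr_gt0 // ltr_wpDl.
split=> //; first by rewrite divr_gt0.
(* e1 costs at most half of the coercivity constant k1, and e2 at most the
   decay constant k0 of the Lyapunov form. *)
pose e1 := Num.min 1 (k1 / 2 / N).
have e1_gt0 : 0 < e1 by rewrite lt_min ltr01 !divr_gt0.
pose e2 := k0 / (N * (`|S0| + 1) * n.+1%:R).
have e2_gt0 : 0 < e2 by rewrite divr_gt0 // !mulr_gt0 // ltr_wpDl.
have nS : \forall l \near l0, `|S l0 - S l| <= e1 by move/cvgrPdist_le: cS; exact.
have nH : \forall l \near l0, `|deflated l0 - deflated l| <= e2 by move/cvgrPdist_le: cH; exact.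
near=> l.
have Sl : `|S l0 - S l| <= e1 by near: l.
have Hl : `|deflated l0 - deflated l| <= e2 by near: l.
have [Bv wB wv] : [/\ Bm l *m v l = mu l *: v l, w l *m Bm l = mu l *: w l & w l *m v l = 1%:M].
  by near: l.
split.
- by rewrite /S linearD /= !trmx_mul !trmxK S0S mulmxA.
- move=> x; have {1}-> : bform (S l) x x = bform (S l0) x x - bform (S l0 - S l) x x.
    by rewrite /bform mulmxBr mulmxBl !mxE /=; ring.
  have : `|bform (S l0 - S l) x x| <= k1 / 2 * `|x| ^+ 2.
    apply: le_trans (bform_le _ _ _) _; rewrite -expr2 ler_wpM2r ?sqr_ge0 //.
    rewrite -/N mulrC -ler_pdivlMr //; apply: le_trans Sl _.
    by rewrite ge_min lexx orbT.
  move/ler_normlP => [_]; have := pos0 x; nra.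
- move=> x y; apply: le_trans (bform_le _ _ _) _; rewrite -/N ler_wpM2r ?mulr_ge0 //.
  rewrite ler_wpM2l ?(ltW N_gt0) //.
  have -> : S l = S l0 - (S l0 - S l) by rewrite opprB addrC subrK.
  apply: le_trans (ler_normB _ _) _; rewrite lerD2l; apply: le_trans Sl _.
  by rewrite ge_min lexx.
- move=> x; set Nl := Bm l - _.
  have wN : w l *m Nl = 0 by rewrite mulmxBr wB mul_mx_scalar subrr.
  have Nv : Nl *m v l = 0 by rewrite mulmxBl Bv mul_scalar_mx subrr.
  have PN : P l *m Nl = Nl by rewrite mulmxBl mul1mx -mulmxA wN mulmx0 subr0.
  have HP : deflated l *m P l = Nl.
    rewrite /deflated -/Nl /P mulmxBr mulmx1 mulmxBl mulmxA Nv mul0mx sub0r.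
    by rewrite mulmxA -[v l *m w l *m v l]mulmxA wv mulmx1 opprK subrK.
  rewrite SE mulmxA wN mul0mx [in X in _ * X]mxE mulr0 add0r mulmxA PN -HP -mulmxA.
  set r := P l *m x.
  have -> : deflated l *m r = deflated l0 *m r - (deflated l0 - deflated l) *m r.
    by rewrite (mulmxBl (deflated l0) (deflated l) r) opprB addrC subrK.
  rewrite bformDr; have := S0H r; rewrite -/(bform _ _ _) => h1.
  have : `|bform S0 r (- ((deflated l0 - deflated l) *m r))| <= k0 * `|r| ^+ 2.
    apply: le_trans (bform_le _ _ _) _; rewrite -/N normrN.
    apply: (@le_trans _ _ (N * `|S0| * (`|r| * (n.+1%:R * (e2 * `|r|))))).
      rewrite ler_wpM2l ?mulr_ge0 // ler_wpM2l //.
      apply: le_trans (mulmx_norm_le _ _) _.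
      by rewrite ler_wpM2l // ler_wpM2r.
    have -> : N * `|S0| * (`|r| * (n.+1%:R * (e2 * `|r|)))
      = (N * `|S0| * n.+1%:R * e2) * `|r| ^+ 2 by ring.
    rewrite ler_wpM2r ?sqr_ge0 // /e2 mulrA ler_pdivrMr; last by rewrite !mulr_gt0 // ltr_wpDl.
    rewrite mulrC ler_wpM2l ?(ltW k0_gt0) // ler_wpM2r // ler_wpM2l ?(ltW N_gt0) //.
    by rewrite lerDl.
  move/ler_normlP => [_]; lra.
Unshelve. all: by end_near. Qed.

End Energy.

(** * Solutions with prescribed exponential asymptotics *)

Section AdditiveIdentities.
Variable V : zmodType.
Implicit Types p q r s : V.

Lemma subr_trans_add p q r : p - r = (q - r) + (p - q).
Proof. by rewrite [RHS]addrC addrA subrK. Qed.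

Lemma subr_via p q r : p - q = (r - q) - (r - p).
Proof. by rewrite opprB [RHS]addrC addrA subrK. Qed.

Lemma subr_via2 p q r s : p - q = (p - r) - (s - r) - (q - s).
Proof. by rewrite !opprB !addrA !subrK. Qed.

End AdditiveIdentities.

Lemma mulmx_sub_split (T : pzRingType) m p q (G H : 'M[T]_(m, p)) (a b : 'M[T]_(p, q)) :
  G *m a - H *m b = H *m (a - b) + (G - H) *m a.
Proof. by rewrite mulmxBr mulmxBl addrC [RHS]addrC addrA subrK addrC. Qed.

Lemma continuous_joint (R : realType) (V : normedModType R) (u : R -> R -> V) (x0 l0 : R) :
  {for x0, continuous (u ^~ l0)} ->
  (forall e : R, 0 < e -> \forall l \near l0, forall x : R, x <= x0 + 1 -> `|u x l - u x l0| <= e) ->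
  {for (x0, l0), continuous (fun p : R * R => u p.1 p.2)}.
Proof.
move=> c0 H; apply/cvgrPdist_le => e e_gt0.
have e2 : 0 < e / 2 by rewrite divr_gt0.
have {}H := H _ e2.
have c1 : \forall t \near x0, `|u x0 l0 - u t l0| <= e / 2.
  by move/cvgrPdist_le: c0; exact.
have c2 : \forall x \near x0, x <= x0 + 1.
  by exists 1 => //= y /=; rewrite /ball_ /= => /ltr_normlP[]; lra.
exists ([set x | `|u x0 l0 - u x l0| <= e / 2] `&` [set x | x <= x0 + 1],
        [set l | forall x : R, x <= x0 + 1 -> `|u x l - u x l0| <= e / 2]).
  split=> //=; exact: filterI.
move=> [x l] /= [[h1 xx0] /(_ _ xx0) h2].
have -> : u x0 l0 - u x l = (u x0 l0 - u x l0) - (u x l - u x l0).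
  by rewrite opprB addrA subrK.
by apply: le_trans (ler_normB _ _) _; rewrite [leRHS]splitr lerD.
Qed.

Lemma cvg_joint_of_uniform (R : realType) (V : normedModType R) (u : R -> R -> V)
    (v : R -> V) (l0 : R) :
  {for l0, continuous v} ->
  (forall e : R, 0 < e -> exists T, \forall l \near l0, forall x : R, x <= T -> `|u x l - v l| <= e) ->
  (fun p : R * R => u p.1 p.2) @ filter_prod (-oo : set_system R) (nbhs l0) --> v l0.
Proof.
move=> cv H; apply/cvgrPdist_le => e e_gt0.
have e2 : 0 < e / 2 by rewrite divr_gt0.
have [T TP] := H _ e2.
have vl : \forall l \near l0, `|v l0 - v l| <= e / 2 by move/cvgrPdist_le: cv; exact.
exists ([set x : R | x <= T], [set l | (forall x : R, x <= T -> `|u x l - v l| <= e / 2)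
                                  /\ `|v l0 - v l| <= e / 2]).
  split=> /=; first by apply: nbhs_ninfty_le; exact: num_real.
  exact: filterI.
move=> [x l] /= [xT [/(_ _ xT) h1 h2]].
have -> : v l0 - u x l = (v l0 - v l) - (u x l - v l) by rewrite opprB addrA subrK.
by apply: le_trans (ler_normB _ _) _; rewrite [leRHS]splitr lerD.
Qed.

Section Asymptotics.
Variables (R : realType) (n : nat) (l0 : R).
Variables (B : R -> R -> 'M[R]_n.+1) (Bm : R -> 'M[R]_n.+1) (mu : R -> R).
Variables (v : R -> 'cV[R]_n.+1) (w : R -> 'rV[R]_n.+1).
Variables (z : R -> R -> 'cV[R]_n.+1) (Th : R -> R -> R).
Local Notation cplx := (map_mx (@real_complex R)).

(** The factor turns growth like exp (mu x) at -oo into convergence, and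
    replaces the limit matrix Bm by Bm - mu. *)
Definition rescaled x l : 'cV[R]_n.+1 := expR (- mu l * x) *: z x l.
Local Notation u := rescaled.

Hypothesis eigen : \forall l \near l0,
  [/\ Bm l *m v l = mu l *: v l, w l *m Bm l = mu l *: w l & w l *m v l = 1%:M].
Hypotheses (cBm : {for l0, continuous Bm}) (cmu : {for l0, continuous mu}).
Hypotheses (cv : {for l0, continuous v}) (cw : {for l0, continuous w}).
Hypothesis stab : forall nu,
  eigenvalue (cplx (deflated Bm mu v w l0)) nu -> complex.Re nu < 0.
Hypothesis cB : forall x, {for (x, l0), continuous (fun p : R * R => B p.1 p.2)}.
Hypothesis sol : \forall l \near l0,
  (forall x : R, is_derive x 1 (z ^~ l) (B x l *m z x l)) /\ u ^~ l @ -oo --> v l.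
Hypothesis DTh : \forall l \near l0,
  forall x : R, is_derive x 1 (Th ^~ l) `|B x l - Bm l|.
Hypothesis smallTh : forall e, 0 < e -> exists T, \forall l \near l0,
  forall a b, a <= b -> b <= T -> Th b l - Th a l <= e.

Lemma is_derive_rescaled l (x : R) :
  is_derive x 1 (z ^~ l) (B x l *m z x l) ->
  is_derive x 1 (u ^~ l) ((B x l - (mu l)%:M) *m u x l).
Proof.
move=> /is_derive_mxP Dz; apply/is_derive_mxP => i j.
rewrite (_ : (fun t => _) = (fun t => expR (- mu l * t)) * (fun t => z t l i j));
  last by apply/funext => t; rewrite mxE.
have De : is_derive x 1 (fun t => expR (- mu l * t)) (- mu l * expR (- mu l * x)).
  by apply: is_derive_eq; rewrite /GRing.scale /=; ring.
apply: (is_derive_eq (is_deriveM De (Dz i j))).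
rewrite mulmxBl mul_scalar_mx /u -scalemxAr !mxE /GRing.scale /=; ring.
Qed.

(** The energy of u - v is at most K |u - v|^2 and its derivative is controlled
    by |B - Bm| times (energy + 1), since Bm - mu does not increase it and
    annihilates v; the summand 1 absorbs the forcing (B - Bm) v.  The energy
    tends to 0 at -oo, and the integral of |B - Bm| up to T is small uniformly
    in the parameter, so Gronwall keeps the energy small up to T. *)
Lemma rescaled_cvg_uniform e : 0 < e -> exists T, \forall l \near l0,
  forall x, x <= T -> `|u x l - v l| <= e.
Proof.
move=> e_gt0; have [S [k [K [k_gt0 K_gt0 form]]]] := energy_form eigen cBm cmu cv cw stab.
pose m : R := n.+1%:R; pose V := `|v l0| + 1.
pose C := 2 * (K * m * (2 / k + V ^+ 2)).
have C_gt0 : 0 < C by rewrite !mulr_gt0 // ltr_pwDl ?divr_gt0 // sqr_ge0.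
(* The energy starts below d and the integral of the rate is at most d, so
   energy + 1 ends below (1 + d) exp (C d). *)
have [d d_gt0 dP] : exists2 d : R, 0 < d & (1 + d) * expR (C * d) <= 1 + k * e ^+ 2.
  have c0 : (fun d => (1 + d) * expR (C * d)) x @[x --> (0 : R)] --> (1 + 0 : R) * expR (C * 0).
    apply: cvgM; first by apply: cvgD; [exact: cvg_cst|exact: cvg_id].
    apply: (@continuous_comp _ _ _ (fun d : R => C * d) expR); last exact: continuous_expR.
    exact: (cvgM (cvg_cst _) cvg_id).
  have ke : 0 < k * e ^+ 2 by rewrite mulr_gt0 // exprn_gt0.
  have [d /= d_gt0 dP] := (cvgrPdist_le _ _).1 c0 _ ke.
  exists (d / 2); rewrite ?divr_gt0 //.
  have := dP (d / 2); rewrite /ball_/= sub0r normrN gtr0_norm ?divr_gt0 //.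
  rewrite ltr_pdivrMr // ltr_pMr // ltr1n => /(_ isT).
  rewrite mulr0 expR0 mulr1 addr0 => /ler_normlP [+ _]; lra.
have [T smallT] := smallTh d_gt0.
exists T; near=> l => x xT.
have [Bv _ _] : [/\ Bm l *m v l = mu l *: v l, w l *m Bm l = mu l *: w l & w l *m v l = 1%:M].
  by near: l.
have [Dz uv] : (forall x : R, is_derive x 1 (z ^~ l) (B x l *m z x l)) /\ u ^~ l @ -oo --> v l.
  by near: l.
have Dth : forall x : R, is_derive x 1 (Th ^~ l) `|B x l - Bm l| by near: l.
have smallTl : forall a b, a <= b -> b <= T -> Th b l - Th a l <= d by near: l.
have vV : `|v l| <= V.
  have : `|v l0 - v l| <= 1 by near: l; move/cvgrPdist_le: cv; exact.
  move=> h; have -> : v l = v l0 - (v l0 - v l) by rewrite opprB addrC subrK.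
  by apply: le_trans (ler_normB _ _) _; rewrite lerD2l.
have [SS Spos Sle Sdis] : [/\ (S l)^T = S l,
      (forall x : 'cV_n.+1, k * `|x| ^+ 2 <= bform (S l) x x),
      (forall x y : 'cV_n.+1, `|bform (S l) x y| <= K * (`|x| * `|y|)) &
      (forall x, bform (S l) x ((Bm l - (mu l)%:M) *m x) <= 0)] by near: l.
pose dd (t : R) : 'cV[R]_n.+1 := u t l - v l.
pose f (t : R) : R := bform (S l) (dd t) (dd t).
have Dd (t : R) : is_derive t 1 dd ((B t l - (mu l)%:M) *m u t l).
  have D := is_derive_rescaled (Dz t).
  by apply: (is_derive_eq (is_deriveB D (is_derive_cst (v l) t 1))); rewrite subr0.
have Df (t : R) : is_derive t 1 (fun t => f t + 1)
    (2 * bform (S l) (dd t) ((B t l - (mu l)%:M) *m u t l)).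
  apply: (is_derive_eq (is_deriveD (is_derive_bform SS (Dd t)) (is_derive_cst (1 : R) t 1))).
  by rewrite addr0.
have split_rhs (t : R) : (B t l - (mu l)%:M) *m u t l
    = (Bm l - (mu l)%:M) *m dd t + (B t l - Bm l) *m u t l.
  have Nv : (Bm l - (mu l)%:M) *m v l = 0 by rewrite mulmxBl Bv mul_scalar_mx subrr.
  rewrite /dd (mulmxBr (Bm l - (mu l)%:M)) Nv subr0 -mulmxDl; congr (_ *m _).
  by rewrite [RHS]addrC addrA subrK.
have bound (t : R) : 2 * bform (S l) (dd t) ((B t l - (mu l)%:M) *m u t l)
    <= C * `|B t l - Bm l| * (f t + 1).
  rewrite split_rhs bformDr; set E := B t l - Bm l.
  have h1 := Sdis (dd t).
  have h2 : bform (S l) (dd t) (E *m u t l) <= K * (`|dd t| * (m * (`|E| * (`|dd t| + V)))).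
    apply: le_trans (ler_norm _) _; apply: le_trans (Sle _ _) _.
    rewrite ler_wpM2l ?(ltW K_gt0) // ler_wpM2l //.
    apply: le_trans (mulmx_norm_le _ _) _; rewrite -/m ler_wpM2l // ler_wpM2l //.
    have -> : u t l = dd t + v l by rewrite subrK.
    by apply: le_trans (ler_normD _ _) _; rewrite lerD2l.
  have h3 := Spos (dd t); rewrite -/(f t) in h3.
  have h4 : `|dd t| * (`|dd t| + V) <= (2 / k + V ^+ 2) * (f t + 1).
    have a0 : `|dd t| ^+ 2 <= f t / k by rewrite ler_pdivlMr // mulrC.
    have f0 : 0 <= f t by apply: le_trans h3; rewrite mulr_ge0 ?sqr_ge0 // ltW.
    have ki : 0 <= k^-1 by rewrite invr_ge0 ltW.
    have := sqr_ge0 (`|dd t| - V); rewrite sqrrB => h5.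
    have -> : (2 / k + V ^+ 2) * (f t + 1) = 2 * (f t / k) + 2 * k^-1 + V ^+ 2 * f t + V ^+ 2 by ring.
    have := mulr_ge0 (sqr_ge0 V) f0; have := sqr_ge0 `|dd t|; have := sqr_ge0 V.
    rewrite mulrDr -expr2; lra.
  have KmE : 0 <= 2 * (K * m * `|E|) by rewrite !mulr_ge0 // ltW.
  have := ler_wpM2l KmE h4; rewrite /C; lra.
have nda : \forall t \near (-oo : set_system R), `|dd t| <= Num.min 1 (d / K).
  have p : 0 < Num.min 1 (d / K) by rewrite lt_min ltr01 divr_gt0.
  by move/cvgrPdistC_le: uv; exact.
(* The starting point of the Gronwall estimate, depending on the parameter. *)
near (-oo : set_system R) => a.
have ax : a <= x by near: a; apply: nbhs_ninfty_le; exact: num_real.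
have da : `|dd a| <= Num.min 1 (d / K) by near: a.
have fa : f a <= d.
  have : `|f a| <= K * (`|dd a| * `|dd a|) by exact: Sle.
  move/ler_normlP => [_ h]; apply: le_trans h _.
  have d1 : `|dd a| <= 1 by apply: le_trans da _; rewrite ge_min lexx.
  have d2 : `|dd a| <= d / K by apply: le_trans da _; rewrite ge_min lexx orbT.
  have -> : d = K * (1 * (d / K)) by field; rewrite gt_eqF.
  by rewrite ler_wpM2l ?(ltW K_gt0) // ler_pM.
have G := gronwall ax Df Dth (fun t _ => bound t).
have Gx : f x + 1 <= (1 + d) * expR (C * d).
  have f0 : 0 <= f a by apply: le_trans (Spos _); rewrite mulr_ge0 ?sqr_ge0 // ltW.
  apply: le_trans G _; apply: ler_pM.
  - exact: addr_ge0.
  - exact: expR_ge0.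
  - by rewrite [leRHS]addrC lerD2r.
  - by rewrite ler_expR ler_wpM2l ?(ltW C_gt0) //; exact: smallTl.
have : k * `|dd x| ^+ 2 <= k * e ^+ 2 by have := Spos (dd x); rewrite -/(f x); lra.
by rewrite ler_pM2l // ler_pXn2r ?nnegrE // ltW.
Unshelve. all: by end_near. Qed.

Lemma rescaled_bounded x1 : exists U, forall x, x <= x1 -> `|u x l0| <= U.
Proof.
have [T HT] := rescaled_cvg_uniform (@ltr01 R).
have {}HT := nbhs_singleton HT.
have [Dz _] := nbhs_singleton sol.
have [xT|Tx] := leP x1 T.
  exists (`|v l0| + 1) => x xx1; have -> : u x l0 = v l0 + (u x l0 - v l0) by rewrite addrC subrK.
  by apply: le_trans (ler_normD _ _) _; rewrite lerD2l HT // (le_trans xx1).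
have cu : {within `[T, x1], continuous (fun x => `|u x l0|)}.
  apply: continuous_subspaceT => x; apply: continuous_comp; last exact: norm_continuous.
  apply/differentiable_continuous/derivable1_diffP.
  by case: (is_derive_rescaled (Dz x)).
have [c _ cP] := EVT_max (ltW Tx) cu.
exists (Num.max (`|v l0| + 1) `|u c l0|) => x xx1.
have [xT|/ltW xT] := leP x T; rewrite le_max; apply/orP; [left|right].
  have -> : u x l0 = v l0 + (u x l0 - v l0) by rewrite addrC subrK.
  by apply: le_trans (ler_normD _ _) _; rewrite lerD2l HT.
by apply: cP; rewrite in_itv /= xT.
Qed.

Lemma continuous_near_compact a b e : 0 < e -> \forall l \near l0,
  forall x, a <= x <= b -> `|B x l - (mu l)%:M - (B x l0 - (mu l0)%:M)| <= e.
Proof.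
move=> e_gt0.
have /compact_near_coveringP cov : compact `[a, b] by exact: segment_compact.
have : \forall l \near l0, `[a, b] `<=` (fun x =>
     `|B x l - (mu l)%:M - (B x l0 - (mu l0)%:M)| <= e).
  apply: (cov _ (nbhs l0) (fun l x => `|B x l - (mu l)%:M - (B x l0 - (mu l0)%:M)| <= e)).
  move=> x _.
  pose G (p : R * R) := B p.1 p.2 - (mu p.2)%:M.
  have cG : G p @[p --> (x, l0)] --> G (x, l0).
    apply: cvg_submx; first exact: cB.
    apply: cvg_scalar_mx; apply: (@cvg_comp _ _ _ snd mu); last exact: cmu.
    exact: cvg_snd.
  have e2 : 0 < e / 2 by rewrite divr_gt0.
  have [[P Q] /= [Px Ql] PQ] := (cvgrPdist_le _ _).1 cG _ e2.
  exists (P, Q) => // -[y l] /= [Py Ql'].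
  have h1 := PQ (y, l) (conj Py Ql').
  have h2 := PQ (y, l0) (conj Py (nbhs_singleton Ql)).
  rewrite /G /= in h1 h2; move: h1 h2.
  set p := B y l - _; set q := B y l0 - _; set r := B x l0 - _ => h1 h2.
  rewrite (subr_via p q r).
  by apply: le_trans (ler_normB _ _) _; rewrite [leRHS]splitr lerD.
by apply: filterS => l H x xab; apply: H; rewrite /= in_itv.
Qed.

(** Up to some T2 both solutions are close to their limits at -oo, which are
    close to each other.  On [T2, x1] the coefficients at l and l0 are uniformly
    close, and Gronwall bounds the energy, at l0, of the difference. *)
Lemma rescaled_continuous_uniform x1 e : 0 < e -> \forall l \near l0,
  forall x, x <= x1 -> `|u x l - u x l0| <= e.
Proof.
move=> e_gt0; have [S [k [K [k_gt0 K_gt0 form]]]] := energy_form eigen cBm cmu cv cw stab.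
have [SS Spos Sle Sdis] := nbhs_singleton form.
have [Dz0 _] := nbhs_singleton sol.
have Dth := nbhs_singleton DTh.
have [U0 U0P] := rescaled_bounded x1.
pose U := Num.max 0 U0.
have U_ge0 : 0 <= U by rewrite le_max lexx.
have UP x : x <= x1 -> `|u x l0| <= U by move=> /U0P h; rewrite le_max h orbT.
pose m : R := n.+1%:R; pose C := 2 * (K * m * (2 / k + U ^+ 2 + 1)).
have C_gt0 : 0 < C.
  by rewrite !mulr_gt0 // ltr_wpDl // addr_ge0 ?sqr_ge0 // divr_ge0 // ltW.
have [T0 /nbhs_singleton T0P] := smallTh (@ltr01 R).
pose M := Th x1 l0 - Th T0 l0 + 1.
(* M bounds the integral of |B - Bm| at l0 from T2 to x1, and the extra rate
   tau integrates to at most 1, so X bounds the Gronwall factor. *)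
pose X := expR (C * (M + 1)).
(* The slack s is added to the energy in order to absorb the forcing that comes
   from the difference of the coefficients; this forcing is at most s tau. *)
pose s := Num.min 1 (k * e ^+ 2 / (2 * X)).
have X_gt0 : 0 < X by exact: expR_gt0.
have s_gt0 : 0 < s by rewrite lt_min ltr01 divr_gt0 // mulr_gt0 // exprn_gt0.
pose d := Num.min (e / 3) (Num.min 1 (s / K) / 3).
have d_gt0 : 0 < d by rewrite lt_min !divr_gt0 // lt_min ltr01 divr_gt0.
have [T1 T1P] := rescaled_cvg_uniform d_gt0.
pose T2 := Num.min (Num.min T0 T1) x1.
have T20 : T2 <= T0 by rewrite !ge_min lexx.
have T21 : T2 <= T1 by rewrite !ge_min lexx orbT.
have T2x1 : T2 <= x1 by rewrite ge_min lexx orbT.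
pose tau := (x1 - T2 + 1)^-1.
have tau_gt0 : 0 < tau by rewrite invr_gt0 ltr_wpDl // subr_ge0.
have rho_gt0 : 0 < s * tau by rewrite mulr_gt0.
have T1P0 := nbhs_singleton T1P.
have nG := continuous_near_compact T2 x1 rho_gt0.
near=> l.
have [Dz _] : (forall x : R, is_derive x 1 (z ^~ l) (B x l *m z x l)) /\ u ^~ l @ -oo --> v l.
  by near: l.
have T1Pl : forall x, x <= T1 -> `|u x l - v l| <= d by near: l.
have vl : `|v l0 - v l| <= d by near: l; move/cvgrPdist_le: cv; exact.
have Gl : forall x, T2 <= x <= x1 -> `|B x l - (mu l)%:M - (B x l0 - (mu l0)%:M)| <= s * tau.
  by near: l.
have left_small x : x <= T2 -> `|u x l - u x l0| <= 3 * d.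
  move=> xT; have xT1 := le_trans xT T21.
  rewrite (subr_via2 _ _ (v l) (v l0)).
  have := ler_normB (u x l - v l - (v l0 - v l)) (u x l0 - v l0).
  have := ler_normB (u x l - v l) (v l0 - v l).
  have := T1Pl _ xT1; have := T1P0 _ xT1; lra.
move=> x xx1; have [xT|/ltW Tx] := leP x T2.
  apply: le_trans (left_small _ xT) _.
  by rewrite mulrC -ler_pdivlMr // ge_min lexx.
pose dd (t : R) : 'cV[R]_n.+1 := u t l - u t l0.
pose f (t : R) : R := bform (S l0) (dd t) (dd t).
pose G0 (t : R) := B t l0 - (mu l0)%:M.
pose DG (t : R) := B t l - (mu l)%:M - G0 t.
have Dd (t : R) : is_derive t 1 dd (G0 t *m dd t + DG t *m u t l).
  apply: (is_derive_eq (is_deriveB (is_derive_rescaled (Dz t)) (is_derive_rescaled (Dz0 t)))).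
  exact: mulmx_sub_split.
have Df (t : R) : is_derive t 1 (fun t => f t + s)
    (2 * bform (S l0) (dd t) (G0 t *m dd t + DG t *m u t l)).
  apply: (is_derive_eq (is_deriveD (is_derive_bform SS (Dd t)) (is_derive_cst (s : R) t 1))).
  by rewrite addr0.
have DTh' (t : R) : is_derive t 1 (fun t => Th t l0 + tau * t) (`|B t l0 - Bm l0| + tau).
  have ? := Dth t; apply: is_derive_eq; rewrite /GRing.scale /=; ring.
have bound (t : R) : T2 <= t <= x ->
    2 * bform (S l0) (dd t) (G0 t *m dd t + DG t *m u t l)
    <= C * (`|B t l0 - Bm l0| + tau) * (f t + s).
  move=> /andP[Tt tx]; have tx1 := le_trans tx xx1.
  rewrite bformDr /G0; set E := B t l0 - Bm l0.
  have -> : B t l0 - (mu l0)%:M = (Bm l0 - (mu l0)%:M) + E.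
    exact: subr_trans_add.
  rewrite mulmxDl bformDr.
  have h1 := Sdis (dd t).
  have h2 : bform (S l0) (dd t) (E *m dd t) <= K * (`|dd t| * (m * (`|E| * `|dd t|))).
    apply: le_trans (ler_norm _) _; apply: le_trans (Sle _ _) _.
    by rewrite ler_wpM2l ?(ltW K_gt0) // ler_wpM2l // mulmx_norm_le.
  have h2' : bform (S l0) (dd t) (DG t *m u t l)
      <= K * (`|dd t| * (m * (s * tau * (`|dd t| + U)))).
    apply: le_trans (ler_norm _) _; apply: le_trans (Sle _ _) _.
    rewrite ler_wpM2l ?(ltW K_gt0) // ler_wpM2l //.
    apply: le_trans (mulmx_norm_le _ _) _; rewrite -/m ler_wpM2l //.
    apply: ler_pM => //; first by apply: Gl; rewrite Tt.
    have -> : u t l = dd t + u t l0 by rewrite subrK.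
    by apply: le_trans (ler_normD _ _) _; rewrite lerD2l UP.
  have h3 := Spos (dd t); rewrite -/(f t) in h3.
  have a0 : `|dd t| ^+ 2 <= f t / k by rewrite ler_pdivlMr // mulrC.
  have f0 : 0 <= f t by apply: le_trans h3; rewrite mulr_ge0 ?sqr_ge0 // ltW.
  have U20 := sqr_ge0 U; have d20 := sqr_ge0 `|dd t|.
  have ki : 0 < k^-1 by rewrite invr_gt0.
  have h4 : `|dd t| ^+ 2 <= (2 / k + U ^+ 2 + 1) * (f t + s).
    have -> : (2 / k + U ^+ 2 + 1) * (f t + s)
      = 2 * (f t / k) + 2 * (k^-1 * s) + (U ^+ 2 * f t + U ^+ 2 * s) + f t + s by ring.
    have := mulr_ge0 U20 f0; have := mulr_ge0 U20 (ltW s_gt0).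
    have := mulr_gt0 ki s_gt0; lra.
  have h5 : s * (`|dd t| * (`|dd t| + U)) <= (2 / k + U ^+ 2 + 1) * (f t + s).
    apply: (@le_trans _ _ (s * (2 * (f t / k) + U ^+ 2))).
      rewrite ler_wpM2l ?(ltW s_gt0) //.
      have := sqr_ge0 (`|dd t| - U); rewrite sqrrB mulrDr -expr2; lra.
    have s1 : s <= 1 by rewrite ge_min lexx.
    have -> : (2 / k + U ^+ 2 + 1) * (f t + s)
      = 2 * (f t / k) + 2 * (k^-1 * s) + (U ^+ 2 * f t + U ^+ 2 * s) + f t + s by ring.
    have := mulr_ge0 U20 f0; have := mulr_gt0 ki s_gt0.
    have fk : 0 <= f t / k by rewrite mulr_ge0 // ltW.
    have := ler_wpM2r fk s1; lra.
  have Km : 0 <= 2 * (K * m) by rewrite !mulr_ge0 // ltW.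
  have := ler_wpM2l (mulr_ge0 Km (normr_ge0 E)) h4.
  have := ler_wpM2l (mulr_ge0 Km (ltW tau_gt0)) h5.
  rewrite /C; lra.
have G := gronwall Tx Df DTh' bound.
have fT : f T2 <= s.
  have : `|f T2| <= K * (`|dd T2| * `|dd T2|) by exact: Sle.
  move/ler_normlP => [_ h]; apply: le_trans h _.
  have := left_small _ (lexx T2); rewrite -/(dd T2) => h.
  have da : `|dd T2| <= Num.min 1 (s / K).
    apply: le_trans h _; rewrite mulrC -ler_pdivlMr //.
    by rewrite ge_min lexx orbT.
  have d1 : `|dd T2| <= 1 by apply: le_trans da _; rewrite ge_min lexx.
  have d2 : `|dd T2| <= s / K by apply: le_trans da _; rewrite ge_min lexx orbT.
  have -> : s = K * (1 * (s / K)) by field; rewrite gt_eqF.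
  by rewrite ler_wpM2l ?(ltW K_gt0) // ler_pM.
have f0 : 0 <= f T2 by apply: le_trans (Spos _); rewrite mulr_ge0 ?sqr_ge0 // ltW.
have Th_mono a b : a <= b -> Th a l0 <= Th b l0.
  move=> ab; apply: (@ger0_derive1_le_cc _ (Th ^~ l0) a b); rewrite ?bound_itvE //.
  - by move=> t _; rewrite derive1E derive_val.
  - by apply: derivable_within_continuous => t _; case: (Dth t).
have Gx : f x + s <= 2 * s * X.
  apply: le_trans G _; apply: ler_pM.
  - by rewrite addr_ge0 // ltW.
  - exact: expR_ge0.
  - lra.
  - rewrite ler_expR ler_wpM2l ?(ltW C_gt0) //.
    have h1 := Th_mono _ _ xx1; have h2 := T0P _ _ T20 (lexx T0).
    have h3 : tau * (x - T2) <= 1.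
      rewrite mulrC ler_pdivrMr ?mul1r; first by lra.
      by rewrite ltr_wpDl // subr_ge0.
    rewrite /M; lra.
have sX : 2 * s * X <= k * e ^+ 2.
  have : s <= k * e ^+ 2 / (2 * X) by rewrite ge_min lexx orbT.
  rewrite ler_pdivlMr ?mulr_gt0 //; lra.
have : k * `|dd x| ^+ 2 <= k * e ^+ 2 by have := Spos (dd x); rewrite -/(f x); lra.
by rewrite ler_pM2l // ler_pXn2r ?nnegrE // ltW.
Unshelve. all: by end_near. Qed.

Lemma rescaled_cvg_joint :
  (fun p : R * R => u p.1 p.2) @ filter_prod (-oo : set_system R) (nbhs l0) --> v l0.
Proof. exact: cvg_joint_of_uniform cv rescaled_cvg_uniform. Qed.

(** Continuity of u in the parameter is uniform for x <= x0 + 1, which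
    together with continuity in x gives joint continuity. *)
Lemma solution_continuous_joint x0 :
  {for (x0, l0), continuous (fun p : R * R => z p.1 p.2)}.
Proof.
have [Dz _] := nbhs_singleton sol.
have cu : (fun p : R * R => u p.1 p.2) @ (x0, l0) --> u x0 l0.
  apply: continuous_joint => [|e]; last exact: rescaled_continuous_uniform.
  apply/differentiable_continuous/derivable1_diffP.
  by case: (is_derive_rescaled (Dz x0)).
have zE x l : z x l = expR (mu l * x) *: u x l.
  by rewrite /u scalerA -expRD mulNr addrN expR0 scale1r.
have cmu2 : (fun p : R * R => mu p.2) @ (x0, l0) --> mu l0.
  by apply: (@cvg_comp _ _ _ snd mu); [exact: cvg_snd | exact: cmu].
have ce : (fun p : R * R => expR (mu p.2 * p.1)) @ (x0, l0) --> expR (mu l0 * x0).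
  apply: (@continuous_cvg _ _ _ (nbhs (x0, l0)) _ (fun p : R * R => mu p.2 * p.1) expR).
    exact: continuous_expR.
  by apply: cvgM => //; exact: cvg_fst.
have E : (fun p : R * R => z p.1 p.2) = (fun p : R * R => expR (mu p.2 * p.1) *: u p.1 p.2).
  by apply/funext => -[x l]; exact: zE.
rewrite E; exact: (cvgZ ce cu).
Qed.

End Asymptotics.

(** * Primitives and tails of continuous functions *)

Section OrientedIntegral.
Variable R : realType.
Notation mu := (@lebesgue_measure R).
Implicit Types f g : R -> R.

Lemma continuous_itv_integrable f a b : continuous f ->
  mu.-integrable `[a, b] (EFin \o f).
Proof.
move=> cf; apply: continuous_compact_integrable; first exact: segment_compact.
exact: continuous_subspaceT.
Qed.

Lemma Rintegral_itv_sub f c a b : continuous f -> c <= a -> a <= b ->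
  \int[mu]_(t in `[c, b]) f t - \int[mu]_(t in `[c, a]) f t = \int[mu]_(t in `[a, b]) f t.
Proof.
move=> cf ca ab; rewrite Rintegral_itvB ?bnd_simp //; last exact: continuous_itv_integrable.
rewrite Rintegral_itv_obnd_cbnd //.
apply: integrableS (continuous_itv_integrable a b cf) => //.
by move=> t /=; rewrite !in_itv /= => /andP[/ltW -> ->].
Qed.

Lemma oriented_integral0E f c y : continuous f -> c <= 0 -> c <= y ->
  oriented_integral 0 y f
  = \int[mu]_(t in `[c, y]) f t - \int[mu]_(t in `[c, 0]) f t.
Proof.
move=> cf c0 cy; rewrite /oriented_integral.
case: ifPn => [y0|]; first by rewrite Rintegral_itv_sub.
by rewrite -ltNge => /ltW y0; rewrite -(@Rintegral_itv_sub _ c) // opprB.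
Qed.

Lemma oriented_integralB f a b : continuous f -> a <= b ->
  oriented_integral 0 b f - oriented_integral 0 a f = \int[mu]_(t in `[a, b]) f t.
Proof.
move=> cf ab; pose c := Num.min a 0.
have ca : c <= a by rewrite ge_min lexx.
have c0 : c <= 0 by rewrite ge_min lexx orbT.
have cb := le_trans ca ab.
rewrite (@oriented_integral0E _ c b) // (@oriented_integral0E _ c a) //.
by rewrite opprB addrA subrK Rintegral_itv_sub.
Qed.

(** Measured from a point c below both 0 and x, the oriented integral is an
    ordinary one up to a constant. *)
Lemma is_derive_oriented_integral f (x : R) : continuous f ->
  is_derive x 1 (fun y => oriented_integral 0 y f) (f x).
Proof.
move=> cf; pose c := Num.min x 0 - 1.
have cx : c < x by rewrite ltrBlDr (le_lt_trans (y := x)) ?ge_min ?lexx // ltrDl.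
have c0 : c <= 0 by rewrite lerBlDr (le_trans (y := 0)) ?ge_min ?lexx ?orbT // add0r.
have xx1 : x < x + 1 by rewrite ltrDl.
have [dF dFE] := continuous_FTC1_closed xx1
  (continuous_itv_integrable c (x + 1) cf) cx (cf x).
have D : is_derive x 1 (fun y => \int[mu]_(t in `[c, y]) f t - \int[mu]_(t in `[c, 0]) f t) (f x).
  apply: (is_derive_eq (is_deriveB (DeriveDef dF erefl) (is_derive_cst _ x 1))).
  by rewrite subr0 -derive1E dFE.
apply: near_eq_is_derive D.
exists (x - c); rewrite /= ?subr_gt0 // => y /ltr_normlP[_ xy].
by rewrite (@oriented_integral0E _ c) //; lra.
Qed.

Lemma integral_itv_le_tail f g (S : set R) a b e :
  continuous f -> measurable S -> measurable_fun S g -> `[a, b] `<=` S ->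
  (forall x, 0 <= f x) -> (forall x, S x -> 0 <= g x) ->
  (forall x, a <= x <= b -> f x <= g x) ->
  (\int[mu]_(x in S) (g x)%:E <= e%:E)%E ->
  \int[mu]_(t in `[a, b]) f t <= e.
Proof.
move=> cf mS mg abS f0 g0 fg ge; rewrite -lee_fin.
have fi := continuous_itv_integrable a b cf.
rewrite /Rintegral fineK; last exact: integrable_fin_num.
apply: le_trans ge; apply: (@le_trans _ _ (\int[mu]_(x in `[a, b]) (g x)%:E)%E).
  apply: ge0_le_integral => //.
  - by move=> t _; rewrite lee_fin.
  - exact: (measurable_int mu) fi.
  - by apply/measurable_EFinP; apply: measurable_funS mg.
apply: ge0_subset_integral => //.
  exact/measurable_EFinP.
Qed.

End OrientedIntegral.

(** * Real parts of complex matrices *)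

Section RealParts.
Variable R : realType.

Lemma normc_ge_Im (z : R[i]) : `|complex.Im z|%:C <= `|z|.
Proof.
case: z => a b; rewrite normc_def /= lecR -sqrtr_sqr ler_wsqrtr //.
by rewrite lerDr sqr_ge0.
Qed.

Lemma norm_real_complex (x : R) : `|x%:C| = `|x|%:C.
Proof. by rewrite normc_def /= expr0n /= addr0 sqrtr_sqr. Qed.

Lemma Re_lipschitz (a b : R[i]) (e : R) : `|a - b| <= e%:C ->
  `|complex.Re a - complex.Re b| <= e.
Proof.
move=> h; rewrite -lecR; apply: le_trans h; rewrite -raddfB.
exact: normc_ge_Re.
Qed.

Section Limits.
Variables (T : Type) (F : set_system T).
Context {FF : Filter F}.

Lemma cvg_Re (f : T -> R[i]^o) (a : R[i]^o) : f @ F --> a ->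
  (fun t => complex.Re (f t)) @ F --> complex.Re a.
Proof.
move=> fa; apply/cvgrPdist_le => e e0.
have e0' : 0 < e%:C by rewrite ltcR.
move/cvgrPdist_le: fa => /(_ _ e0').
by apply: filterS => t; exact: Re_lipschitz.
Qed.

Lemma cvg_Im (f : T -> R[i]^o) (a : R[i]^o) : f @ F --> a ->
  (fun t => complex.Im (f t)) @ F --> complex.Im a.
Proof.
move=> fa; apply/cvgrPdist_le => e e0.
have e0' : 0 < e%:C by rewrite ltcR.
move/cvgrPdist_le: fa => /(_ _ e0').
apply: filterS => t h; rewrite -lecR; apply: le_trans h; rewrite -raddfB.
exact: normc_ge_Im.
Qed.

Lemma cvg_real_complex (f : T -> R) (a : R) : f @ F --> a ->
  (fun t => (f t)%:C : R[i]^o) @ F --> (a%:C : R[i]^o).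
Proof.
move=> fa; apply/cvgrPdist_le => -[e e'] e0.
have [e0' ee] : 0 < e /\ e' = 0 by move: e0; rewrite ltcE /= => /andP[/eqP <-].
move/cvgrPdist_le: fa => /(_ _ e0').
apply: filterS => t h; rewrite ee -[e +i* 0]/(e%:C).
rewrite (_ : (a%:C : R[i]^o) - (f t)%:C = (a - f t)%:C); last by rewrite raddfB.
by rewrite norm_real_complex lecR.
Qed.

Lemma cvg_entry m n (f : T -> 'M[R[i]^o]_(m, n)) (B : 'M[R[i]^o]_(m, n)) i j : f @ F --> B ->
  (fun t => f t i j : R[i]^o) @ F --> (B i j : R[i]^o).
Proof.
move=> fB; apply: (@cvg_comp _ _ _ f (fun M : 'M[R[i]^o]_(m, n) => M i j : R[i]^o) F _ _ fB).
exact: coord_continuous.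
Qed.

Lemma cvg_Re_mx m n (f : T -> 'M[R[i]^o]_(m, n)) (B : 'M[R[i]^o]_(m, n)) : f @ F --> B ->
  (fun t => map_mx (@complex.Re R) (f t)) @ F --> map_mx (@complex.Re R) B.
Proof.
move=> fB; apply/cvg_mxP => i j; rewrite mxE; under eq_fun do rewrite mxE.
by apply: cvg_Re; exact: cvg_entry.
Qed.

Lemma lim_real_mx m n (f : T -> 'M[R[i]^o]_(m, n)) (B : 'M[R[i]^o]_(m, n)) :
  ProperFilter F -> f @ F --> B -> (forall t, (f t : 'M[R[i]]_(m, n)) \is a mxOver Num.real) ->
  (B : 'M[R[i]]_(m, n)) \is a mxOver Num.real.
Proof.
move=> PF fB fr; apply/mxOverP => i j; apply/complex_realP.
have c := cvg_Im (cvg_entry (i := i) (j := j) fB).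
have E : (fun t => complex.Im (f t i j)) = cst 0.
  by apply/funext => t; have /mxOverP/(_ i j)/complex_realP [x ->] := fr t.
have B0 : complex.Im (B i j) = 0.
  by apply: (@cvg_unique _ _ (fmap (fun t => complex.Im (f t i j)) F)) => //; rewrite E; exact: cvg_cst.
by exists (complex.Re (B i j)); rewrite [LHS]complexE B0 mulr0 addr0.
Qed.

End Limits.

Lemma map_mx_RRe m n (B : 'M[R[i]]_(m, n)) : B \is a mxOver Num.real ->
  map_mx (@real_complex R) (map_mx (@complex.Re R) B) = B.
Proof.
move=> /mxOverP Br; apply/matrixP => i j; rewrite !mxE /=.
exact: RRe_real.
Qed.

Lemma analytic_continuous_Re (Omega : set R[i]^o) (f : R[i] -> R[i]) (l0 : R) :
  analytic_on Omega f -> Omega l0%:C ->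
  {for l0, continuous (fun l : R => complex.Re (f l%:C))}.
Proof.
move=> af O0; apply: cvg_Re.
apply: (@cvg_comp _ _ _ (fun l : R => l%:C : R[i]^o) (f : R[i]^o -> R[i]^o)).
  by apply: cvg_real_complex; exact: cvg_id.
have : differentiable (f : R[i]^o -> R[i]^o) (l0%:C : R[i]^o) by apply/derivable1_diffP/af.
exact: differentiable_continuous.
Qed.

End RealParts.

(** * Coefficients and limiting eigendata at real parameters *)

Lemma continuous_section_r (X Y : topologicalType) (Z : topologicalType) (f : X * Y -> Z) x y :
  {for (x, y), continuous f} -> {for y, continuous (fun t => f (x, t))}.
Proof.
move=> c P /c [[Q S] /= [Qx Sy] QS]; apply: filterS Sy => t St.
by apply: (QS (x, t)); split => //=; exact: nbhs_singleton Qx.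
Qed.

Lemma continuous_section_l (X Y : topologicalType) (Z : topologicalType) (f : X * Y -> Z) x y :
  {for (x, y), continuous f} -> {for x, continuous (fun t => f (t, y))}.
Proof.
move=> c P /c [[Q S] /= [Qx Sy] QS]; apply: filterS Qx => t Qt.
by apply: (QS (t, y)); split => //=; exact: nbhs_singleton Sy.
Qed.

Section RealSystem.
Variables (R : realType) (n : nat) (I : set R) (Omega : set R[i]^o).
Variable A : R -> R[i] -> 'M[R[i]]_n.+1.
Hypothesis hA : assumption_A Omega I A.
Hypothesis hIo : open I.

Lemma coefficient_cvg (x : R) (l : R[i]^o) : Omega l ->
  (fun p : R * R[i]^o => A p.1 p.2 : 'M[R[i]^o]_n.+1) @ (x, l)
    --> (A x l : 'M[R[i]^o]_n.+1).
Proof.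
case: hA => Oo IO cA _ _ Ol.
have S : open [set p : R * R[i]^o | Omega p.2].
  by apply: (@open_comp _ _ snd) => // p _; exact: cvg_snd.
by move: cA; rewrite continuous_open_subspace // => /(_ (x, l)); apply; exact: mem_set.
Qed.

Lemma coefficient_continuous (x l0 : R) : I l0 ->
  {for (x, l0), continuous (fun p : R * R => remx (A p.1) p.2)}.
Proof.
move=> Il0; have [_ IO _ _ _] := hA.
have c1 : (fun p : R * R => (p.1, p.2%:C) : R * R[i]^o) @ (x, l0) --> (x, l0%:C : R[i]^o).
  move=> P [[Q S] /= [Qx Sl] QS]; exists (Q, (fun l : R => l%:C) @^-1` S) => /=.
    by split; [exact: Qx | exact: (cvg_real_complex (@cvg_id _ (nbhs l0)) Sl)].
  by move=> [y l] /= Qyl; exact: QS.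
exact: cvg_Re_mx (cvg_comp _ _ c1 (coefficient_cvg (x := x) (IO _ Il0))).
Qed.

Lemma coefficient_continuous_x (l : R) : I l ->
  continuous (fun x : R => A x l%:C : 'M[R[i]^o]_n.+1).
Proof.
move=> Il x; have [_ IO _ _ _] := hA.
have c1 : (fun x : R => (x, l%:C) : R * R[i]^o) @ x --> (x, l%:C : R[i]^o).
  move=> P [[Q S] /= [Qx Sl] QS]; apply: filterS Qx => y Qy.
  by apply: QS; split => //=; exact: nbhs_singleton Sl.
exact: cvg_comp _ _ c1 (coefficient_cvg (x := x) (IO _ Il)).
Qed.

Lemma segment_in_parameters l0 : I l0 -> exists2 r : R, 0 < r &
  let K := (fun l : R => l%:C : R[i]^o) @` `[l0 - r, l0 + r] in
  [/\ compact K, K `<=` Omega & \forall l \near l0, K l%:C].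
Proof.
move=> Il0; have [_ IO _ _ _] := hA.
have [r /= r_gt0 rI] : nbhs l0 I by exact: open_nbhs_nbhs.
exists (r / 2); rewrite ?divr_gt0 //; split.
- apply: continuous_compact; last exact: segment_compact.
  by apply: continuous_subspaceT => x; apply: cvg_real_complex; exact: cvg_id.
- move=> _ [l + <-]; rewrite /= in_itv /= => /andP[h1 h2].
  by apply/IO/rI; rewrite /ball_ /= ltr_norml; apply/andP; split; lra.
- exists (r / 2); rewrite /= ?divr_gt0 // => l /ltr_normlP[h1 h2].
  by exists l => //=; rewrite in_itv /=; apply/andP; split; lra.
Qed.

Section Limit.
Variables (F : set_system R) (B : R[i] -> 'M[R[i]]_n.+1).
Context {PF : ProperFilter F}.
Hypothesis hB : limit_matrix Omega A F B.

Lemma limit_matrix_real l : I l -> B l%:C \is a mxOver Num.real.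
Proof.
move=> Il; have [_ IO _ Areal _] := hA.
by apply: lim_real_mx (hB.1 _ (IO _ Il)) _ => t; exact: Areal.
Qed.

(** Locally uniform limits of continuous functions are continuous; the compact
    sets available are real segments around l0. *)
Lemma limit_matrix_continuous l0 : I l0 -> {for l0, continuous (remx B)}.
Proof.
move=> Il0; have [r r_gt0 [cK KO nK]] := segment_in_parameters Il0.
apply/cvgrPdist_le => e e_gt0.
have e3 : 0 < e / 3 by rewrite divr_gt0.
have e3' : 0 < (e / 3)%:C by rewrite ltcR.
have near_unif : \forall x \near F, forall l : R[i],
    ((fun l : R => l%:C : R[i]^o) @` `[l0 - r, l0 + r]) l ->
    forall i j, `|B l i j - A x l i j| <= (e / 3)%:C.
  apply: (hB.2 _ cK KO (fun h : R[i]^o -> 'M[R[i]^o]_n.+1 => forall l : R[i]^o,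
    ((fun l : R => l%:C : R[i]^o) @` `[l0 - r, l0 + r]) l ->
    forall i j, `|B l i j - h l i j| <= (e / 3)%:C)).
  apply/uniform_nbhs.
  exists [set xy : 'M[R[i]^o]_n.+1 * 'M[R[i]^o]_n.+1 | ball xy.1 (e / 3)%:C xy.2].
  split; first by rewrite -entourage_ballE; exists (e / 3)%:C.
  move=> h hh l Kl i j; have [_ /(_ i j)] := hh _ Kl.
  by move/ltW.
have [x xP] := filter_ex near_unif.
have cx : {for l0, continuous (remx (A x))}.
  exact: (continuous_section_r (coefficient_continuous (x := x) Il0)).
move/cvgrPdist_le: cx => /(_ _ e3); apply: filter_app.
have K0 := nbhs_singleton nK.
move: nK; apply: filterS => l Kl h.
have close l' : ((fun l : R => l%:C : R[i]^o) @` `[l0 - r, l0 + r]) l'%:C ->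
    `|remx B l' - remx (A x) l'| <= e / 3.
  move=> /xP Bx; apply: mx_norm_leP => [|i j]; first exact: ltW.
  by rewrite !mxE; apply: Re_lipschitz; exact: Bx.
have h1 := close _ Kl; have h2 := close _ K0.
rewrite (subr_via2 _ _ (remx (A x) l0) (remx (A x) l)).
have := ler_normB (remx B l0 - remx (A x) l0 - (remx (A x) l - remx (A x) l0)) (remx B l - remx (A x) l).
have := ler_normB (remx B l0 - remx (A x) l0) (remx (A x) l - remx (A x) l0).
rewrite distrC in h; lra.
Qed.

Variables (mu : R[i] -> R[i]) (v : R[i] -> 'cV[R[i]]_n.+1) (w : R[i] -> 'rV[R[i]]_n.+1).
Hypothesis hC : dominant_eigendata Omega I B mu v w.
Local Notation cplx := (map_mx (@real_complex R)).

(** mu = w B v, where w, B and v are real. *)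
Lemma eigenvalue_real l : I l -> mu l%:C = (reev mu l)%:C.
Proof.
move=> Il; have [_ IO _ _ _] := hA.
have [_ _ _ /(_ _ (IO _ Il)) [Bv _ wv] /(_ _ Il) [vr wr]] := hC.
have E : (mu l%:C)%:M = w l%:C *m B l%:C *m v l%:C.
  by rewrite -mulmxA Bv -scalemxAr wv scalemx1.
have : w l%:C *m B l%:C *m v l%:C \is a mxOver Num.real.
  by rewrite !mxOverM // limit_matrix_real.
rewrite -E => /mxOverP/(_ 0 0).
by rewrite mxE eqxx mulr1n => /RRe_real.
Qed.

Lemma real_eigendata l : I l ->
  [/\ cplx (remx B l) = B l%:C, cplx (remx v l) = v l%:C & cplx (remx w l) = w l%:C].
Proof.
move=> Il; have [_ _ _ _ /(_ _ Il) [vr wr]] := hC.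
by split; rewrite /remx map_mx_RRe // limit_matrix_real.
Qed.

Lemma real_eigen_relations l : I l ->
  [/\ remx B l *m remx v l = reev mu l *: remx v l,
      remx w l *m remx B l = reev mu l *: remx w l & remx w l *m remx v l = 1%:M].
Proof.
move=> Il; have [_ IO _ _ _] := hA.
have [_ _ _ /(_ _ (IO _ Il)) [Bv wB wv] _] := hC.
have [eB ev ew] := real_eigendata Il.
have inj m p : injective (cplx : 'M[R]_(m, p) -> 'M[R[i]]_(m, p)).
  by apply: map_mx_inj; exact: complexI.
split; apply: inj.
- by rewrite map_mxM map_mxZ eB ev Bv (eigenvalue_real Il).
- by rewrite map_mxM map_mxZ eB ew wB (eigenvalue_real Il).
- by rewrite map_mxM map_mx1 ev ew.
Qed.

Lemma real_deflated_spectrum l : I l -> forall nu,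
  eigenvalue (cplx (deflated (remx B) (reev mu) (remx v) (remx w) l)) nu ->
  complex.Re nu < 0.
Proof.
move=> Il; have [_ IO _ _ _] := hA.
have [/(_ _ (IO _ Il)) dom _ _ /(_ _ (IO _ Il)) [Bv wB wv] _] := hC.
have [eB ev ew] := real_eigendata Il.
rewrite /deflated !map_mxB map_mxM map_scalar_mx /= eB ev ew -(eigenvalue_real Il).
exact: deflated_spectrum.
Qed.

Lemma eigendata_continuous l : I l ->
  [/\ {for l, continuous (reev mu)}, {for l, continuous (remx v)} & {for l, continuous (remx w)}].
Proof.
move=> Il; have [_ IO _ _ _] := hA.
have [_ mua [va wa] _ _] := hC.
split.
- exact: analytic_continuous_Re mua (IO _ Il).
- apply/cvg_mxP => i j; rewrite mxE; under eq_fun do rewrite mxE.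
  exact: analytic_continuous_Re (va i j) (IO _ Il).
- apply/cvg_mxP => i j; rewrite mxE; under eq_fun do rewrite mxE.
  exact: analytic_continuous_Re (wa i j) (IO _ Il).
Qed.

End Limit.

End RealSystem.

(** * Decay of the perturbation of the limit matrices *)

Section Tails.
Variables (R : realType) (n : nat) (I : set R) (Omega : set R[i]^o).
Variables (A : R -> R[i] -> 'M[R[i]]_n.+1) (Am Ap : R[i] -> 'M[R[i]]_n.+1).
Hypothesis hA : assumption_A Omega I A.
Hypothesis hIo : open I.
Hypothesis hD : assumption_D Omega A Am Ap.
Notation mu := (@lebesgue_measure R).

Definition perturbation (B : R[i] -> 'M[R[i]]_n.+1) (l x : R) : R :=
  `|remx (A x) l - remx B l|.

Lemma perturbation_continuous B l : I l -> continuous (perturbation B l).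
Proof.
move=> Il x; have c := continuous_section_l (coefficient_continuous hA (x := x) Il).
apply: (@cvg_comp _ _ _ (fun t => remx (A t) l - remx B l) (fun M => `|M|)).
  exact: (cvg_submx c (cvg_cst _)).
exact: norm_continuous.
Qed.

Lemma cmxnorm_continuous (B : 'M[R[i]]_n.+1) l : I l ->
  continuous (fun x => cmxnorm (A x l%:C - B)).
Proof.
move=> Il x; have c := coefficient_continuous_x hA Il (x := x).
apply: (@cvg_comp _ _ _ (fun t => \sum_i \sum_j Normc.normc ((A t l%:C - B) i j) ^+ 2) Num.sqrt);
  last exact: sqrt_continuous.
apply: cvg_finite_sum => i; apply: cvg_finite_sum => j.
have normcE (z : R[i]) : Normc.normc z ^+ 2 = complex.Re z ^+ 2 + complex.Im z ^+ 2.
  by case: z => a b /=; rewrite sqr_sqrtr // addr_ge0 ?sqr_ge0.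
have cij := cvg_entry (i := i) (j := j) c.
rewrite normcE; under eq_fun do rewrite normcE !mxE !raddfD /= !raddfN /= !expr2.
rewrite !mxE !raddfD /= !raddfN /= !expr2.
have cRe := cvgB (cvg_Re cij) (cvg_cst (complex.Re (B i j))).
have cIm := cvgB (cvg_Im cij) (cvg_cst (complex.Im (B i j))).
by apply: cvgD; apply: cvgM; (exact: cRe || exact: cIm).
Qed.

Lemma norm_remx_le (B C : R[i] -> 'M[R[i]]_n.+1) l :
  `|remx B l - remx C l| <= cmxnorm (B l%:C - C l%:C).
Proof.
apply: mx_norm_leP => [|i j]; first exact: sqrtr_ge0.
rewrite !mxE -raddfB /= -sqrtr_sqr /cmxnorm; apply: ler_wsqrtr.
rewrite (bigD1 i) //= (bigD1 j) //= !mxE.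
apply: (@le_trans _ _ (Normc.normc (B l%:C i j - C l%:C i j) ^+ 2)).
  case: (_ - _) => a b /=.
  by rewrite sqr_sqrtr ?addr_ge0 ?sqr_ge0 // lerDl sqr_ge0.
rewrite -addrA lerDl addr_ge0 // ?sumr_ge0 // => *; rewrite ?sqr_ge0 // sumr_ge0 // => *.
exact: sqr_ge0.
Qed.

Lemma norm_ge_rays (T : R) : 0 < T -> [set x : R | T <= `|x|] = `]-oo, - T] `|` `[T, +oo[.
Proof.
move=> T0; apply/seteqP; split => x /=; rewrite !in_itv /= andbT.
  by rewrite ler_normr => /orP[h|h]; [right | left; lra].
by rewrite ler_normr => -[h|->] //; apply/orP; right; lra.
Qed.

Lemma Eterm_measurable T l : 0 < T -> I l ->
  measurable_fun [set x : R | T <= `|x|] (fun x => cmxnorm (Eterm A Am Ap x l%:C)).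
Proof.
move=> T0 Il.
rewrite norm_ge_rays //.
apply/measurable_funU => //; split.
- apply: (eq_measurable_fun (fun x => cmxnorm (A x l%:C - Am l%:C))) => [x|].
    move=> /set_mem /=; rewrite in_itv /= => xT; rewrite /Eterm ifT //; lra.
  by apply: measurable_funTS; apply: continuous_measurable_fun; exact: cmxnorm_continuous.
- apply: (eq_measurable_fun (fun x => cmxnorm (A x l%:C - Ap l%:C))) => [x|].
    move=> /set_mem /=; rewrite in_itv /= andbT => xT; rewrite /Eterm ifF //; apply/negbTE; rewrite -leNgt; lra.
  by apply: measurable_funTS; apply: continuous_measurable_fun; exact: cmxnorm_continuous.
Qed.

(** The perturbation at a real parameter is at most the complex matrix norm of
    E, and a real segment around l0 is a compact set of parameters, on which
    the tails of the integral of E are uniformly small. *)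
Lemma perturbation_tail_small l0 e : I l0 -> 0 < e -> exists2 T, 0 < T &
  \forall l \near l0, forall a b, a <= b ->
    (b <= - T -> \int[mu]_(t in `[a, b]) perturbation Am l t <= e) /\
    (T <= a -> \int[mu]_(t in `[a, b]) perturbation Ap l t <= e).
Proof.
move=> Il0 e0; have [r r_gt0 [cK KO nK]] := segment_in_parameters hA hIo Il0.
have [T T0 TP] := hD.2 _ cK KO _ e0.
exists T => //; near=> l => a b ab.
have Kl : ((fun l : R => l%:C : R[i]^o) @` `[l0 - r, l0 + r]) l%:C by near: l.
have Il : I l by near: l; exact: open_nbhs_nbhs.
have mS : measurable [set x : R | T <= `|x|] by rewrite norm_ge_rays //; exact: measurableU.
have tail B : `[a, b] `<=` [set x : R | T <= `|x|] ->
    (forall x, a <= x <= b -> perturbation B l x <= cmxnorm (Eterm A Am Ap x l%:C)) ->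
    \int[mu]_(t in `[a, b]) perturbation B l t <= e.
  move=> sub le.
  apply: (@integral_itv_le_tail R (perturbation B l)
    (fun x => cmxnorm (Eterm A Am Ap x l%:C)) [set x : R | T <= `|x|]) => //.
  - exact: perturbation_continuous.
  - exact: Eterm_measurable.
  - by move=> x; exact: normr_ge0.
  - by move=> x _; exact: sqrtr_ge0.
  - exact: (TP _ Kl).
split=> h; apply: tail => x /=; rewrite ?in_itv /= => /andP[xa xb].
- by rewrite ler_normr; apply/orP; right; lra.
- rewrite /Eterm ifT; last lra.
  exact: (norm_remx_le (A x)).
- by rewrite ler_normr; apply/orP; left; lra.
- rewrite /Eterm ifF; first exact: (norm_remx_le (A x)).
  by apply/negbTE; rewrite -leNgt; lra.
Unshelve. all: by end_near. Qed.

End Tails.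

(** * Wedge products as determinants and as covectors *)

Section DeterminantDerivative.
Variable R : realType.

Lemma is_derive_prod m (f : 'I_m -> R -> R) (df : 'I_m -> R) (x : R) :
  (forall i, is_derive x 1 (f i) (df i)) ->
  is_derive x 1 (fun t => \prod_i f i t)
    (\sum_k \prod_i (if i == k then df i else f i x)).
Proof.
elim: m f df => [|m IH] f df Df.
  rewrite big_ord0 (_ : (fun t => _) = cst 1); first exact: is_derive_cst.
  by apply/funext => t; rewrite big_ord0.
rewrite (_ : (fun t => _) = f ord0 * (fun t => \prod_i f (lift ord0 i) t)); last first.
  by apply/funext => t; rewrite big_ord_recl.
have D := is_deriveM (Df ord0) (IH _ _ (fun i => Df (lift ord0 i))).
apply: (is_derive_eq D); rewrite big_ord_recl big_ord_recl eqxx addrC; congr (_ + _).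
  by rewrite [LHS]mulrC; congr (_ * _).
by rewrite scaler_sumr; apply: eq_bigr => k _; rewrite big_ord_recl /=; congr (_ * _).
Qed.

(** Jacobi's formula: differentiate the Leibniz expansion one row at a time,
    and expand the k-th resulting determinant along its k-th row. *)
Lemma is_derive_det m (X : R -> 'M[R]_m) (dX : 'M[R]_m) (x : R) :
  is_derive x 1 X dX -> is_derive x 1 (fun t => \det (X t)) (\tr (dX *m \adj (X x))).
Proof.
move=> /is_derive_mxP DX.
pose Xk k := \matrix_(i, j) (if i == k then dX i j else X x i j).
have -> : \tr (dX *m \adj (X x)) = \sum_k \det (Xk k).
  apply: eq_bigr => k _; rewrite mxE (expand_det_row _ k); apply: eq_bigr => j _.
  rewrite !mxE eqxx; congr (_ * _); rewrite /cofactor; congr (_ * \det _).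
  by apply/matrixP => i i'; rewrite !mxE eq_sym (negbTE (neq_lift _ _)).
rewrite (_ : (fun t => \det _) = \sum_(s : 'S_m) (fun t => (-1) ^+ s * \prod_i X t i (s i)));
  last by apply/funext => t; rewrite fct_sumE.
rewrite exchange_big /=.
have D (s : 'S_m) : is_derive x 1 (fun t => (-1) ^+ s * \prod_i X t i (s i))
   (\sum_k (-1) ^+ s * \prod_i Xk k i (s i)).
  have Dp := @is_derive_prod m (fun i t => X t i (s i)) (fun i => dX i (s i)) x (fun i => DX i (s i)).
  apply: (is_derive_eq (is_deriveZ ((-1) ^+ s) Dp)).
  rewrite scaler_sumr; apply: eq_bigr => k _; congr (_ * _).
  by apply: eq_bigr => i _; rewrite mxE.
elim/big_ind2 : _ => [|? ? ? ? d1 d2|s _]; first exact: is_derive_cst.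
  exact: is_deriveD.
exact: D.
Qed.

End DeterminantDerivative.

Section Covectors.
Variables (R : realType) (n : nat).
Implicit Types (v V : 'cV[R]_n.+1) (r : 'rV[R]_n.+1) (Y : 'M[R]_(n.+1, n)).

(** The row vector r such that r v is the scalar v wedge V. *)
Definition covec V : 'rV[R]_n.+1 := \row_i ((-1) ^+ i * V (rev_ord i) 0).

Definition uncovec r : 'cV[R]_n.+1 := \col_j ((-1) ^+ rev_ord j * r 0 (rev_ord j)).

Lemma covecK : cancel covec uncovec.
Proof.
move=> V; apply/matrixP => j k; rewrite !mxE ord1 rev_ordK mulrA -expr2 sqrr_sign.
by rewrite mul1r.
Qed.

Lemma uncovecK : cancel uncovec covec.
Proof.
move=> r; apply/matrixP => k j; rewrite !mxE ord1 rev_ordK mulrA -expr2 sqrr_sign.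
by rewrite mul1r.
Qed.

Lemma covecZ a V : covec (a *: V) = a *: covec V.
Proof. by apply/matrixP => i j; rewrite !mxE mulrCA. Qed.

Lemma wedge_pairE v V : wedge_pair v V = (covec V *m v) 0 0.
Proof. by rewrite mxE; apply: eq_bigr => i _; rewrite mxE mulrAC. Qed.

Lemma row_mx_first v p (Z : 'M[R]_(n.+1, p)) i : (row_mx v Z) i (0 : 'I_(1 + p)) = v i 0.
Proof. by rewrite mxE; case: splitP => // k _; rewrite (ord1 k). Qed.

Lemma cofactor_row_mx_first v Y i :
  cofactor (row_mx v Y : 'M[R]_(1 + n)) i 0 = (-1) ^+ i * \det (row' i Y).
Proof.
rewrite /cofactor addn0; congr (_ * \det _); apply/matrixP => a b; rewrite !mxE.
case: splitP => [k|k] /=; first by rewrite (ord1 k).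
by rewrite /bump /= add1n => -[] /val_inj ->.
Qed.

Lemma wedge_pair_det v Y : wedge_pair v (wedge_cols Y) = \det (row_mx v Y : 'M[R]_(1 + n)).
Proof.
rewrite (expand_det_col _ (0 : 'I_(1 + n))); apply: eq_bigr => i _.
by rewrite cofactor_row_mx_first row_mx_first mxE rev_ordK mulrCA mulrA.
Qed.

(** Pairing with v is the determinant of (v | M Y), which is det M times the
    determinant of (M^-1 v | Y). *)
Lemma covec_wedge_mul (M : 'M[R]_n.+1) Y : M \in unitmx ->
  covec (wedge_cols (M *m Y)) = \det M *: (covec (wedge_cols Y) *m invmx M).
Proof.
move=> uM; apply/matrixP => i j; rewrite (ord1 i).
have E r : r 0 j = (r *m delta_mx j 0 : 'M[R]_1) 0 0 by rewrite -colE mxE.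
rewrite E -wedge_pairE wedge_pair_det [RHS]E -scalemxAl mxE -mulmxA.
rewrite -wedge_pairE wedge_pair_det; set d : 'cV[R]_n.+1 := delta_mx j 0.
have -> : row_mx d (M *m Y) = M *m row_mx (invmx M *m d) Y.
  by rewrite mul_mx_row mulmxA mulmxV // mul1mx.
exact: (@det_mulmx _ n.+1).
Qed.

End Covectors.

Section AdjointSystem.
Variables (R : realType) (n : nat).

(** Jacobi's formula for X = (v | Y), whose derivative (0 | A Y) is
    A X - (A v | 0): the first term contributes the trace of A and the second
    one an expansion along the first column. *)
Lemma is_derive_wedge (A : 'M[R]_n.+1) (Y : R -> 'M[R]_(n.+1, n)) (x : R) (v : 'cV[R]_n.+1) :
  is_derive x 1 Y (A *m Y x) ->
  is_derive x 1 (fun t => wedge_pair v (wedge_cols (Y t)))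
    (\tr A * wedge_pair v (wedge_cols (Y x)) - wedge_pair (A *m v) (wedge_cols (Y x))).
Proof.
move=> DY; under eq_fun do rewrite wedge_pair_det; rewrite !wedge_pair_det.
pose X t : 'M[R]_(1 + n) := row_mx v (Y t).
have DX : is_derive x 1 X (row_mx 0 (A *m Y x)).
  apply/is_derive_mxP => i j; rewrite mxE; under eq_fun do rewrite mxE.
  case: splitP => k _; first by rewrite mxE; exact: is_derive_cst.
  by move/is_derive_mxP: DY; exact.
apply: (is_derive_eq (is_derive_det DX)).
have -> : row_mx 0 (A *m Y x) = (A : 'M[R]_(1 + n)) *m X x - row_mx (A *m v) 0.
  by rewrite mul_mx_row opp_row_mx add_row_mx subrr oppr0 addr0.
rewrite mulmxBl raddfB /= -mulmxA mul_mx_adj mul_mx_scalar mxtraceZ mulrC; congr (_ - _).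
rewrite mxtrace_mulC (expand_det_col _ (0 : 'I_(1 + n))).
rewrite /mxtrace (bigD1 (0 : 'I_(1 + n))) //= [X in _ + X]big1 ?addr0; last first.
  move=> i i0; rewrite mxE big1 // => j _; rewrite [row_mx _ _ _ _]mxE.
  case: splitP => k ik; last by rewrite [X in _ * X]mxE mulr0.
  by case/eqP: i0; apply/val_inj; rewrite /= ik (ord1 k).
rewrite mxE; apply: eq_bigr => i _; rewrite [\adj _ _ _]mxE mulrC.
by rewrite !cofactor_row_mx_first !row_mx_first.
Qed.

End AdjointSystem.

(** * The adjoint solution and the asymptotics of the system *)

Lemma char_poly_trmx (T : comNzRingType) m (B : 'M[T]_m) : char_poly B^T = char_poly B.
Proof.
rewrite /char_poly -[RHS]det_tr; congr (\det _).
by rewrite /char_poly_mx linearB /= tr_scalar_mx map_trmx.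
Qed.

Lemma nbhs_oppr (R : realType) (x : R) Q : nbhs (- x) Q -> nbhs x [set s | Q (- s)].
Proof. by move=> h; exact: (cvgN (@cvg_id _ (nbhs x)) h). Qed.

Section Solutions.
Variables (R : realType) (n : nat) (I : set R) (Omega : set R[i]^o).
Variables (A : R -> R[i] -> 'M[R[i]]_n.+1) (Am Ap : R[i] -> 'M[R[i]]_n.+1).
Variables (muminus muplus : R[i] -> R[i]).
Variables (vm vp : R[i] -> 'cV[R[i]]_n.+1) (wm wp : R[i] -> 'rV[R[i]]_n.+1).
Hypothesis hIo : open I.
Hypothesis hA : assumption_A Omega I A.
Hypothesis hB : assumption_B Omega A Am Ap.
Hypothesis hC : assumption_C Omega I Am Ap muminus muplus vm vp wm wp.
Hypothesis hD : assumption_D Omega A Am Ap.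
Variables (eta : R -> R -> 'cV[R]_n.+1) (y : 'I_n.+1 -> R -> R -> 'cV[R]_n.+1).
Hypothesis heta : forall l, I l -> is_eta A muminus vm eta l.
Hypothesis hy : forall l, I l -> is_ybasis A muplus wp y vp l.

(** The form tilde Y as a row vector.  It solves the adjoint system z' = - z A,
    so its product with any solution is constant. *)
Definition adj_row x l : 'rV[R]_n.+1 := covec (tY A y x l).

Lemma perturbation_primitive (B : R[i] -> 'M[R[i]]_n.+1) l (x : R) : I l ->
  is_derive x 1 (fun t => oriented_integral 0 t (perturbation A B l)) (perturbation A B l x).
Proof. by move=> Il; exact/is_derive_oriented_integral/(perturbation_continuous hA). Qed.

Lemma primitive_tail_small l0 e : I l0 -> 0 < e -> exists2 T, 0 < T &
  \forall l \near l0, forall a b, a <= b ->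
    (b <= - T -> oriented_integral 0 b (perturbation A Am l)
                - oriented_integral 0 a (perturbation A Am l) <= e) /\
    (T <= a -> oriented_integral 0 b (perturbation A Ap l)
                - oriented_integral 0 a (perturbation A Ap l) <= e).
Proof.
move=> Il0 e0; have [T T0 HT] := perturbation_tail_small hA hIo hD Il0 e0.
exists T => //; near=> l => a b ab.
have Il : I l by near: l; exact: open_nbhs_nbhs.
rewrite !oriented_integralB //; try exact: (perturbation_continuous hA).
by move: a b ab; near: l.
Unshelve. all: by end_near. Qed.

Lemma eta_asymptotics l0 : I l0 ->
  (fun p : R * R => expR (- reev muminus p.2 * p.1) *: eta p.1 p.2)
    @ filter_prod (-oo : set_system R) (nbhs l0) --> remx vm l0 /\
  forall x0, {for (x0, l0), continuous (fun p : R * R => eta p.1 p.2)}.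
Proof.
move=> Il0; have nI := open_nbhs_nbhs (conj hIo Il0).
have [cmu cv cw] := eigendata_continuous hA hC.1 Il0.
have eigen : \forall l \near l0, [/\ remx Am l *m remx vm l = reev muminus l *: remx vm l,
    remx wm l *m remx Am l = reev muminus l *: remx wm l & remx wm l *m remx vm l = 1%:M].
  by apply: filterS nI => l Il; exact: (real_eigen_relations hA hB.1 hC.1).
have cB : {for l0, continuous (remx Am)} by exact: (limit_matrix_continuous hA hIo hB.1 Il0).
have stab : forall nu, eigenvalue (map_mx (@real_complex R)
    (deflated (remx Am) (reev muminus) (remx vm) (remx wm) l0)) nu -> complex.Re nu < 0.
  by exact: (real_deflated_spectrum hA hB.1 hC.1 Il0).
have cA x := coefficient_continuous hA (x := x) Il0.
have sol : \forall l \near l0,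
  (forall x : R, is_derive x 1 (eta ^~ l) (remx (A x) l *m eta x l)) /\
  rescaled (reev muminus) eta ^~ l @ -oo --> remx vm l.
  by apply: filterS nI => l Il; exact: heta.
pose Th x l := oriented_integral 0 x (perturbation A Am l).
have DTh : \forall l \near l0, forall x : R, is_derive x 1 (Th ^~ l) `|remx (A x) l - remx Am l|.
  by apply: filterS nI => l Il x; exact: perturbation_primitive.
have smallTh e : 0 < e -> exists T, \forall l \near l0,
    forall a b, a <= b -> b <= T -> Th b l - Th a l <= e.
  move=> e0; have [T _ HT] := primitive_tail_small Il0 e0.
  by exists (- T); apply: filterS HT => l H a b ab; exact: (H a b ab).1.
split.
  exact: (@rescaled_cvg_joint _ _ _ (fun x l => remx (A x) l) _ _ _ _ _ Th eigen cB cmu cv cw stab sol DTh smallTh).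
move=> x0.
exact: (@solution_continuous_joint _ _ _ (fun x l => remx (A x) l) _ _ _ _ _ Th eigen cB cmu cv cw stab cA sol DTh smallTh).
Qed.

Lemma yfirst_mx_solution l (x : R) : I l ->
  is_derive x 1 ((yfirst_mx y)^~ l) (remx (A x) l *m yfirst_mx y x l).
Proof.
move=> Il; have [[sol _] _ _ _] := hy Il.
apply/is_derive_mxP => i j; under eq_fun do rewrite mxE.
have /is_derive_mxP/(_ i 0) := sol (widen_ord (leqnSn n) j) x.
move=> D; apply: (is_derive_eq D); rewrite [LHS]mxE [RHS]mxE.
by apply: eq_bigr => k _; rewrite [yfirst_mx _ _ _ _ _]mxE.
Qed.

Lemma trace_continuous l : I l -> continuous (fun x => \tr (remx (A x) l)).
Proof.
move=> Il x; have c := continuous_section_l (coefficient_continuous hA (x := x) Il).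
apply: cvg_finite_sum => i.
by have /cvg_mxP := c; exact.
Qed.

Lemma is_derive_trfactor l (x : R) : I l ->
  is_derive x 1 ((trfactor A) ^~ l) (- \tr (remx (A x) l) * trfactor A x l).
Proof.
move=> Il; have D := is_derive_oriented_integral x (trace_continuous Il).
by apply: is_derive_eq; rewrite /GRing.scale /= mulrC.
Qed.

Lemma adj_row_pairing x l (v : 'cV[R]_n.+1) :
  (adj_row x l *m v) 0 0 = trfactor A x l * wedge_pair v (cY y x l).
Proof. by rewrite /adj_row /tY covecZ -scalemxAl mxE wedge_pairE. Qed.

(** The trace term of is_derive_wedge is cancelled by the trace factor. *)
Lemma adj_row_solution l (x : R) : I l ->
  is_derive x 1 (adj_row ^~ l) (- (adj_row x l *m remx (A x) l)).
Proof.
move=> Il; apply/is_derive_mxP => i j; rewrite (ord1 i).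
have E (r : 'rV[R]_n.+1) : r 0 j = (r *m delta_mx j 0 : 'M[R]_1) 0 0 by rewrite -colE mxE.
rewrite (_ : (fun t => _) = (trfactor A) ^~ l * (fun t => wedge_pair (delta_mx j 0) (cY y t l)));
  last by apply/funext => t; rewrite E adj_row_pairing.
have D1 := is_derive_trfactor x Il.
have D2 := is_derive_wedge (delta_mx j 0) (yfirst_mx_solution x Il).
apply: (is_derive_eq (is_deriveM D1 D2)).
rewrite mxE E -mulmxA adj_row_pairing /cY /GRing.scale /=; ring.
Qed.

Lemma adj_row_cvg l : I l ->
  (fun x => expR (reev muplus l * x) *: adj_row x l) @ +oo --> remx wp l.
Proof.
move=> Il; have [_ _ _ ylim] := hy Il.
have -> : remx wp l = covec (tV wp l) by rewrite -[LHS]uncovecK.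
rewrite (_ : (fun x => _) = (fun x => covec (expR (reev muplus l * x) *: tY A y x l)));
  last by apply/funext => x; rewrite covecZ.
apply/cvg_mxP => i j; rewrite mxE; under eq_fun do rewrite mxE.
apply: cvgM; first exact: cvg_cst.
by move/cvg_mxP: ylim; exact.
Qed.

(** Reversing x turns the transposed adjoint system into a system of the same
    kind at -oo, with the transpose of Ap as limit matrix; the roles of the
    right and left eigenvectors v^+ and w^+ are exchanged. *)
Lemma adj_asymptotics l0 : I l0 ->
  (fun p : R * R => expR (reev muplus p.2 * p.1) *: adj_row p.1 p.2)
    @ filter_prod (+oo : set_system R) (nbhs l0) --> remx wp l0 /\
  forall x0, {for (x0, l0), continuous (fun p : R * R => adj_row p.1 p.2)}.
Proof.
move=> Il0; have nI := open_nbhs_nbhs (conj hIo Il0).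
have [cmu cv cw] := eigendata_continuous hA hC.2 Il0.
pose B x l := (remx (A (- x)) l)^T.
pose Bm l := (remx Ap l)^T.
pose v l := (remx wp l)^T.
pose w l := (remx vp l)^T.
pose z x l := (adj_row (- x) l)^T.
pose Th x l := - oriented_integral 0 (- x) (perturbation A Ap l).
have eigen : \forall l \near l0, [/\ Bm l *m v l = reev muplus l *: v l,
    w l *m Bm l = reev muplus l *: w l & w l *m v l = 1%:M].
  apply: filterS nI => l Il; have [e1 e2 e3] := real_eigen_relations hA hB.2 hC.2 Il.
  by rewrite /Bm /v /w -!trmx_mul e1 e2 e3 trmx1 !linearZ.
have cB : {for l0, continuous Bm}.
  by apply: cvg_trmx; exact: (limit_matrix_continuous hA hIo hB.2 Il0).
have cv' : {for l0, continuous v} by exact: cvg_trmx.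
have cw' : {for l0, continuous w} by exact: cvg_trmx.
have stab : forall nu, eigenvalue (map_mx (@real_complex R)
    (deflated Bm (reev muplus) v w l0)) nu -> complex.Re nu < 0.
  have -> : deflated Bm (reev muplus) v w l0
     = (deflated (remx Ap) (reev muplus) (remx vp) (remx wp) l0)^T.
    by rewrite /deflated /Bm /v /w !linearB /= trmx_mul tr_scalar_mx.
  move=> nu; rewrite -map_trmx eigenvalue_root_char char_poly_trmx -eigenvalue_root_char.
  exact: (real_deflated_spectrum hA hB.2 hC.2 Il0).
have cA x : {for (x, l0), continuous (fun p : R * R => B p.1 p.2)}.
  apply: cvg_trmx; have c := coefficient_continuous hA (x := - x) Il0.
  move=> P /c [[Q S] /= [Qx Sl] QS]; exists ([set s | Q (- s)], S) => /=.
    by split=> //; exact: nbhs_oppr.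
  by move=> [s l] /= [Qs Sl']; exact: (QS (- s, l)).
have sol : \forall l \near l0,
  (forall x : R, is_derive x 1 (z ^~ l) (B x l *m z x l)) /\
  rescaled (reev muplus) z ^~ l @ -oo --> v l.
  apply: filterS nI => l Il; split.
    move=> x; apply/is_derive_mxP => i j.
    have /is_derive_mxP/(_ j i) D := adj_row_solution (- x) Il.
    under eq_fun do rewrite mxE.
    have DN : is_derive x 1 (fun s : R => - s) (-1) by exact: (is_deriveN (is_derive_id x (1 : R))).
    apply: (is_derive_eq (is_derive1_comp D DN)).
    by rewrite /B /z -trmx_mul !mxE mulrN1 opprK.
  apply/cvgNy_compNP; apply: cvg_trans (cvg_trmx (adj_row_cvg Il)).
  apply: near_eq_cvg; near=> x.
  by rewrite /= /rescaled /z opprK mulrN mulNr opprK linearZ.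
have DTh : \forall l \near l0, forall x : R, is_derive x 1 (Th ^~ l) `|B x l - Bm l|.
  apply: filterS nI => l Il x.
  have D := perturbation_primitive Ap (- x) Il.
  have DN : is_derive x 1 (fun s : R => - s) (-1) by exact: (is_deriveN (is_derive_id x (1 : R))).
  apply: (is_derive_eq (is_deriveN (is_derive1_comp D DN))).
  by rewrite mulrN1 opprK /B /Bm -linearB /= trmx_norm.
have smallTh e : 0 < e -> exists T, \forall l \near l0,
    forall a b, a <= b -> b <= T -> Th b l - Th a l <= e.
  move=> e0; have [T _ HT] := primitive_tail_small Il0 e0.
  exists (- T); apply: filterS HT => l H a b ab bT.
  have ba : - b <= - a by rewrite lerN2.
  have [_] := H _ _ ba; rewrite /Th opprK addrC; apply.
  by rewrite lerNr.
split.
  have H := @rescaled_cvg_joint _ _ _ B _ _ _ _ _ Th eigen cB cmu cv' cw' stab sol DTh smallTh.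
  have {H} := cvg_trmx H; rewrite /v trmxK => H P /H [[Q S] /= [[q [_ Qq]] Sl] QS].
  exists ([set x | Q (- x)], S) => /=.
    split=> //; exists (- q); split; first exact: num_real.
    by move=> x qx /=; apply: Qq; rewrite ltrNl.
  move=> [x l] /= [Qx Sl'].
  have := QS (- x, l) (conj Qx Sl'); rewrite /= /rescaled /z opprK mulrN mulNr opprK.
  by rewrite linearZ /= trmxK.
move=> x0.
have H := @solution_continuous_joint _ _ _ B _ _ _ _ _ Th eigen cB cmu cv' cw' stab cA sol DTh smallTh (- x0).
have {H} := cvg_trmx H; rewrite /z opprK trmxK => H P /H [[Q S] /= [Qx Sl] QS].
exists ([set x | Q (- x)], S) => /=; first by split=> //; exact: nbhs_oppr.
move=> [x l] /= [Qx' Sl'].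
by have := QS (- x, l) (conj Qx' Sl'); rewrite /= opprK trmxK.
Unshelve. all: by end_near. Qed.

Lemma adj_solution_constant l (f : R -> 'cV[R]_n.+1) x : I l -> is_solution A l f ->
  (adj_row x l *m f x) 0 0 = (adj_row 0 l *m f 0) 0 0.
Proof.
move=> Il sf; apply: (@is_derive_0_is_cst R (fun x => (adj_row x l *m f x) 0 0)) => t.
have D := is_derive_mulmx (adj_row_solution t Il) (sf t).
move/is_derive_mxP: D => /(_ 0 0) D; apply: (is_derive_eq D).
by rewrite mulNmx mulmxA addNr mxE.
Qed.

(** The product is constant, and the two exponential factors are inverse to
    each other, so the constant can be read off at +oo. *)
Lemma adj_solution_limit l (f : R -> 'cV[R]_n.+1) (e : 'cV[R]_n.+1) x : I l ->
  is_solution A l f -> (fun x => expR (- reev muplus l * x) *: f x) @ +oo --> e ->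
  (adj_row x l *m f x) 0 0 = (remx wp l *m e) 0 0.
Proof.
move=> Il sf fe; have c : (fun t => (expR (reev muplus l * t) *: adj_row t l)
    *m (expR (- reev muplus l * t) *: f t)) @ +oo --> remx wp l *m e.
  by apply: cvg_mulmx fe; exact: adj_row_cvg.
move/cvg_mxP: c => /(_ 0 0) c; apply: esym; apply: (cvg_unique _ c) => //.
rewrite (_ : (fun t => _) = cst ((adj_row x l *m f x) 0 0)); first exact: cvg_cst.
apply/funext => t; rewrite -scalemxAl -scalemxAr scalerA -expRD mulNr addrN expR0 scale1r.
by rewrite (adj_solution_constant t Il sf) (adj_solution_constant x Il sf).
Qed.

(** In the basis y, only the component along the dominant solution survives
    division by exp (mu_+ x). *)
Lemma eta_at_pinfty l : I l -> exists (c : R) (r : R -> 'cV[R]_n.+1),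
  [/\ in_span_yfirst y l r, forall x, eta x l = c *: y ord_max x l + r x &
      (fun x => expR (- reev muplus l * x) *: eta x l) @ +oo --> c *: remx vp l].
Proof.
move=> Il; have [[ysol ybas] ytop ysub _] := hy Il.
have [c [cE _]] := ybas _ (heta Il).1.
pose r x := \sum_(j < n) c (widen_ord (leqnSn n) j) 0 *: yfirst y j x l.
have rspan : in_span_yfirst y l r by exists (fun j => c (widen_ord (leqnSn n) j) 0).
have rsol : is_solution A l r.
  move=> x; apply/is_derive_mxP => i j.
  rewrite (_ : (fun t => _) = \sum_(k < n) (fun t => c (widen_ord (leqnSn n) k) 0 * yfirst y k t l i j)); last first.
    by apply/funext => t; rewrite /r summxE fct_sumE; apply: eq_bigr => k _; rewrite mxE.
  rewrite /r mulmx_sumr summxE; apply: is_derive_sum => k.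
  have /is_derive_mxP/(_ i j) D := ysol (widen_ord (leqnSn n) k) x.
  by apply: (is_derive_eq (is_deriveZ _ D)); rewrite -scalemxAr [RHS]mxE.
have etaE x : eta x l = c ord_max 0 *: y ord_max x l + r x.
  by rewrite cE big_ord_recr /= addrC.
exists (c ord_max 0), r; split => //.
have sub := (ysub _ rsol).2 rspan.
rewrite (_ : (fun x => _) = (fun x => c ord_max 0 *: (expR (- reev muplus l * x) *: y ord_max x l)
   + expR (- reev muplus l * x) *: r x)); last first.
  by apply/funext => x; rewrite etaE scalerDr !scalerA mulrC.
rewrite -[X in _ --> X]addr0; apply: cvg_addmx sub.
by apply: cvgZ => //; exact: cvg_cst.
Qed.

End Solutions.

(** * Angles of planar vectors *)

Section Angles.
Variable R : realType.
Implicit Types (a b x th : R) (k : int).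

(** The convention of angle_lift at one point: the second coordinate goes with
    the cosine. *)
Definition is_angle a1 a2 th : Prop :=
  cos th = a2 / Num.sqrt (a1 ^+ 2 + a2 ^+ 2) /\
  sin th = a1 / Num.sqrt (a1 ^+ 2 + a2 ^+ 2).

Lemma is_angleP a1 a2 th : is_angle a1 a2 th <->
  exists2 r, 0 < r & a1 = r * sin th /\ a2 = r * cos th.
Proof.
split=> [[c s]|[r r0 [-> ->]]].
  set r := Num.sqrt _ in c s; exists r; last first.
    have r0 : r != 0.
      apply/eqP => r0; have := cos2Dsin2 th; rewrite c s r0 invr0 !mulr0 expr0n /= addr0.
      by move/eqP; rewrite eq_sym oner_eq0.
    by rewrite c s ![r * _]mulrC !divfK.
  rewrite lt_neqAle sqrtr_ge0 andbT eq_sym; apply/eqP => r0.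
  have := cos2Dsin2 th; rewrite c s r0 invr0 !mulr0 expr0n /= addr0.
  by move/eqP; rewrite eq_sym oner_eq0.
have E : Num.sqrt ((r * sin th) ^+ 2 + (r * cos th) ^+ 2) = r.
  rewrite !exprMn -mulrDr [X in _ * X]addrC cos2Dsin2 mulr1 sqrtr_sqr.
  by rewrite ger0_norm // ltW.
by split; rewrite E mulrAC divff ?mul1r // gt_eqF.
Qed.

Lemma is_angle_scale c a1 a2 th : 0 < c -> is_angle a1 a2 th -> is_angle (c * a1) (c * a2) th.
Proof.
move=> c0 /is_angleP[r r0 [-> ->]]; apply/is_angleP; exists (c * r); first exact: mulr_gt0.
by rewrite !mulrA.
Qed.

Lemma is_angle_exists a1 a2 : ~ (a1 = 0 /\ a2 = 0) -> exists th, is_angle a1 a2 th.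
Proof.
move=> nz; pose r := Num.sqrt (a1 ^+ 2 + a2 ^+ 2).
have r0 : 0 < r.
  rewrite sqrtr_gt0 lt_neqAle addr_ge0 ?sqr_ge0 // andbT eq_sym.
  rewrite paddr_eq0 ?sqr_ge0 // !sqrf_eq0; apply/negP => /andP[/eqP ? /eqP ?].
  exact: nz.
have rr : r ^+ 2 = a1 ^+ 2 + a2 ^+ 2 by rewrite sqr_sqrtr // addr_ge0 ?sqr_ge0.
have b : -1 <= a2 / r <= 1.
  rewrite ler_pdivlMr // ler_pdivrMr // mul1r mulN1r -ler_norml.
  by rewrite -(@ler_pXn2r _ 2) ?nnegrE ?(ltW r0) // real_normK ?num_real // rr lerDr sqr_ge0.
have c : cos (acos (a2 / r)) = a2 / r by apply: acosK; rewrite in_itv.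
have s : sin (acos (a2 / r)) = `|a1| / r.
  rewrite sin_acos //; have -> : 1 - (a2 / r) ^+ 2 = (a1 / r) ^+ 2.
    have r2 : r ^+ 2 != 0 by rewrite expf_neq0 // gt_eqF.
    by rewrite !exprMn exprVn -[1](divff r2) -mulrBl rr addrK.
  by rewrite sqrtr_sqr normrM normrV ?unitfE ?gt_eqF // (gtr0_norm r0).
have [a0|a0] := leP 0 a1.
  by exists (acos (a2 / r)); split; rewrite ?c ?s ?ger0_norm.
by exists (- acos (a2 / r)); split; rewrite ?cosN ?sinN ?c ?s // ltr0_norm // mulNr opprK.
Qed.

Lemma cos_sub_angles a1 a2 b1 b2 th th' : is_angle a1 a2 th -> is_angle b1 b2 th' ->
  0 < a1 * b1 + a2 * b2 -> 0 < cos (th - th').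
Proof.
move=> /is_angleP[r r0 [-> ->]] /is_angleP[r' r0' [-> ->]].
have -> : r * sin th * (r' * sin th') + r * cos th * (r' * cos th')
  = r * r' * cos (th - th') by rewrite cosB; ring.
by rewrite pmulr_rgt0 // mulr_gt0.
Qed.

(** The angle between -pi / 2 and pi / 2 from the direction of (a1, a2) to that
    of (b1, b2) when their scalar product is positive.  It is continuous in all
    four arguments, so angles can be continued by adding turns. *)
Definition turn a1 a2 b1 b2 : R := atan ((a2 * b1 - a1 * b2) / (a1 * b1 + a2 * b2)).

Lemma is_angle_turn a1 a2 b1 b2 th : is_angle a1 a2 th -> 0 < a1 * b1 + a2 * b2 ->
  is_angle b1 b2 (th + turn a1 a2 b1 b2).
Proof.
move=> /is_angleP[r r0 [E1 E2]] P0; rewrite /turn.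
set D := a2 * b1 - a1 * b2; set P := _ + _ in P0 *.
set ph := atan _.
have cph : 0 < cos ph by apply: cos_gt0_pihalf; rewrite atan_gtNpi2 atan_ltpi2.
have sph : sin ph = D / P * cos ph.
  have := atanK (D / P); rewrite -/ph /tan => <-.
  by rewrite divfK // gt_eqF.
apply/is_angleP; exists ((cos ph / P * r)^-1).
  by rewrite invr_gt0 mulr_gt0 // divr_gt0.
have k0 : cos ph / P * r != 0 by rewrite gt_eqF // mulr_gt0 // divr_gt0.
have cs := cos2Dsin2 th.
have Pn0 : P != 0 by rewrite gt_eqF.
rewrite sinD cosD sph; split.
- have N : sin th * P + cos th * D = r * b1 * (cos th ^+ 2 + sin th ^+ 2).
    by rewrite /D /P E1 E2; ring.
  have -> : sin th * cos ph + cos th * (D / P * cos ph)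
    = cos ph / P * (sin th * P + cos th * D) by field.
  by rewrite N cs mulr1 [X in _^-1 * X]mulrA mulKf.
- have N : cos th * P - sin th * D = r * b2 * (cos th ^+ 2 + sin th ^+ 2).
    by rewrite /D /P E1 E2; ring.
  have -> : cos th * cos ph - sin th * (D / P * cos ph)
    = cos ph / P * (cos th * P - sin th * D) by field.
  by rewrite N cs mulr1 [X in _^-1 * X]mulrA mulKf.
Qed.

Lemma turn_id a1 a2 : turn a1 a2 a1 a2 = 0.
Proof. by rewrite /turn [a2 * a1]mulrC subrr mul0r atan0. Qed.

Lemma cvg_turn (T : Type) (F : set_system T) {FF : Filter F} (a1 a2 b1 b2 : T -> R)
    (l1 l2 m1 m2 : R) : a1 @ F --> l1 -> a2 @ F --> l2 -> b1 @ F --> m1 -> b2 @ F --> m2 ->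
  0 < l1 * m1 + l2 * m2 ->
  (fun t => turn (a1 t) (a2 t) (b1 t) (b2 t)) @ F --> turn l1 l2 m1 m2.
Proof.
move=> c1 c2 d1 d2 P0; apply: continuous_cvg; first exact: continuous_atan.
apply: cvgM; first by apply: cvgB; exact: cvgM.
by apply: cvgV; [rewrite gt_eqF | apply: cvgD; exact: cvgM].
Qed.

Lemma cosD2pik x k : cos (x + 2 * pi * k%:~R) = cos x.
Proof.
have H n (t : R) : cos (t + 2 * pi * n%:R) = cos t.
  rewrite -[RHS](periodicn (@cosD2pi R) n t); congr (cos (t + _)).
  by rewrite -[pi *+ 2]mulr_natl -[RHS]mulr_natr.
case: k => n; first exact: H.
by rewrite NegzE mulrNz mulrN -[LHS](H n.+1) subrK.
Qed.

Lemma cos_gt0_near_2pik x : 0 < cos x -> exists k, `|x - 2 * pi * k%:~R| < pi / 2.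
Proof.
move=> cx; have p0 := pi_gt0 R; have p20 : 0 < 2 * pi :> R by rewrite mulr_gt0.
pose k := Num.floor ((x + pi) / (2 * pi)); exists k.
have /andP[] := floor_itv ((x + pi) / (2 * pi)).
rewrite ler_pdivlMr // ltr_pdivrMr // -/k intrD => h1 h2.
set r := x - _.
have cr : 0 < cos `|r|.
  rewrite cos_norm /r -[cos _](cosD2pik _ k) subrK //.
have rpi : `|r| <= pi by rewrite ler_norml /r; apply/andP; split; lra.
rewrite ltNge; apply/negP => h.
have : cos `|r| <= cos (pi / 2).
  move: h; rewrite le_eqVlt => /orP[/eqP <- //|h].
  by apply/ltW; rewrite ltr_cos // in_itv /=; apply/andP; split; lra.
by rewrite cos_pihalf leNgt cr.
Qed.

Lemma cos_pihalf_norm x : `|x| = pi / 2 -> cos x = 0.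
Proof. by move=> h; rewrite -cos_norm h cos_pihalf. Qed.

(** The phase lies within pi / 2 of a multiple of 2 pi at t0, and by the
    intermediate value theorem it cannot leave this neighbourhood without
    passing a zero of the cosine. *)
Lemma close_phases (D : set R) t0 (f : R -> R) : is_interval D -> D t0 ->
  {within D, continuous f} -> (forall t, D t -> 0 < cos (f t)) ->
  exists k, forall t, D t -> `|f t - 2 * pi * k%:~R| < pi / 2.
Proof.
move=> iD Dt0 cf pos; have [k kP] := cos_gt0_near_2pik (pos _ Dt0).
exists k => t Dt; rewrite ltNge; apply/negP => h.
pose g s := `|f s - 2 * pi * k%:~R|.
have main a b : a <= b -> D a -> D b -> Num.min (g a) (g b) <= pi / 2 <= Num.max (g a) (g b) -> False.
  move=> ab Da Db v.
  have cg : {within `[a, b], continuous g}.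
    apply: (@continuous_subspaceW _ _ _ D).
      by move=> s /=; rewrite in_itv /= => asb; exact: (iD a b).
    move=> s; apply: cvg_norm; apply: cvgB; [exact: cf | exact: cvg_cst].
  have [c + gc] := IVT ab cg v; rewrite in_itv /= => acb.
  have := pos c (iD _ _ Da Db _ acb).
  by rewrite -(cosD2pik _ (- k)) mulrNz mulrN (cos_pihalf_norm gc) ltxx.
have [t0t|tt0] := leP t0 t.
  apply: (main _ _ t0t Dt0 Dt).
  by rewrite ge_min (ltW kP) /= le_max h orbT.
apply: (main _ _ (ltW tt0) Dt Dt0).
by rewrite ge_min (ltW kP) orbT /= le_max h.
Qed.

Lemma sin_sub_pik k : exists2 e : R, e * e = 1 & forall t : R, sin (t - pi * k%:~R) = e * sin t.
Proof.
have H n (t : R) : sin (t + pi * n%:R) = (-1) ^+ n * sin t.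
  by rewrite mulr_natr; exact: (alternatingn (@sinDpi R)).
have ee n : (-1) ^+ n * (-1) ^+ n = 1 :> R by rewrite -expr2 sqrr_sign.
case: k => n.
  exists ((-1) ^+ n) => // t.
  by rewrite -[in RHS](subrK (pi * n%:R) t) H mulrA ee mul1r.
exists ((-1) ^+ n.+1) => // t.
by rewrite NegzE mulrNz mulrN opprK H.
Qed.

(** If the floors differ, a multiple of pi separates the two angles.  As they
    are less than pi apart, their sines then cannot both be positive or both be
    negative; and two different multiples of pi are at least pi apart. *)
Lemma sin_eq0_or_sign_floor x x' : `|x - x'| < pi ->
  (sin x = 0 /\ sin x' = 0) \/ 0 < sin x * sin x' ->
  Num.floor (x / pi) = Num.floor (x' / pi).
Proof.
have p0 := pi_gt0 R.
wlog : x x' / (Num.floor (x / pi) <= Num.floor (x' / pi))%R.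
  move=> H xx' s; have [h|/ltW h] := leP (Num.floor (x / pi)) (Num.floor (x' / pi)).
    exact: H.
  by apply/esym/H => //; [rewrite distrC | rewrite mulrC; case: s => [[]|]; [left|right]].
rewrite le_eqVlt => /orP[/eqP -> //|lt_floor] xx' s; exfalso.
set m := Num.floor (x / pi) in lt_floor.
have /andP[] := floor_itv (x / pi); rewrite -/m intrD => h1 h2.
have := floor_le (x' / pi).
have : (m + 1)%:~R <= (Num.floor (x' / pi))%:~R :> R by rewrite ler_int lezD1.
rewrite intrD => h3 h4; have {h3 h4} h3 := le_trans h3 h4.
rewrite ler_pdivlMr // in h1; rewrite ltr_pdivrMr // in h2; rewrite ler_pdivlMr // in h3.
pose d : R := pi * m%:~R.
have xd : 0 <= x - d < pi by rewrite /d; apply/andP; split; lra.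
have xd' : pi <= x' - d < pi + pi.
  have := xx'; rewrite distrC => /ltr_normlP[_ h].
  by move: xd; rewrite /d => /andP[? ?]; apply/andP; split; lra.
have [e e2 sE] := sin_sub_pik m; rewrite -/d in sE.
have S : sin (x - d) * sin (x' - d) = sin x * sin x'.
  by rewrite !sE mulrACA e2 mul1r.
have {xd} [/andP[y0 ypi] /andP[y'pi y'2]] := (xd, xd').
have s1 : 0 <= sin (x - d) by apply: sin_ge0_pi; rewrite y0 ltW.
have s2 : 0 <= sin (x' - d - pi) by apply: sin_ge0_pi; apply/andP; split; lra.
have s2E : sin (x' - d) = - sin (x' - d - pi).
  by rewrite -[in LHS](subrK pi (x' - d)) sinDpi.
case: s => [[sx sx']|]; last first.
  by rewrite -S s2E mulrN oppr_gt0 ltNge mulr_ge0.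
have zero (t : R) : 0 <= t < pi -> sin t = 0 -> t = 0.
  move=> /andP[t0 tpi] st; apply/eqP; rewrite eq_le t0 andbT leNgt; apply/negP => t1.
  by have := @sin_gt0_pi R t; rewrite t1 tpi st ltxx => /(_ isT).
have x0 : x - d = 0 by apply: zero; rewrite ?y0 // sE sx mulr0.
have x0' : x' - d - pi = 0.
  apply: zero; first by apply/andP; split; lra.
  by apply/eqP; rewrite -oppr_eq0 -s2E sE sx' mulr0.
by move: xx'; rewrite distrC => /ltr_normlP[_]; lra.
Qed.

End Angles.

(** * Continuous angles along the line *)

Section Lifts.
Variable R : realType.

Lemma dot_gt0_near (F : set_system R) {FF : Filter F} (a1 a2 : R -> R) (m1 m2 : R) :
  a1 @ F --> m1 -> a2 @ F --> m2 -> ~ (m1 = 0 /\ m2 = 0) ->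
  exists2 Q : set R, F Q & forall s t, Q s -> Q t ->
    0 < a1 s * a1 t + a2 s * a2 t /\ 0 < m1 * a1 t + m2 * a2 t.
Proof.
move=> c1 c2 nz.
have m0 : 0 < m1 * m1 + m2 * m2.
  rewrite -!expr2 lt_neqAle addr_ge0 ?sqr_ge0 // andbT eq_sym.
  rewrite paddr_eq0 ?sqr_ge0 // !sqrf_eq0; apply/negP => /andP[/eqP ? /eqP ?].
  exact: nz.
have c1f : (fun p : R * R => a1 p.1) @ filter_prod F F --> m1 by apply: cvg_comp c1; exact: cvg_fst.
have c2f : (fun p : R * R => a2 p.1) @ filter_prod F F --> m2 by apply: cvg_comp c2; exact: cvg_fst.
have c1s : (fun p : R * R => a1 p.2) @ filter_prod F F --> m1 by apply: cvg_comp c1; exact: cvg_snd.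
have c2s : (fun p : R * R => a2 p.2) @ filter_prod F F --> m2 by apply: cvg_comp c2; exact: cvg_snd.
have cp : (fun p : R * R => a1 p.1 * a1 p.2 + a2 p.1 * a2 p.2) @ filter_prod F F
    --> m1 * m1 + m2 * m2.
  by apply: cvgD; apply: cvgM.
have cm : (fun t => m1 * a1 t + m2 * a2 t) @ F --> m1 * m1 + m2 * m2.
  by apply: cvgD; apply: cvgM => //; exact: cvg_cst.
have [[Q1 Q2] /= [FQ1 FQ2] Q12] := cvgr_gt _ cp _ m0.
have FQ3 : F [set t | 0 < m1 * a1 t + m2 * a2 t] by exact: (cvgr_gt _ cm _ m0).
exists (Q1 `&` Q2 `&` [set t | 0 < m1 * a1 t + m2 * a2 t]).
  exact: (filterI (filterI FQ1 FQ2) FQ3).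
move=> s t [[s1 s2] s3] [[t1 t2] t3]; split=> //.
exact: (Q12 (s, t)).
Qed.

Variables (a1 a2 : R -> R).
Hypotheses (ca1 : continuous a1) (ca2 : continuous a2).
Hypothesis nz : forall t, ~ (a1 t = 0 /\ a2 t = 0).
Variables (m1 m2 p1 p2 : R).
Hypotheses (lm1 : a1 @ -oo --> m1) (lm2 : a2 @ -oo --> m2) (nzm : ~ (m1 = 0 /\ m2 = 0)).
Hypotheses (lp1 : a1 @ +oo --> p1) (lp2 : a2 @ +oo --> p2) (nzp : ~ (p1 = 0 /\ p2 = 0)).

Let stopped (c t : R) : R := Num.min c t.

Let continuous_stopped c : continuous (stopped c).
Proof. by move=> t; apply: continuous_min; [exact: cvg_cst | exact: cvg_id]. Qed.

Let continuous_comp_stopped (a : R -> R) c : continuous a -> continuous (a \o stopped c).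
Proof. by move=> ca t; apply: continuous_comp; [exact: continuous_stopped | exact: ca]. Qed.

Let cvg_comp_stopped (a : R -> R) c (m : R) : a @ -oo --> m -> (a \o stopped c) @ -oo --> m.
Proof.
move=> am; apply: cvg_trans am; apply: near_eq_cvg; near=> t.
rewrite /= /stopped min_r //; near: t; apply: nbhs_ninfty_le; exact: num_real.
Unshelve. all: by end_near. Qed.

(** Stopping the path at time c keeps the lift a function on the whole line,
    constant from c on, so that lifts over longer pieces arise from it by
    adding turns and no gluing is needed. *)
Definition lift_upto c := exists (th : R -> R) (tm : R),
  [/\ continuous th, (forall t, is_angle (a1 (stopped c t)) (a2 (stopped c t)) (th t)),
      (forall t, c <= t -> th t = th c) & th @ -oo --> tm].

Lemma lift_upto_base : exists c, lift_upto c.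
Proof.
have [Q [c [_ cQ]] Qdot] := dot_gt0_near lm1 lm2 nzm.
exists (c - 1).
have dotm t : 0 < m1 * a1 (stopped (c - 1) t) + m2 * a2 (stopped (c - 1) t).
  have Qt : Q (stopped (c - 1) t) by apply: cQ; rewrite /stopped gt_min ltrBlDr ltrDl ltr01.
  by have [] := Qdot _ _ Qt Qt.
have [tm tmP] := is_angle_exists nzm.
exists (fun t => tm + turn m1 m2 (a1 (stopped (c - 1) t)) (a2 (stopped (c - 1) t))), tm; split.
- move=> t; apply: cvgD; first exact: cvg_cst.
  apply: cvg_turn (dotm t); try exact: cvg_cst.
    exact: (@continuous_comp_stopped _ (c - 1) ca1 t).
  exact: (@continuous_comp_stopped _ (c - 1) ca2 t).
- by move=> t; exact: is_angle_turn.
- by move=> t ct; rewrite /stopped !min_l.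
- rewrite -[X in _ --> X]addr0 -(turn_id m1 m2); apply: cvgD; first exact: cvg_cst.
  apply: cvg_turn; try exact: cvg_cst.
  + exact: (@cvg_comp_stopped _ (c - 1) _ lm1).
  + exact: (@cvg_comp_stopped _ (c - 1) _ lm2).
  + have [Q' FQ' Qd] := dot_gt0_near (cvg_cst m1) (cvg_cst m2) nzm (F := nbhs (0 : R)).
    by have [] := Qd _ _ (nbhs_singleton FQ') (nbhs_singleton FQ').
Qed.

Lemma lift_upto_step c d : c <= d -> lift_upto c ->
  (forall s t, c <= s <= d -> c <= t <= d -> 0 < a1 s * a1 t + a2 s * a2 t) -> lift_upto d.
Proof.
move=> cd [th [tm [cth ath thc thm]]] dot.
have dotcd t : 0 < a1 (stopped c t) * a1 (stopped d t) + a2 (stopped c t) * a2 (stopped d t).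
  rewrite /stopped; have [ct|/ltW tc] := leP c t.
    by apply: dot; rewrite ?lexx ?cd // le_min cd ct ge_min lexx.
  rewrite (min_r (le_trans tc cd)).
  have [Q FQ Qd] := dot_gt0_near (ca1 (x := t)) (ca2 (x := t)) (nz (t := t)).
  by have [] := Qd _ _ (nbhs_singleton FQ) (nbhs_singleton FQ).
exists (fun t => th t + turn (a1 (stopped c t)) (a2 (stopped c t)) (a1 (stopped d t)) (a2 (stopped d t))), tm.
split.
- move=> t; apply: cvgD; first exact: cth.
  apply: cvg_turn (dotcd t).
  + exact: (@continuous_comp_stopped _ (c) ca1 t).
  + exact: (@continuous_comp_stopped _ (c) ca2 t).
  + exact: (@continuous_comp_stopped _ (d) ca1 t).
  + exact: (@continuous_comp_stopped _ (d) ca2 t).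
- by move=> t; exact: is_angle_turn.
- move=> t dt; rewrite /stopped !(min_l dt) !(min_l cd) !(min_l (le_trans cd dt)).
  by rewrite minxx (thc _ cd) (thc _ (le_trans cd dt)).
- apply: cvg_trans thm; apply: near_eq_cvg; near=> t.
  have tc : t <= c by near: t; apply: nbhs_ninfty_le; exact: num_real.
  by rewrite /stopped !min_r // ?turn_id ?addr0 // (le_trans tc).
Unshelve. all: by end_near. Qed.

(** Every point has a neighbourhood in which the directions stay within a right
    angle of each other, so the supremum of the times that can be reached is
    reached and can only be d. *)
Lemma lift_upto_all c0 d : lift_upto c0 -> c0 <= d -> lift_upto d.
Proof.
move=> L0 c0d.
have loc c : exists2 e, 0 < e & forall s t, `|s - c| < e -> `|t - c| < e -> 0 < a1 s * a1 t + a2 s * a2 t.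
  have [Q [e /= e0 eQ] Qd] := dot_gt0_near (ca1 (x := c)) (ca2 (x := c)) (nz (t := c)).
  exists e => // s t sc tc; have [] // := Qd s t; apply: eQ; rewrite /ball_ /= distrC //.
pose S := [set c | [/\ c0 <= c, c <= d & lift_upto c]].
have S0 : S c0 by split.
have ubS : ubound S d by move=> c [].
have supS : has_sup S by split; [exists c0 | exists d].
set s := sup S.
have sd : s <= d by apply: ge_sup => //; exists c0.
have c0s : c0 <= s by apply: ub_le_sup => //; exists d.
have [e e0 eP] := loc s.
have e2 : 0 < e / 2 by rewrite divr_gt0.
have [c [c0c cd Lc] sc] := sup_adherent e2 supS.
have cs : c <= s by apply: ub_le_sup => //; exists d.
rewrite -/s in sc.
pose c' := Num.min (s + e / 2) d.
have c'd : c' <= d by rewrite ge_min lexx orbT.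
have cc' : c <= c' by rewrite le_min cd andbT; lra.
have c's : c' <= s + e / 2 by rewrite ge_min lexx.
have Lc' : lift_upto c'.
  apply: (lift_upto_step cc' Lc) => x y /andP[x1 x2] /andP[y1 y2].
  by apply: eP; rewrite ltr_norml; apply/andP; split; lra.
have Sc' : S c' by split => //; exact: le_trans cc'.
have : c' <= s by apply: ub_le_sup => //; exists d.
rewrite ge_min => /orP[|ds]; first by lra.
by have -> : d = c' by apply/eqP; rewrite eq_le c'd andbT; apply: le_trans ds _; rewrite le_min sd andbT; lra.
Qed.

(** From some time on the direction stays within a right angle of its limit at
    +oo, so a single turn continues the lift to infinity and makes it converge. *)
Lemma lift_line : exists (th : R -> R) (tm tp : R),
  [/\ continuous th, (forall t, is_angle (a1 t) (a2 t) (th t)), th @ -oo --> tm & th @ +oo --> tp].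
Proof.
have [c0 L0] := lift_upto_base.
have [Q [q [_ qQ]] Qdot] := dot_gt0_near lp1 lp2 nzp.
pose c := Num.max c0 (q + 1).
have [th [tm [cth ath thc thm]]] : lift_upto c by apply: (lift_upto_all L0); rewrite le_max lexx.
have Qc t : c <= t -> Q t.
  by move=> ct; apply: qQ; apply: lt_le_trans ct; rewrite lt_max ltrDl ltr01 orbT.
have dotc t : 0 < a1 (stopped c t) * a1 t + a2 (stopped c t) * a2 t.
  rewrite /stopped; have [ct|/ltW tc] := leP c t.
    by have [] := Qdot c t (Qc _ (lexx c)) (Qc _ ct).
  have [Q' FQ Qd] := dot_gt0_near (ca1 (x := t)) (ca2 (x := t)) (nz (t := t)).
  by have [] := Qd _ _ (nbhs_singleton FQ) (nbhs_singleton FQ).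
exists (fun t => th t + turn (a1 (stopped c t)) (a2 (stopped c t)) (a1 t) (a2 t)), tm,
  (th c + turn (a1 c) (a2 c) p1 p2); split.
- move=> t; apply: cvgD; first exact: cth.
  apply: cvg_turn (dotc t).
  + exact: (@continuous_comp_stopped _ (c) ca1 t).
  + exact: (@continuous_comp_stopped _ (c) ca2 t).
  + exact: ca1.
  + exact: ca2.
- by move=> t; exact: is_angle_turn.
- apply: cvg_trans thm; apply: near_eq_cvg; near=> t.
  have tc : t <= c by near: t; apply: nbhs_ninfty_le; exact: num_real.
  by rewrite /stopped !min_r // turn_id addr0.
- have cl : (fun t => th c + turn (a1 c) (a2 c) (a1 t) (a2 t)) @ +oo --> th c + turn (a1 c) (a2 c) p1 p2.
    apply: cvgD; first exact: cvg_cst.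
    apply: cvg_turn => //; try exact: cvg_cst.
    have [_] := Qdot c c (Qc _ (lexx c)) (Qc _ (lexx c)).
    by rewrite [p1 * _]mulrC [p2 * _]mulrC.
  apply: cvg_trans cl; apply: near_eq_cvg; near=> t.
  have ct : c <= t by near: t; apply: nbhs_pinfty_ge; exact: num_real.
  by rewrite /stopped !min_l // thc.
Unshelve. all: by end_near. Qed.

End Lifts.

(** * Indices of paths in the projective line *)

Section Indices.
Variable R : realType.
Implicit Types (a b c t x : R) (k : int).

Lemma sinD2pik x k : sin (x + 2 * pi * k%:~R) = sin x.
Proof.
have H (s : R) : sin s = cos (s - pi / 2) by rewrite cosBpihalf.
by rewrite !H addrAC cosD2pik.
Qed.

Lemma floor_add_2pik x k :
  Num.floor ((x + 2 * pi * k%:~R) / pi) = Num.floor (x / pi) + 2 * k.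
Proof.
have p0 : pi != 0 :> R by rewrite gt_eqF // pi_gt0.
have -> : (x + 2 * pi * k%:~R) / pi = x / pi + (2 * k)%:~R.
  by rewrite intrM mulrDl; congr (_ + _); rewrite mulrAC mulfK.
by rewrite floorDrz ?intr_int // intrKfloor.
Qed.

Lemma angle_sign a1 a2 b1 b2 x x' : is_angle a1 a2 x -> is_angle b1 b2 x' ->
  (a1 = 0 /\ b1 = 0) \/ 0 < a1 * b1 -> (sin x = 0 /\ sin x' = 0) \/ 0 < sin x * sin x'.
Proof.
move=> /is_angleP[r r0 [-> _]] /is_angleP[r' r0' [-> _]] [[e e']|h].
  left; split; apply/eqP.
    by move/eqP: e; rewrite mulf_eq0 gt_eqF.
  by move/eqP: e'; rewrite mulf_eq0 gt_eqF.
by right; move: h; rewrite mulrACA pmulr_rgt0 // mulr_gt0.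
Qed.

(** Closeness up to k full turns, together with equal signs of the first
    coordinates, determines the floors. *)
Lemma floor_angle_close a1 a2 b1 b2 x x' k : is_angle a1 a2 x -> is_angle b1 b2 x' ->
  (a1 = 0 /\ b1 = 0) \/ 0 < a1 * b1 -> `|x - x' - 2 * pi * k%:~R| < pi ->
  Num.floor (x / pi) = Num.floor (x' / pi) + 2 * k.
Proof.
move=> ax bx s d; rewrite -floor_add_2pik; apply: sin_eq0_or_sign_floor.
  by rewrite opprD addrA.
by rewrite sinD2pik; exact: angle_sign ax bx s.
Qed.

Lemma same_sign_refl a : (a = 0 /\ a = 0) \/ 0 < a * a.
Proof.
have [->|a0] := eqVneq a 0; [by left | right].
by rewrite -expr2 lt_neqAle sqr_ge0 andbT eq_sym sqrf_eq0.
Qed.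

Lemma cos_sub_same_angle a1 a2 x x' : is_angle a1 a2 x -> is_angle a1 a2 x' -> cos (x - x') = 1.
Proof. by move=> [c s] [c' s']; rewrite cosB c s -c' -s' -!expr2 cos2Dsin2. Qed.

Lemma cos1_small x : cos x = 1 -> `|x| < pi / 2 -> x = 0.
Proof.
have p0 := pi_gt0 R => c x2; apply/normr0_eq0/(@cos_inj R); rewrite ?in_itv /=.
- by apply/andP; split; [exact: normr_ge0 | lra].
- by rewrite lexx ltW.
- by rewrite cos_norm cos0.
Qed.

Lemma same_angle_eq a1 a2 x x' : is_angle a1 a2 x -> is_angle a1 a2 x' ->
  exists k, x = x' + 2 * pi * k%:~R.
Proof.
move=> ax ax'; have c := cos_sub_same_angle ax ax'.
have [k xk] : exists k, `|x - x' - 2 * pi * k%:~R| < pi / 2.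
  by apply: cos_gt0_near_2pik; rewrite c.
exists k; apply/eqP; rewrite -subr_eq0 opprD addrA; apply/eqP.
apply: cos1_small => //.
by rewrite -mulrN -mulrNz cosD2pik.
Qed.

(** The pair is extended to the line by its end values. *)
Lemma lift_segment a b (a1 a2 : R -> R) : a <= b ->
  (forall t, a <= t <= b -> {for t, continuous a1} /\ {for t, continuous a2}) ->
  (forall t, a <= t <= b -> ~ (a1 t = 0 /\ a2 t = 0)) ->
  exists th, angle_lift `[a, b] a1 a2 th.
Proof.
move=> ab ca nz; pose cl (t : R) : R := Num.max a (Num.min t b).
have clab t : a <= cl t <= b by rewrite le_max lexx /= ge_max ab ge_min lexx orbT.
have ccl : continuous cl.
  move=> t; apply: (@continuous_max _ _ (fun=> a) (fun t => Num.min t b)); first exact: cvg_cst.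
  by apply: (@continuous_min _ _ id (fun=> b)); [exact: cvg_id | exact: cvg_cst].
have cc1 : continuous (a1 \o cl).
  by move=> t; apply: continuous_comp; [exact: ccl | exact: (ca _ (clab t)).1].
have cc2 : continuous (a2 \o cl).
  by move=> t; apply: continuous_comp; [exact: ccl | exact: (ca _ (clab t)).2].
have clN t : t <= a -> cl t = a by move=> ta; rewrite /cl min_l ?(le_trans ta) // max_l.
have clP t : b <= t -> cl t = b by move=> bt; rewrite /cl min_r // max_r.
have limN (f : R -> R) : (f \o cl) @ -oo --> f a.
  have e : (fun=> f a) @ (-oo : set_system R) --> f a by exact: cvg_cst.
  apply: cvg_trans e; apply: near_eq_cvg; near=> t.
  by rewrite /= clN //; near: t; apply: nbhs_ninfty_le; exact: num_real.
have limP (f : R -> R) : (f \o cl) @ +oo --> f b.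
  have e : (fun=> f b) @ (+oo : set_system R) --> f b by exact: cvg_cst.
  apply: cvg_trans e; apply: near_eq_cvg; near=> t.
  by rewrite /= clP //; near: t; apply: nbhs_pinfty_ge; exact: num_real.
have aa : a <= a <= b by rewrite lexx.
have bb : a <= b <= b by rewrite lexx andbT.
have [th [tm [tp [cth ath _ _]]]] := lift_line cc1 cc2 (fun t => nz _ (clab t))
  (limN a1) (limN a2) (nz _ aa) (limP a1) (limP a2) (nz _ bb).
exists th; split; first exact: continuous_subspaceT.
move=> t; rewrite /= in_itv /= => /andP[at_ tb].
by have := ath t; rewrite /= /cl min_l // max_r.
Unshelve. all: by end_near. Qed.

Lemma close_lifts (D : set R) t0 (a1 a2 b1 b2 th th' : R -> R) : is_interval D -> D t0 ->
  angle_lift D a1 a2 th -> angle_lift D b1 b2 th' ->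
  (forall t, D t -> 0 < a1 t * b1 t + a2 t * b2 t) ->
  exists k, forall t, D t -> `|th t - th' t - 2 * pi * k%:~R| < pi / 2.
Proof.
move=> iD D0 [cth ath] [cth' ath'] dot.
apply: (@close_phases _ _ _ (fun t => th t - th' t) iD D0) => [t|t Dt].
  by apply: cvgB; [exact: cth | exact: cth'].
exact: cos_sub_angles (ath _ Dt) (ath' _ Dt) (dot _ Dt).
Qed.

Lemma lifts_differ_by_constant (D : set R) t0 (a1 a2 th th' : R -> R) : is_interval D -> D t0 ->
  angle_lift D a1 a2 th -> angle_lift D a1 a2 th' ->
  exists k, forall t, D t -> th t = th' t + 2 * pi * k%:~R.
Proof.
move=> iD D0 [cth ath] [cth' ath'].
have c1 t : D t -> cos (th t - th' t) = 1.
  by move=> Dt; exact: cos_sub_same_angle (ath _ Dt) (ath' _ Dt).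
have [t|t Dt|k kP] := @close_phases _ _ _ (fun t => th t - th' t) iD D0.
- by apply: cvgB; [exact: cth | exact: cth'].
- by rewrite c1.
exists k => t Dt; apply/eqP; rewrite -subr_eq0 opprD addrA; apply/eqP.
by apply: cos1_small (kP _ Dt); rewrite -mulrN -mulrNz cosD2pik c1.
Qed.

(** Two lifts differ by a constant multiple of 2 pi, which cancels in the
    difference of the floors. *)
Lemma hyp_indexE a b (a1 a2 th : R -> R) : a <= b -> angle_lift `[a, b] a1 a2 th ->
  hyp_index a1 a2 a b = Num.floor (th b / pi) - Num.floor (th a / pi).
Proof.
move=> ab L; apply: xget_unique; first by exists th.
move=> k [th' [L' ->]].
have Da : `[a, b]%classic a by rewrite /= in_itv /= lexx.
have Db : `[a, b]%classic b by rewrite /= in_itv /= lexx andbT.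
have [j jP] := lifts_differ_by_constant (@interval_is_interval _ _) Da L' L.
by rewrite (jP _ Da) (jP _ Db) !floor_add_2pik; ring.
Qed.

Lemma hyp_index_inftyE (a1 a2 th : R -> R) (tm tp : R) :
  angle_lift setT a1 a2 th -> th @ -oo --> tm -> th @ +oo --> tp ->
  hyp_index_infty a1 a2 = Num.floor (tp / pi) - Num.floor (tm / pi).
Proof.
move=> L lm lp; apply: xget_unique; first by exists th, tm, tp.
move=> k [th' [tm' [tp' [L' lm' lp' ->]]]].
have iT : is_interval [set: R] by [].
have [j jP] := lifts_differ_by_constant iT (I : [set: R] 0) L' L.
have E : th' = (fun t => th t + 2 * pi * j%:~R) by apply/funext => t; exact: jP.
have -> : tm' = tm + 2 * pi * j%:~R.
  apply: (cvg_unique _ lm') => //; rewrite E; apply: cvgD lm _; exact: cvg_cst.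
have -> : tp' = tp + 2 * pi * j%:~R.
  apply: (cvg_unique _ lp') => //; rewrite E; apply: cvgD lp _; exact: cvg_cst.
by rewrite !floor_add_2pik; ring.
Qed.

End Indices.

(** * Comparing the indices of nearby paths *)

Section BoxLemmas.
Variable R : realType.

Lemma int_norm_lt1 (k : int) : `|k%:~R : R| < 1 -> k = 0.
Proof.
by rewrite -intr_norm -[1]/(1%:~R) ltr_int; lia.
Qed.

(** The path f on [-c, c] is compared with the path g on the whole line.  At
    the end c the first coordinate of f has the sign of that of the limit of g,
    which fixes the floor there.  At -c there
    is no sign condition: the angles of f and of the limit of g are measured
    against reference angles ths and Ths, which later come from the adjacent
    shelf, with ks full turns between them.  Three errors smaller than pi / 2
    separate the two ways of counting full turns, so the two counts agree. *)
Lemma side_corner (c : R) (f1 f2 g1 g2 th Th : R -> R) (tm tp p1 p2 : R)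
    (h1 h2 ths Ths : R) (ks : int) : 0 <= c ->
  angle_lift `[- c, c] f1 f2 th -> angle_lift setT g1 g2 Th ->
  (forall x, - c <= x <= c -> 0 < f1 x * g1 x + f2 x * g2 x) ->
  is_angle (f1 (- c)) (f2 (- c)) ths -> is_angle h1 h2 tm -> is_angle h1 h2 Ths ->
  `|ths - Ths - 2 * pi * ks%:~R| < pi / 2 -> `|Th (- c) - tm| < pi / 2 ->
  is_angle p1 p2 tp -> `|Th c - tp| < pi / 2 ->
  (f1 c = 0 /\ p1 = 0) \/ 0 < f1 c * p1 ->
  Num.floor (th c / pi) - Num.floor (th (- c) / pi) + Num.floor (ths / pi)
  = Num.floor (tp / pi) - Num.floor (tm / pi) + Num.floor (Ths / pi) + 2 * ks.
Proof.
move=> c0 L LT dot as_ atm aTs ds dm ap dp sgn; have pi0 := pi_gt0 R.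
have Dc x : `[- c, c]%classic x <-> - c <= x <= c by rewrite /= in_itv.
have LTc : angle_lift `[- c, c] g1 g2 Th.
  split; last by move=> t _; exact: LT.2.
  by apply: continuous_subspaceW LT.1.
have DN : `[- c, c]%classic (- c) by apply/Dc; apply/andP; split; lra.
have DP : `[- c, c]%classic c by apply/Dc; apply/andP; split; lra.
have [|k kP] := close_lifts (@interval_is_interval _ _) DN L LTc.
  by move=> t /Dc; exact: dot.
have [j jE] := same_angle_eq (L.2 _ DN) as_.
have [J JE] := same_angle_eq atm aTs.
(* Four comparisons of angles close up at the corner -c. *)
have jk : j - J - k + ks = 0.
  have h1' := kP _ DN.
  apply: int_norm_lt1.
  have h : `|2 * pi * (j - J - k + ks)%:~R| < 2 * pi :> R.
    have -> : 2 * pi * (j - J - k + ks)%:~R =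
      (th (- c) - Th (- c) - 2 * pi * k%:~R) - (ths - Ths - 2 * pi * ks%:~R) + (Th (- c) - tm).
      by rewrite jE JE !intrD !intrN; ring.
    apply: le_lt_trans (ler_normD _ _) _.
    have := ler_normB (th (- c) - Th (- c) - 2 * pi * k%:~R) (ths - Ths - 2 * pi * ks%:~R).
    lra.
  move: h; rewrite normrM gtr0_norm; last by rewrite mulr_gt0.
  by rewrite gtr_pMr // mulr_gt0.
have E1 : Num.floor (th c / pi) = Num.floor (tp / pi) + 2 * k.
  apply: floor_angle_close (L.2 _ DP) ap sgn _.
  have -> : th c - tp - 2 * pi * k%:~R = (th c - Th c - 2 * pi * k%:~R) + (Th c - tp) by ring.
  apply: le_lt_trans (ler_normD _ _) _; have := kP _ DP; lra.
rewrite E1 jE JE !floor_add_2pik; move: jk.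
move: (Num.floor _) (Num.floor _) (Num.floor _) => u v w jk.
have -> : ks = - j + J + k by apply/eqP; rewrite -subr_eq0 -jk; apply/eqP; ring.
ring.
Qed.

(** Each multiple of pi between the end angles is attained, by the intermediate
    value theorem, and the first coordinate vanishes there; different multiples
    are attained at different times. *)
Lemma index_le_counting (a b : R) (a1 a2 th : R -> R) (S : set R) : a <= b ->
  angle_lift `[a, b] a1 a2 th -> (forall t, a <= t <= b -> a1 t = 0 -> S t) ->
  ((`|Num.floor (th b / pi) - Num.floor (th a / pi)|%:~R : R)%:E <= counting S)%E.
Proof.
move=> ab [cth ath] zS; have pi0 := pi_gt0 R.
rewrite /counting; case: asboolP => [finS|_]; last exact: leey.
set u := Num.floor (th b / pi); set v := Num.floor (th a / pi).
pose lo := Num.min u v.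
(* With lo and hi the smaller and the larger floor, the multiples of pi that
   must be attained are those from lo + 1 up to hi. *)
have cross (i : 'I_`|u - v|%N) : exists t, [/\ a <= t <= b, a1 t = 0 & th t = pi * (lo + 1 + i%:Z)%:~R].
  have Hi : lo + 1 + i%:Z <= Num.max u v.
    by have := ltn_ord i; rewrite /lo; move: (nat_of_ord i) => ii; case: (leP u v) => h hi; lia.
  have Hlo : lo < lo + 1 + i%:Z by lia.
  have bnd (x : R) (m : int) : Num.floor (x / pi) < m -> x < pi * m%:~R.
    by rewrite floor_lt_int ltr_pdivrMr // mulrC.
  have bnd' (x : R) (m : int) : m <= Num.floor (x / pi) -> pi * m%:~R <= x.
    by rewrite floor_ge_int ler_pdivlMr // mulrC.
  have v' : Num.min (th a) (th b) <= pi * (lo + 1 + i%:Z)%:~R <= Num.max (th a) (th b).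
    rewrite ge_min le_max; move: Hi Hlo; rewrite /lo; case: (leP u v) => h Hi Hlo.
      by rewrite (ltW (bnd _ _ Hlo)) (bnd' _ _ Hi) orbT.
    by rewrite (ltW (bnd _ _ Hlo)) (bnd' _ _ Hi) orbT.
  have [t tab tE] := IVT ab cth v'; exists t; move: (tab); rewrite in_itv /= => tab'; split=> //.
  have /is_angleP[r _ [-> _]] := ath t tab; rewrite tE.
  have [e _ /(_ 0)] := sin_sub_pik R (lo + 1 + i%:Z).
  by rewrite sin0 mulr0 add0r sinN => /eqP; rewrite oppr_eq0 => /eqP ->; rewrite mulr0.
have [t tP] := choice cross.
have t_inj : injective t.
  move=> i i' e; have [_ _ E] := tP i; have [_ _ E'] := tP i'.
  move: E; rewrite e E' => /(mulfI (lt0r_neq0 pi0)) /intr_inj h.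
  by apply/val_inj; move: h => /=; lia.
have -> : (`|u - v|%:~R : R) = (#|` [fset t i | i in 'I_`|u - v|%N]%fset |)%:R.
  by rewrite card_imfset //= -cardE card_ord -abszE -pmulrn.
rewrite lee_fin ler_nat; apply: fsubset_leq_card; apply/fsubsetP => x /imfsetP[i _ ->].
have [tab a1t _] := tP i.
by rewrite in_fset_set //; apply: mem_set; exact: (zS _ tab a1t).
Qed.

(** For nearby c the paths stay within a right angle of each other, by
    compactness, and the sign condition makes the floors at both ends agree; so
    the index is locally constant in c.  A locally constant real function has
    derivative 0 and is constant. *)
Lemma homotopy_index_constant (c0 a b : R) (f1 f2 : R -> R -> R) : a <= b ->
  (forall c t, c0 <= c -> a <= t <= b ->
     {for (c, t), continuous (fun p : R * R => f1 p.1 p.2)} /\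
     {for (c, t), continuous (fun p : R * R => f2 p.1 p.2)}) ->
  (forall c t, c0 <= c -> a <= t <= b -> ~ (f1 c t = 0 /\ f2 c t = 0)) ->
  (forall c c' t, c0 <= c -> c0 <= c' -> t = a \/ t = b ->
     (f1 c t = 0 /\ f1 c' t = 0) \/ 0 < f1 c t * f1 c' t) ->
  forall c, c0 <= c -> hyp_index (f1 c) (f2 c) a b = hyp_index (f1 c0) (f2 c0) a b.
Proof.
move=> ab cf nz sgn; have pi0 := pi_gt0 R.
have aab : a <= a <= b by rewrite lexx.
have bab : a <= b <= b by rewrite lexx andbT.
have lifts c : c0 <= c -> exists th, angle_lift `[a, b] (f1 c) (f2 c) th.
  move=> c0c; apply: lift_segment => // t tab; last exact: nz.
  have [k1 k2] := cf c t c0c tab.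
  by split; [exact: (continuous_section_r k1) | exact: (continuous_section_r k2)].
have local c : c0 <= c -> \forall c' \near c, c0 <= c' ->
    hyp_index (f1 c') (f2 c') a b = hyp_index (f1 c) (f2 c) a b.
  move=> c0c.
  have /compact_near_coveringP cov : compact `[a, b] by exact: segment_compact.
  have : \forall c' \near c, `[a, b] `<=` (fun t => 0 < f1 c' t * f1 c t + f2 c' t * f2 c t).
    apply: (cov _ (nbhs c) (fun c' t => 0 < f1 c' t * f1 c t + f2 c' t * f2 c t)).
    move=> t; rewrite /= in_itv /= => tab.
    have [k1 k2] := cf c t c0c tab.
    have swap (f : R -> R -> R) : {for (c, t), continuous (fun p : R * R => f p.1 p.2)} ->
        (fun q : R * R => f q.2 q.1) @ (t, c) --> f c t.
      move=> k P /k [[Q S] /= [Qc St] QS]; exists (S, Q) => // -[t' c'] /= [St' Qc'].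
      exact: (QS (c', t')).
    have sect (f : R -> R -> R) : {for (c, t), continuous (fun p : R * R => f p.1 p.2)} ->
        (fun q : R * R => f c q.1) @ (t, c) --> f c t.
      move=> k; have k' := continuous_section_r k.
      by apply: (@cvg_comp _ _ _ fst (f c)); [exact: cvg_fst | exact: k'].
    have cd : (fun q : R * R => f1 q.2 q.1 * f1 c q.1 + f2 q.2 q.1 * f2 c q.1) @ (t, c)
        --> f1 c t * f1 c t + f2 c t * f2 c t.
      by apply: cvgD; apply: cvgM; (exact: swap || exact: sect).
    apply: (cvgr_gt _ cd).
    rewrite -!expr2 lt_neqAle addr_ge0 ?sqr_ge0 // andbT eq_sym.
    rewrite paddr_eq0 ?sqr_ge0 // !sqrf_eq0; apply/negP => /andP[/eqP e1 /eqP e2].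
    exact: (nz c t c0c tab).
  apply: filterS => c' dot c0c'.
  have [th L] := lifts c c0c; have [th' L'] := lifts c' c0c'.
  rewrite (hyp_indexE ab L) (hyp_indexE ab L').
  have Da : `[a, b]%classic a by rewrite /= in_itv.
  have Db : `[a, b]%classic b by rewrite /= in_itv.
  have [k kP] := close_lifts (@interval_is_interval _ _) Da L' L dot.
  rewrite (floor_angle_close (k := k) (L'.2 _ Da) (L.2 _ Da)); first last.
  - by apply: lt_trans (kP _ Da) _; lra.
  - by apply: sgn => //; left.
  rewrite (floor_angle_close (k := k) (L'.2 _ Db) (L.2 _ Db)); first last.
  - by apply: lt_trans (kP _ Db) _; lra.
  - by apply: sgn => //; right.
  by ring.
(* Truncating at c0 defines the function on the whole line. *)
pose g (c : R) : R := (hyp_index (f1 (Num.max c0 c)) (f2 (Num.max c0 c)) a b)%:~R.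
have Dg (c : R) : is_derive c 1 g 0.
  have D0 : is_derive c 1 (cst (g c)) 0 by exact: is_derive_cst.
  apply: near_eq_is_derive D0.
  have c0m (d : R) : c0 <= Num.max c0 d by rewrite le_max lexx.
  have cmax : {for c, continuous (fun d : R => Num.max c0 d)}.
    by apply: (@continuous_max _ _ (fun=> c0) id); [exact: cvg_cst | exact: cvg_id].
  have : nbhs c ((fun d : R => Num.max c0 d) @^-1` (fun c' => c0 <= c' ->
    hyp_index (f1 c') (f2 c') a b = hyp_index (f1 (Num.max c0 c)) (f2 (Num.max c0 c)) a b)).
    exact: cmax (local _ (c0m c)).
  by apply: filterS => d /= E; rewrite /g E.
move=> c c0c; have := is_derive_0_is_cst c c0 Dg.
by rewrite /g maxxx (max_r c0c) => /intr_inj.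
Qed.

End BoxLemmas.

(** * The two forms tracked by the indices *)

Section EuclideanNorm.
Variables (R : realType) (n : nat).
Implicit Types v : 'cV[R]_n.+1.

Lemma vnorm_ge0 v : 0 <= vnorm v.
Proof. exact: sqrtr_ge0. Qed.

Lemma mx_norm_le_vnorm v : `|v| <= vnorm v.
Proof.
rewrite -(@ler_pXn2r _ 2) ?nnegrE ?vnorm_ge0 // sqr_sqrtr; first exact: sqr_norm_le_sum.
by apply: sumr_ge0 => i _; exact: sqr_ge0.
Qed.

Lemma vnorm_gt0 v : v <> 0 -> 0 < vnorm v.
Proof.
by move=> /eqP v0; apply: lt_le_trans (mx_norm_le_vnorm v); rewrite normr_gt0.
Qed.

Lemma vnormZ a v : vnorm (a *: v) = `|a| * vnorm v.
Proof.
rewrite /vnorm -sqrtr_sqr -sqrtrM ?sqr_ge0 // mulr_sumr; congr Num.sqrt.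
by apply: eq_bigr => i _; rewrite mxE exprMn.
Qed.

Lemma cvg_vnorm (T : Type) (F : set_system T) {FF : Filter F} (f : T -> 'cV[R]_n.+1)
  (v : 'cV[R]_n.+1) : f @ F --> v -> (fun t => vnorm (f t)) @ F --> vnorm v.
Proof.
move=> /cvg_mxP fv; apply: (@continuous_cvg _ _ _ F FF (fun t => \sum_i f t i 0 ^+ 2) Num.sqrt).
  exact: sqrt_continuous.
apply: cvg_finite_sum => i; rewrite expr2; under eq_fun do rewrite expr2.
by apply: cvgM; exact: fv.
Qed.

End EuclideanNorm.

Section PairForms.
Variables (R : realType) (n : nat) (M : 'M[R]_n.+1).
Implicit Types (r : 'rV[R]_n.+1) (e : 'cV[R]_n.+1).

(** When r is the covector of an (n-1)-form Y, form1 r e is e wedge Y, and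
    form2 r e is e wedge the same form with M applied to its factors
    (covec_wedge_mul). *)
Definition form1 r e : R := (r *m e) 0 0.
Definition form2 r e : R := \det M * (r *m invmx M *m e) 0 0.

Lemma form2E r e : form2 r e = ((\det M *: (r *m invmx M)) *m e) 0 0.
Proof. by rewrite -scalemxAl mxE. Qed.

Lemma form1Z a b r e : form1 (a *: r) (b *: e) = a * b * form1 r e.
Proof. by rewrite /form1 -scalemxAl -scalemxAr scalerA mxE. Qed.

Lemma form2Z a b r e : form2 (a *: r) (b *: e) = a * b * form2 r e.
Proof. by rewrite /form2 -!scalemxAl -scalemxAr scalerA mxE mulrCA. Qed.

Lemma form1Bl r r' e : form1 (r - r') e = form1 r e - form1 r' e.
Proof. by rewrite /form1 mulmxBl !mxE. Qed.

Lemma form2Bl r r' e : form2 (r - r') e = form2 r e - form2 r' e.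
Proof. by rewrite /form2 !mulmxBl -mulrBr !mxE. Qed.

Lemma cvg_form1 (T : Type) (F : set_system T) {FF : Filter F} (r : T -> 'rV[R]_n.+1)
    (e : T -> 'cV[R]_n.+1) (r0 : 'rV[R]_n.+1) (e0 : 'cV[R]_n.+1) :
  r @ F --> r0 -> e @ F --> e0 -> (fun t => form1 (r t) (e t)) @ F --> form1 r0 e0.
Proof.
move=> rr ee.
have c : (fun t => r t *m e t) @ F --> r0 *m e0 by exact: cvg_mulmx.
by move/cvg_mxP: c; exact.
Qed.

Lemma cvg_form2 (T : Type) (F : set_system T) {FF : Filter F} (r : T -> 'rV[R]_n.+1)
    (e : T -> 'cV[R]_n.+1) (r0 : 'rV[R]_n.+1) (e0 : 'cV[R]_n.+1) :
  r @ F --> r0 -> e @ F --> e0 -> (fun t => form2 (r t) (e t)) @ F --> form2 r0 e0.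
Proof.
move=> rr ee; apply: cvgM; first exact: cvg_cst.
have rM : (fun t => r t *m invmx M) @ F --> r0 *m invmx M.
  by apply: cvg_mulmx => //; exact: cvg_cst.
have c : (fun t => r t *m invmx M *m e t) @ F --> r0 *m invmx M *m e0 by exact: cvg_mulmx.
by move/cvg_mxP: c; exact.
Qed.

Lemma forms_bounded : exists2 K : R, 0 < K & forall r e,
  `|form1 r e| <= K * (`|r| * `|e|) /\ `|form2 r e| <= K * (`|r| * `|e|).
Proof.
pose N : R := n.+1%:R; pose K1 := N; pose K2 := `|\det M| * (N * (N * `|invmx M|)).
have K20 : 0 <= K2 by rewrite !mulr_ge0.
exists (K1 + K2); first by rewrite ltr_wpDr.
move=> r e; have re : 0 <= `|r| * `|e| by rewrite mulr_ge0.
split; rewrite mulrDl.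
  apply: (@le_trans _ _ (K1 * (`|r| * `|e|))); last by rewrite lerDl mulr_ge0.
  exact: le_trans (mx_entry_le_norm _ _ _) (mulmx_norm_le _ _).
apply: (@le_trans _ _ (K2 * (`|r| * `|e|))); last by rewrite lerDr mulr_ge0.
rewrite /form2 normrM /K2 -!mulrA ler_wpM2l //.
apply: le_trans (mx_entry_le_norm _ _ _) _.
apply: le_trans (mulmx_norm_le _ _) _; rewrite -/N ler_wpM2l //.
apply: (@le_trans _ _ (N * (`|r| * `|invmx M|) * `|e|)).
  by rewrite ler_wpM2r // mulmx_norm_le.
by rewrite -!mulrA ler_wpM2l // mulrCA.
Qed.

End PairForms.

Section PositiveInfimum.
Variable R : realType.

Lemma bounded_below_line (q : R -> R) (a b : R) : continuous q -> (forall x, 0 < q x) ->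
  q @ -oo --> a -> q @ +oo --> b -> 0 < a -> 0 < b -> exists2 m, 0 < m & forall x, m <= q x.
Proof.
move=> cq q0 qa qb a0 b0.
have a2 : a / 2 < a by rewrite ltr_pdivrMr // ltr_pMr // ltr1n.
have b2 : b / 2 < b by rewrite ltr_pdivrMr // ltr_pMr // ltr1n.
have [A [_ HA]] := cvgr_gt _ qa _ a2.
have [B [_ HB]] := cvgr_gt _ qb _ b2.
pose l := A - 1; pose r := Num.max l (B + 1).
have lr : l <= r by rewrite le_max lexx.
have [c _ cP] := EVT_min lr (continuous_subspaceT cq).
exists (Num.min (q c) (Num.min (a / 2) (b / 2))).
  by rewrite !lt_min q0 !divr_gt0.
move=> x; rewrite !ge_min; have [xl|lx] := ltP x l.
  by rewrite (ltW (HA x _)) ?orbT //; rewrite /l in xl; lra.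
have [xr|rx] := leP x r; first by rewrite cP // in_itv /= lx.
have Bx : B < x by apply: le_lt_trans rx; rewrite le_max; apply/orP; right; lra.
by rewrite (ltW (HB x Bx)) !orbT.
Qed.

End PositiveInfimum.

(** * Normalized pairs as multiples of the forms *)

Section MainAssembly.
Variables (R : realType) (n : nat) (I : set R) (Omega : set R[i]^o).
Variables (A : R -> R[i] -> 'M[R[i]]_n.+1) (Am Ap : R[i] -> 'M[R[i]]_n.+1).
Variables (muminus muplus : R[i] -> R[i]).
Variables (vm vp : R[i] -> 'cV[R[i]]_n.+1) (wm wp : R[i] -> 'rV[R[i]]_n.+1).
Hypothesis hA : assumption_A Omega I A.
Hypothesis hB : assumption_B Omega A Am Ap.
Hypothesis hC : assumption_C Omega I Am Ap muminus muplus vm vp wm wp.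
Variables (eta : R -> R -> 'cV[R]_n.+1) (y : 'I_n.+1 -> R -> R -> 'cV[R]_n.+1).
Hypothesis heta : forall l, I l -> is_eta A muminus vm eta l.
Hypothesis hy : forall l, I l -> is_ybasis A muplus wp y vp l.
Variable M : 'M[R]_n.+1.
Hypothesis hM : M \in unitmx.

Local Notation z := (adj_row A y).
Local Notation w := (remx wp).
Local Notation v := (remx vm).
Local Notation mu := (reev muplus).
Local Notation nu := (reev muminus).
Local Notation psi1c := (psi1c eta y).
Local Notation psi2c := (psi2c eta y M).
Local Notation psi1p := (psi1p wp eta).
Local Notation psi2p := (psi2p A muplus wp eta y M).
Local Notation f1 := (@form1 R n).
Local Notation f2 := (form2 M).

Let scaled_adj c l : 'rV[R]_n.+1 := expR (mu l * c) *: z c l.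

Lemma trfactor_gt0 x l : 0 < trfactor A x l.
Proof. exact: expR_gt0. Qed.

(** Total division makes this factor 0 when eta or the form Y vanishes. *)
Definition psi_scale c x l : R := (trfactor A c l * (vnorm (eta x l) * vnorm (cY y c l)))^-1.

Lemma psi_c_forms c x l :
  psi1c c x l = psi_scale c x l * f1 (z c l) (eta x l) /\
  psi2c c x l = psi_scale c x l * f2 (z c l) (eta x l).
Proof.
have t0 := trfactor_gt0 c l.
rewrite /psi_scale /Defs.psi1c /Defs.psi2c /npair !wedge_pairE.
have cancel_t d p : p / d = (trfactor A c l * d)^-1 * (trfactor A c l * p) :> R.
  by rewrite invfM mulrACA mulVf ?mul1r 1?mulrC // gt_eqF.
have zE : z c l = trfactor A c l *: covec (cY y c l) by rewrite /adj_row /tY covecZ.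
rewrite -(scale1r (eta x l)) zE form1Z form2Z mulr1 scale1r -!cancel_t; split=> //.
by rewrite /cYM covec_wedge_mul // -scalemxAl mxE.
Qed.

Lemma psi_c_forms_pos c x l :
  ~ (f1 (z c l) (eta x l) = 0 /\ f2 (z c l) (eta x l) = 0) ->
  exists2 k : R, 0 < k &
  psi1c c x l = k * f1 (z c l) (eta x l) /\ psi2c c x l = k * f2 (z c l) (eta x l).
Proof.
move=> nz; exists (psi_scale c x l); last exact: psi_c_forms.
have e0 : eta x l <> 0.
  by move=> e; apply: nz; rewrite /form1 /form2 e !mulmx0 !mxE mulr0.
have y0 : cY y c l <> 0.
  move=> e; apply: nz; rewrite /form1 /form2 /adj_row /tY e scaler0.
  have -> : covec (0 : 'cV[R]_n.+1) = 0 by apply/matrixP => i j; rewrite !mxE mulr0.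
  by rewrite !mul0mx !mxE mulr0.
by rewrite invr_gt0 !mulr_gt0 ?trfactor_gt0 // vnorm_gt0.
Qed.

Section OneParameter.
Variable l : R.
Hypothesis Il : I l.

Lemma adj_cvg : (scaled_adj ^~ l) @ +oo --> w l.
Proof. exact: (adj_row_cvg hy). Qed.

(** The identity covec_wedge_mul passes to the limit x -> +oo. *)
Lemma tVM_covec : covec (tVM A muplus y M l) = \det M *: (w l *m invmx M).
Proof.
have c : (fun x => expR (mu l * x) *: tYM A y M x l) @ +oo
    --> uncovec (\det M *: (w l *m invmx M)).
  have c1 : (fun x => \det M *: (scaled_adj x l *m invmx M)) @ +oo --> \det M *: (w l *m invmx M).
    apply: cvgZ; first exact: cvg_cst.
    by apply: cvg_mulmx; [exact: adj_cvg | exact: cvg_cst].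
  rewrite (_ : (fun x => _) = (fun x => uncovec (\det M *: (scaled_adj x l *m invmx M)))); last first.
    apply/funext => x; apply: (can_inj (@covecK R n)); rewrite uncovecK !covecZ.
    rewrite /cYM covec_wedge_mul // /scaled_adj /adj_row /tY covecZ.
    by rewrite -!scalemxAl !scalerA; congr (_ *: _); ring.
  apply/cvg_mxP => i j; rewrite mxE; under eq_fun do rewrite mxE.
  by apply: cvgM; [exact: cvg_cst | move/cvg_mxP: c1; exact].
by rewrite /tVM (cvg_lim _ c) // uncovecK.
Qed.

Lemma w_neq0 : w l <> 0.
Proof.
move=> w0; have [_ _] := real_eigen_relations hA hB.2 hC.2 Il.
rewrite w0 mul0mx => /matrixP/(_ 0 0); rewrite !mxE => /eqP.
by rewrite eq_sym oner_eq0.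
Qed.

Lemma v_neq0 : v l <> 0.
Proof.
move=> v0; have [_ _] := real_eigen_relations hA hB.1 hC.1 Il.
rewrite v0 mulmx0 => /matrixP/(_ 0 0); rewrite !mxE => /eqP.
by rewrite eq_sym oner_eq0.
Qed.

Lemma tV_gt0 : 0 < vnorm (tV wp l).
Proof.
apply: vnorm_gt0 => tV0; apply: w_neq0.
rewrite -[w l](@uncovecK R n) -[uncovec (w l)]/(tV wp l) tV0.
by apply/matrixP => i j; rewrite !mxE mulr0.
Qed.

Lemma npair_forms (e : 'cV[R]_n.+1) :
  npair e (tV wp l) (tV wp l) = f1 (w l) e / (vnorm e * vnorm (tV wp l)) /\
  npair e (tVM A muplus y M l) (tV wp l) = f2 (w l) e / (vnorm e * vnorm (tV wp l)).
Proof.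
have E : covec (tV wp l) = w l by exact: uncovecK.
by rewrite /npair !wedge_pairE tVM_covec E form2E.
Qed.

(** The normalized pair does not change when e is multiplied by a positive
    number, so e can be replaced by its convergent rescaling. *)
Lemma npair_cvg (F : set_system R) {FF : ProperFilter F} (e : R -> 'cV[R]_n.+1) (k : R -> R)
    (e0 : 'cV[R]_n.+1) : (forall x, 0 < k x) -> e0 <> 0 ->
  (fun x => k x *: e x) @ F --> e0 ->
  (fun x => npair (e x) (tV wp l) (tV wp l)) @ F --> f1 (w l) e0 / (vnorm e0 * vnorm (tV wp l)) /\
  (fun x => npair (e x) (tVM A muplus y M l) (tV wp l)) @ F
     --> f2 (w l) e0 / (vnorm e0 * vnorm (tV wp l)).
Proof.
move=> k0 e0n0 ce.
have d0 : 0 < vnorm e0 * vnorm (tV wp l) by rewrite mulr_gt0 ?tV_gt0 // vnorm_gt0.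
have scale x U : npair (e x) U (tV wp l) = npair (k x *: e x) U (tV wp l).
  have E : f1 (covec U) (k x *: e x) = k x * f1 (covec U) (e x).
    by rewrite -{1}(scale1r (covec U)) form1Z mul1r.
  rewrite /npair !wedge_pairE -!/(form1 _ _) E vnormZ gtr0_norm //.
  by rewrite -[k x * vnorm (e x) * _]mulrA -mulf_div divff ?mul1r // gt_eqF.
have cd : (fun x => (vnorm (k x *: e x) * vnorm (tV wp l))^-1) @ F
    --> (vnorm e0 * vnorm (tV wp l))^-1.
  apply: cvgV; first by rewrite gt_eqF.
  by apply: cvgM; [exact: cvg_vnorm | exact: cvg_cst].
split.
  rewrite (_ : (fun x => _) = (fun x => f1 (w l) (k x *: e x) / (vnorm (k x *: e x) * vnorm (tV wp l)))).
    by apply: cvgM cd; apply: cvg_form1 => //; exact: cvg_cst.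
  by apply/funext => x; rewrite scale (npair_forms _).1.
rewrite (_ : (fun x => _) = (fun x => f2 (w l) (k x *: e x) / (vnorm (k x *: e x) * vnorm (tV wp l)))).
  by apply: cvgM cd; apply: cvg_form2 => //; exact: cvg_cst.
by apply/funext => x; rewrite scale (npair_forms _).2.
Qed.

Lemma psi_p_at_ninfty :
  psi1p ^~ l @ -oo --> f1 (w l) (v l) / (vnorm (v l) * vnorm (tV wp l)) /\
  psi2p ^~ l @ -oo --> f2 (w l) (v l) / (vnorm (v l) * vnorm (tV wp l)).
Proof.
apply: (npair_cvg (k := fun x => expR (- nu l * x))); first by move=> x; exact: expR_gt0.
- exact: v_neq0.
- exact: (heta Il).2.
Qed.

Lemma psi_pm_forms : exists2 k : R, 0 < k &
  psi1pm wp eta l = k * f1 (w l) (v l) /\ psi2pm A muplus wp eta y M l = k * f2 (w l) (v l).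
Proof.
have [c1 c2] := psi_p_at_ninfty.
exists (vnorm (v l) * vnorm (tV wp l))^-1.
  by rewrite invr_gt0 mulr_gt0 ?tV_gt0 // vnorm_gt0 //; exact: v_neq0.
by rewrite /psi1pm /psi2pm (cvg_lim _ c1) // (cvg_lim _ c2) // ![_ / _]mulrC.
Qed.

Lemma psi_p_forms x : eta x l <> 0 -> exists2 k : R, 0 < k &
  psi1p x l = k * f1 (w l) (eta x l) /\ psi2p x l = k * f2 (w l) (eta x l).
Proof.
move=> e0; exists (vnorm (eta x l) * vnorm (tV wp l))^-1.
  by rewrite invr_gt0 mulr_gt0 ?tV_gt0 // vnorm_gt0.
have [E1 E2] := npair_forms (eta x l).
by rewrite /Defs.psi1p /Defs.psi2p E1 E2 ![_ / _]mulrC.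
Qed.

(** The Evans function.  By crossingE the choice of the point 0 is immaterial. *)
Definition crossing : R := f1 (z 0 l) (eta 0 l).

Lemma crossingE c : f1 (z c l) (eta c l) = crossing.
Proof. exact: (adj_solution_constant hA hy c Il (heta Il).1). Qed.

Lemma eta_nonzero : exists x, eta x l <> 0.
Proof.
apply: contrapT => h; apply: v_neq0.
have lim := (heta Il).2; apply: (cvg_unique _ lim) => //.
rewrite (_ : (fun x => _) = cst 0); first exact: cvg_cst.
apply/funext => x; have -> : eta x l = 0 by apply: contrapT => e; apply: h; exists x.
by rewrite scaler0.
Qed.

(** The value of crossing is the coefficient of eta along the dominant solution
    at +oo.  If it vanishes, eta is a combination of the subdominant solutions. *)
Lemma crossing0_eigenvalue : crossing = 0 -> is_eigenvalue A eta y l.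
Proof.
move=> c0; have [c [r [rspan etaE lim]]] := eta_at_pinfty heta hy Il.
have [_ _ wv] := real_eigen_relations hA hB.2 hC.2 Il.
have : crossing = (w l *m (c *: remx vp l)) 0 0.
  exact: (adj_solution_limit hA hy 0 Il (heta Il).1 lim).
rewrite c0 -scalemxAr wv mxE mxE eqxx mulr1 => cE.
exists (eta ^~ l); split; first exact: (heta Il).1.
- exact: eta_nonzero.
- by exists 1 => x; rewrite scale1r.
- have [d dE] := rspan; exists d => x.
  by rewrite etaE -cE scale0r add0r dE.
Qed.

End OneParameter.

End MainAssembly.

(** * Large boxes are close to the box at infinity *)

Section Closeness.
Variables (R : realType) (n : nat) (I : set R) (Omega : set R[i]^o).
Variables (A : R -> R[i] -> 'M[R[i]]_n.+1) (Am Ap : R[i] -> 'M[R[i]]_n.+1).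
Variables (muminus muplus : R[i] -> R[i]).
Variables (vm vp : R[i] -> 'cV[R[i]]_n.+1) (wm wp : R[i] -> 'rV[R[i]]_n.+1).
Hypothesis hIo : open I.
Hypothesis hA : assumption_A Omega I A.
Hypothesis hB : assumption_B Omega A Am Ap.
Hypothesis hC : assumption_C Omega I Am Ap muminus muplus vm vp wm wp.
Hypothesis hD : assumption_D Omega A Am Ap.
Variables (eta : R -> R -> 'cV[R]_n.+1) (y : 'I_n.+1 -> R -> R -> 'cV[R]_n.+1).
Hypothesis heta : forall l, I l -> is_eta A muminus vm eta l.
Hypothesis hy : forall l, I l -> is_ybasis A muplus wp y vp l.
Variable M : 'M[R]_n.+1.
Hypothesis hM : M \in unitmx.

Local Notation z := (adj_row A y).
Local Notation w := (remx wp).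
Local Notation v := (remx vm).
Local Notation mu := (reev muplus).
Local Notation nu := (reev muminus).
Local Notation psi1p := (psi1p wp eta).
Local Notation psi2p := (psi2p A muplus wp eta y M).
Local Notation f1 := (@form1 R n).
Local Notation f2 := (form2 M).

Let scaled_adj c l : 'rV[R]_n.+1 := expR (mu l * c) *: z c l.

Lemma eta_neq0_of_psi l x : ~ (psi1p x l = 0 /\ psi2p x l = 0) -> eta x l <> 0.
Proof.
move=> nz e; apply: nz.
by rewrite /Defs.psi1p /Defs.psi2p /npair !wedge_pairE e !mulmx0 !mxE !mul0r.
Qed.

Lemma psi_p_continuous l x : I l -> eta x l <> 0 ->
  {for x, continuous (psi1p ^~ l)} /\ {for x, continuous (psi2p ^~ l)}.
Proof.
move=> Il e0.
have ce : (fun t => 1 *: eta t l) @ x --> eta x l.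
  under eq_fun do rewrite scale1r.
  apply/differentiable_continuous/derivable1_diffP.
  by case: ((heta Il).1 x).
have [c1 c2] := npair_cvg hA hB hC hy hM Il (fun=> ltr01) e0 ce.
have [E1 E2] := npair_forms hy hM Il (eta x l).
by rewrite -E1 in c1; rewrite -E2 in c2.
Qed.

Section Side.
Variable l : R.
Hypothesis Il : I l.
Hypothesis hEl : assumption_E_at A muplus wp eta y M l.
Hypothesis hEm : ~ (psi1pm wp eta l = 0 /\ psi2pm A muplus wp eta y M l = 0).

Let eta_neq0 x : eta x l <> 0.
Proof. by have [_ _ /(_ x) nz _] := hEl; exact: eta_neq0_of_psi nz. Qed.

Lemma psi_p_cvg_pinfty :
  psi1p ^~ l @ +oo --> psi1pp wp eta l /\ psi2p ^~ l @ +oo --> psi2pp A muplus wp eta y M l.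
Proof. by have [c1 c2 _ _] := hEl. Qed.

Lemma psi_p_cvg_ninfty :
  psi1p ^~ l @ -oo --> psi1pm wp eta l /\ psi2p ^~ l @ -oo --> psi2pm A muplus wp eta y M l.
Proof.
have [c1 c2] := psi_p_at_ninfty hA hB hC heta hy hM Il.
by rewrite /psi1pm /psi2pm (cvg_lim _ c1) // (cvg_lim _ c2).
Qed.

Let unit_eta x : 'cV[R]_n.+1 := (vnorm (eta x l))^-1 *: eta x l.

Let unit_eta_le1 x : `|unit_eta x| <= 1.
Proof.
have e0 := vnorm_gt0 (@eta_neq0 x).
rewrite normrZ gtr0_norm ?invr_gt0 // mulrC ler_pdivrMr // mul1r.
exact: mx_norm_le_vnorm.
Qed.

Let psi_unit x : psi1p x l * vnorm (tV wp l) = f1 (w l) (unit_eta x) /\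
  psi2p x l * vnorm (tV wp l) = f2 (w l) (unit_eta x).
Proof.
have [E1 E2] := npair_forms hy hM Il (eta x l).
have t0 := tV_gt0 hA hB hC Il; have e0 := vnorm_gt0 (@eta_neq0 x).
rewrite /Defs.psi1p /Defs.psi2p E1 E2.
by split; rewrite /unit_eta -[w l in RHS]scale1r (form1Z, form2Z) mul1r; field; rewrite !gt_eqF.
Qed.

(** On the line and at both of its ends the normalized pair does not vanish, so
    its length is bounded below by a positive constant.  The forms of a
    normalized eta depend continuously on the row vector, uniformly in eta, so
    the rescaled z(c), which converges to w^+, gives a pair close to it. *)
Lemma side_close : \forall c \near +oo, forall x,
  0 < f1 (z c l) (eta x l) * f1 (w l) (eta x l) + f2 (z c l) (eta x l) * f2 (w l) (eta x l).
Proof.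
have t0 := tV_gt0 hA hB hC Il.
have [K K0 KP] := forms_bounded M.
have [cN1 cN2] := psi_p_cvg_ninfty; have [cP1 cP2] := psi_p_cvg_pinfty.
have [_ _ nz nzP] := hEl.
pose q x := psi1p x l ^+ 2 + psi2p x l ^+ 2.
have pos (a b : R) : ~ (a = 0 /\ b = 0) -> 0 < a ^+ 2 + b ^+ 2.
  move=> nab; rewrite lt_neqAle addr_ge0 ?sqr_ge0 // andbT eq_sym.
  rewrite paddr_eq0 ?sqr_ge0 // !sqrf_eq0; apply/negP => /andP[/eqP ? /eqP ?].
  exact: nab.
have sq (F : set_system R) (FF : Filter F) (g h : R -> R) (a b : R) : g @ F --> a -> h @ F --> b ->
    (fun t => g t ^+ 2 + h t ^+ 2) @ F --> a ^+ 2 + b ^+ 2.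
  move=> ga hb; rewrite !expr2; under eq_fun do rewrite !expr2.
  by apply: cvgD; exact: cvgM.
have [m m0 mP] : exists2 m, 0 < m & forall x, m <= q x.
  apply: (@bounded_below_line R q _ _ _ _ (sq _ _ _ _ _ _ cN1 cN2) (sq _ _ _ _ _ _ cP1 cP2)).
  - move=> x; have [c1 c2] := psi_p_continuous Il (@eta_neq0 x).
    exact: (sq _ _ _ _ _ _ c1 c2).
  - by move=> x; exact: pos.
  - exact: pos.
  - exact: pos.
pose T := vnorm (tV wp l).
(* With this d the two error terms are at most a quarter of m T^2 each, and
   m T^2 bounds the scalar product of the limit pair with itself from below. *)
pose d := m * T ^+ 2 / (4 * K ^+ 2 * (`|w l| + 1)).
have w1 : 0 < `|w l| + 1 by rewrite ltr_wpDl.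
have d0 : 0 < d by rewrite divr_gt0 // !mulr_gt0 // exprn_gt0.
have near_d : \forall c \near +oo, `|w l - scaled_adj c l| <= d.
  by have /cvgrPdist_le := adj_cvg hy Il; exact.
apply: filterS near_d => c cd x.
have e0 := vnorm_gt0 (@eta_neq0 x).
have etaE : eta x l = vnorm (eta x l) *: unit_eta x by rewrite scalerA divff ?scale1r // gt_eqF.
have zE : z c l = expR (- (mu l * c)) *: scaled_adj c l.
  by rewrite /scaled_adj scalerA -expRD addNr expR0 scale1r.
rewrite etaE zE -[w l]scale1r.
rewrite !(form1Z _ _ _ (unit_eta x)) !(form2Z _ _ _ _ (unit_eta x)) !mul1r.
set s := expR _; set e := vnorm _ in e0 *; set u := unit_eta x.
have s0 : 0 < s by exact: expR_gt0.
have -> : s * e * f1 (scaled_adj c l) u * (e * f1 (w l) u) + s * e * f2 (scaled_adj c l) u * (e * f2 (w l) u)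
  = s * e ^+ 2 * (f1 (scaled_adj c l) u * f1 (w l) u + f2 (scaled_adj c l) u * f2 (w l) u).
  by ring.
rewrite pmulr_rgt0; last by rewrite mulr_gt0 // exprn_gt0.
have [p1 p2] := psi_unit x; rewrite -/u -/T in p1 p2.
have [b1 b2] := KP (w l - scaled_adj c l) u.
have [k1 k2] := KP (w l) u.
have u1 := unit_eta_le1 x; rewrite -/u in u1.
rewrite form1Bl in b1; rewrite form2Bl in b2.
have B r : K * (`|r| * `|u|) <= K * `|r|.
  by rewrite ler_wpM2l ?(ltW K0) // ler_piMr.
have dot_eq : f1 (scaled_adj c l) u * f1 (w l) u + f2 (scaled_adj c l) u * f2 (w l) u
   = q x * T ^+ 2 - ((f1 (w l) u - f1 (scaled_adj c l) u) * f1 (w l) u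
                     + (f2 (w l) u - f2 (scaled_adj c l) u) * f2 (w l) u).
  by rewrite /q -p1 -p2; ring.
rewrite dot_eq subr_gt0.
have bound (a b : R) : `|a| <= K * d -> `|b| <= K * (`|w l| + 1) -> a * b <= K * d * (K * (`|w l| + 1)).
  move=> ha hb; apply: le_trans (ler_norm _) _; rewrite normrM.
  by apply: ler_pM.
have b1' : `|f1 (w l) u - f1 (scaled_adj c l) u| <= K * d.
  by apply: le_trans b1 _; apply: le_trans (B _ _) _; rewrite ler_wpM2l // ltW.
have b2' : `|f2 (w l) u - f2 (scaled_adj c l) u| <= K * d.
  by apply: le_trans b2 _; apply: le_trans (B _ _) _; rewrite ler_wpM2l // ltW.
have k1' : `|f1 (w l) u| <= K * (`|w l| + 1).
  by apply: le_trans k1 _; apply: le_trans (B _ _) _; rewrite ler_wpM2l ?lerDl // ltW.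
have k2' : `|f2 (w l) u| <= K * (`|w l| + 1).
  by apply: le_trans k2 _; apply: le_trans (B _ _) _; rewrite ler_wpM2l ?lerDl // ltW.
have T2 : 0 < T ^+ 2 by rewrite exprn_gt0.
have Kd : K * d * (K * (`|w l| + 1)) = m * T ^+ 2 / 4.
  by rewrite /d; field; rewrite ?gt_eqF.
have := bound _ _ b1' k1'; have := bound _ _ b2' k2'; rewrite Kd.
have : m * T ^+ 2 <= q x * T ^+ 2 by rewrite ler_wpM2r // ltW.
have : 0 < m * T ^+ 2 by rewrite mulr_gt0.
lra.
Qed.

(** The constant form1 (z x) (eta x), multiplied by exp (mu_+ x) / |eta x|,
    differs from a positive multiple of psi1p x by an error tending to 0.  This
    factor does not tend to 0, as |eta x| is at most of the order of
    exp (mu_+ x).  Hence the limit of psi1p has the sign of the constant. *)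
Lemma crossing_sign : (crossing A eta y l = 0 /\ psi1pp wp eta l = 0) \/
  0 < crossing A eta y l * psi1pp wp eta l.
Proof.
have t0 := tV_gt0 hA hB hC Il; set T := vnorm _ in t0.
have [K K0 KP] := forms_bounded M.
have [cP _] := psi_p_cvg_pinfty.
set a := crossing A eta y l.
have err x : `|psi1p x l * T - expR (mu l * x) / vnorm (eta x l) * a|
    <= K * `|w l - scaled_adj x l|.
  have [-> _] := psi_unit x.
  have -> : expR (mu l * x) / vnorm (eta x l) * a = f1 (scaled_adj x l) (unit_eta x).
    by rewrite form1Z (crossingE hA heta hy Il).
  rewrite -form1Bl; have [b _] := KP (w l - scaled_adj x l) (unit_eta x).
  by apply: le_trans b _; rewrite ler_wpM2l ?(ltW K0) // ler_piMr.
have near_w d : 0 < d -> \forall x \near +oo, `|w l - scaled_adj x l| <= d.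
  by have /cvgrPdist_le := adj_cvg hy Il; exact.
have [a0|a0] := eqVneq a 0.
  left; split=> //; apply: (cvg_unique _ cP) => //.
  apply/cvgrPdist_le => e e0.
  have eK : 0 < e * T / K by rewrite divr_gt0 // mulr_gt0.
  apply: filterS (near_w _ eK) => x hx; rewrite sub0r normrN.
  have := err x; rewrite a0 mulr0 subr0 normrM (gtr0_norm t0) => h.
  rewrite -(ler_pM2r t0); apply: le_trans h _.
  by rewrite mulrC -ler_pdivlMr.
right.
have [c [r [_ _ lim]]] := eta_at_pinfty heta hy Il.
pose D := vnorm (c *: remx vp l).
have cn : (fun x => vnorm (expR (- mu l * x) *: eta x l)) @ +oo --> D by exact: cvg_vnorm.
have D0 : 0 <= D by exact: vnorm_ge0.
have D1 : 0 < D + 1 by rewrite ltr_wpDl.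
have nD : \forall x \near +oo, vnorm (expR (- mu l * x) *: eta x l) <= D + 1.
  have D2 : D < D + 1 by rewrite ltrDl.
  exact: (cvgr_le D cn _ D2).
have a2 : 0 < a ^+ 2 by rewrite lt_neqAle sqr_ge0 andbT eq_sym sqrf_eq0.
(* a times the main term is eventually at least 2 b, and the error times |a| is
   eventually at most b. *)
pose b := a ^+ 2 / (2 * (D + 1)).
have b0 : 0 < b by rewrite divr_gt0 // mulr_gt0.
have na : 0 < `|a| by rewrite normr_gt0.
have db : 0 < b / (K * `|a|) by rewrite divr_gt0 // mulr_gt0.
have cc : (fun x => a * psi1p x l * T) @ +oo --> a * psi1pp wp eta l * T.
  by apply: cvgM; [apply: cvgM => //|]; exact: cvg_cst.
have : b <= a * psi1pp wp eta l * T.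
  apply: (cvgr_to_ge cc); near=> x.
  have hx : `|w l - scaled_adj x l| <= b / (K * `|a|) by near: x; exact: near_w.
  have hDx : vnorm (expR (- mu l * x) *: eta x l) <= D + 1 by near: x.
  have e0 := vnorm_gt0 (@eta_neq0 x).
  have h1 : (D + 1)^-1 <= expR (mu l * x) / vnorm (eta x l).
    rewrite vnormZ gtr0_norm ?expR_gt0 // mulNr expRN in hDx.
    have E : expR (mu l * x) / vnorm (eta x l) = ((expR (mu l * x))^-1 * vnorm (eta x l))^-1.
      by rewrite invfM invrK.
    by rewrite E lef_pV2 // posrE mulr_gt0 // invr_gt0 expR_gt0.
  have h2 := err x.
  have h3 : `|a * (psi1p x l * T - expR (mu l * x) / vnorm (eta x l) * a)| <= b.
    rewrite normrM; apply: le_trans (ler_wpM2l (ltW na) h2) _.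
    apply: (@le_trans _ _ (`|a| * (K * (b / (K * `|a|))))).
      by rewrite ler_wpM2l ?(ltW na) // ler_wpM2l // ltW.
    by rewrite le_eqVlt; apply/orP; left; apply/eqP; field; rewrite ?gt_eqF.
  have h4 : 2 * b <= expR (mu l * x) / vnorm (eta x l) * a ^+ 2.
    have -> : 2 * b = (D + 1)^-1 * a ^+ 2 by rewrite /b; field; rewrite gt_eqF.
    by rewrite ler_wpM2r // ltW.
  move: h3 => /ler_normlP[h3 _].
  rewrite mulrBr in h3; rewrite mulrA in h3.
  have E : a * (expR (mu l * x) / vnorm (eta x l) * a) = expR (mu l * x) / vnorm (eta x l) * a ^+ 2.
    by ring.
  rewrite E in h3; lra.
move=> h; have : 0 < a * psi1pp wp eta l * T by exact: lt_le_trans b0 h.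
by rewrite pmulr_lgt0.
Unshelve. all: by end_near. Qed.

End Side.

(** The rescaled z(c) and eta(- c) converge to w^+ and v^- jointly in c and the
    parameter, so the claim holds near each parameter, and [l1, l2] is compact. *)
Lemma shelf_close (l1 l2 : R) : (forall l, l1 <= l <= l2 -> I l) ->
  (forall l, l1 <= l <= l2 -> ~ (psi1pm wp eta l = 0 /\ psi2pm A muplus wp eta y M l = 0)) ->
  \forall c \near +oo, forall l, l1 <= l <= l2 ->
  0 < f1 (z c l) (eta (- c) l) * f1 (w l) (v l) + f2 (z c l) (eta (- c) l) * f2 (w l) (v l).
Proof.
move=> lI nz.
have /compact_near_coveringP cov : compact `[l1, l2] by exact: segment_compact.
have : \forall c \near +oo, `[l1, l2] `<=` (fun l =>
  0 < f1 (z c l) (eta (- c) l) * f1 (w l) (v l) + f2 (z c l) (eta (- c) l) * f2 (w l) (v l)).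
  apply: (cov _ (+oo : set_system R) (fun c l =>
   0 < f1 (z c l) (eta (- c) l) * f1 (w l) (v l) + f2 (z c l) (eta (- c) l) * f2 (w l) (v l))).
  move=> l0; rewrite /= in_itv /= => l0P; have Il0 := lI _ l0P.
  have [cz _] := adj_asymptotics hIo hA hB hC hD hy Il0.
  have [ce _] := eta_asymptotics hIo hA hB hC hD heta Il0.
  have [_ _ cw] := eigendata_continuous hA hC.2 Il0.
  have [_ cv _] := eigendata_continuous hA hC.1 Il0.
  pose F := filter_prod (nbhs l0) (+oo : set_system R).
  have Zc : (fun p : R * R => expR (mu p.1 * p.2) *: z p.2 p.1) @ F --> w l0.
    move=> P /cz [[Q S] /= [Qx Sl] QS]; exists (S, Q) => // -[l c] /= [Sl' Qc].
    exact: (QS (c, l)).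
  have Ec : (fun p : R * R => expR (- nu p.1 * - p.2) *: eta (- p.2) p.1) @ F --> v l0.
    move=> P /ce [[Q S] /= [[a [_ aQ]] Sl] QS]; exists (S, [set c | - a < c]).
      by split=> //; exists (- a); split; first exact: num_real.
    move=> [l c] /= [Sl' ac]; apply: (QS (- c, l)); split => //=.
    by apply: aQ; rewrite ltrNl.
  have Wc : (fun p : R * R => w p.1) @ F --> w l0.
    by apply: (@cvg_comp _ _ _ fst w); [exact: cvg_fst | exact: cw].
  have Vc : (fun p : R * R => v p.1) @ F --> v l0.
    by apply: (@cvg_comp _ _ _ fst v); [exact: cvg_fst | exact: cv].
  have cd : (fun p : R * R =>
      f1 (expR (mu p.1 * p.2) *: z p.2 p.1) (expR (- nu p.1 * - p.2) *: eta (- p.2) p.1) * f1 (w p.1) (v p.1)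
      + f2 (expR (mu p.1 * p.2) *: z p.2 p.1) (expR (- nu p.1 * - p.2) *: eta (- p.2) p.1) * f2 (w p.1) (v p.1))
      @ F --> f1 (w l0) (v l0) * f1 (w l0) (v l0) + f2 (w l0) (v l0) * f2 (w l0) (v l0).
    by apply: cvgD; apply: cvgM; (exact: cvg_form1 || exact: cvg_form2).
  have pos : 0 < f1 (w l0) (v l0) * f1 (w l0) (v l0) + f2 (w l0) (v l0) * f2 (w l0) (v l0).
    rewrite -!expr2 lt_neqAle addr_ge0 ?sqr_ge0 // andbT eq_sym.
    rewrite paddr_eq0 ?sqr_ge0 // !sqrf_eq0; apply/negP => /andP[/eqP e1 /eqP e2].
    have [k k0 [E1 E2]] := psi_pm_forms hA hB hC heta hy hM Il0.
    by apply: (nz _ l0P); rewrite E1 E2 e1 e2 !mulr0.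
  have : \forall p \near F, 0 <
      f1 (expR (mu p.1 * p.2) *: z p.2 p.1) (expR (- nu p.1 * - p.2) *: eta (- p.2) p.1) * f1 (w p.1) (v p.1)
      + f2 (expR (mu p.1 * p.2) *: z p.2 p.1) (expR (- nu p.1 * - p.2) *: eta (- p.2) p.1) * f2 (w p.1) (v p.1).
    exact: (cvgr_gt _ cd).
  move=> [[S Q] /= [Sl Qc] SQ]; exists (S, Q) => // -[l c] /= SlQc.
  have := SQ (l, c) SlQc; rewrite /= form1Z form2Z -!mulrA -!mulrDr pmulr_rgt0 ?expR_gt0 //.
  by rewrite pmulr_rgt0 ?expR_gt0.
by apply: filterS => c H l lP; apply: H; rewrite /= in_itv.
Qed.

End Closeness.

(** * The index of a large box *)

Section AngleTransfer.
Variable R : realType.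

Lemma angle_lift_scale (D : set R) (a1 a2 b1 b2 th : R -> R) : angle_lift D a1 a2 th ->
  (forall t, D t -> exists2 k : R, 0 < k & b1 t = k * a1 t /\ b2 t = k * a2 t) ->
  angle_lift D b1 b2 th.
Proof.
move=> [cth ath] sc; split=> // t Dt; have [k k0 [-> ->]] := sc t Dt.
exact: is_angle_scale k0 (ath t Dt).
Qed.

Lemma is_angle_cvg (F : set_system R) {FF : ProperFilter F} (a1 a2 th : R -> R) (m1 m2 t : R) :
  (forall s, is_angle (a1 s) (a2 s) (th s)) -> a1 @ F --> m1 -> a2 @ F --> m2 -> th @ F --> t ->
  ~ (m1 = 0 /\ m2 = 0) -> is_angle m1 m2 t.
Proof.
move=> ath am1 am2 tht nz.
pose r (x y : R) := Num.sqrt (x ^+ 2 + y ^+ 2).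
have r0 : r m1 m2 != 0.
  rewrite /r sqrtr_eq0 -ltNge lt_neqAle addr_ge0 ?sqr_ge0 // andbT eq_sym.
  rewrite paddr_eq0 ?sqr_ge0 // !sqrf_eq0; apply/negP => /andP[/eqP ? /eqP ?].
  exact: nz.
have rc : (fun s => r (a1 s) (a2 s)) @ F --> r m1 m2.
  apply: (@continuous_cvg _ _ _ F _ (fun s => a1 s ^+ 2 + a2 s ^+ 2) Num.sqrt).
    exact: sqrt_continuous.
  rewrite !expr2; under eq_fun do rewrite !expr2.
  by apply: cvgD; exact: cvgM.
have quot (a : R -> R) (m : R) : a @ F --> m -> (fun s => a s / r (a1 s) (a2 s)) @ F --> m / r m1 m2.
  by move=> am; apply: cvgM => //; exact: cvgV.
split.
  have c1 : (fun s => cos (th s)) @ F --> cos t.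
    by apply: (@continuous_cvg _ _ _ F _ th (@cos R)) => //; exact: continuous_cos.
  have c2 : (fun s => cos (th s)) @ F --> m2 / r m1 m2.
    rewrite (_ : (fun s => _) = (fun s => a2 s / r (a1 s) (a2 s))); first exact: quot.
    by apply/funext => s; have [->] := ath s.
  exact: (cvg_unique _ c1 c2).
have c1 : (fun s => sin (th s)) @ F --> sin t.
  by apply: (@continuous_cvg _ _ _ F _ th (@sin R)) => //; exact: continuous_sin.
have c2 : (fun s => sin (th s)) @ F --> m1 / r m1 m2.
  rewrite (_ : (fun s => _) = (fun s => a1 s / r (a1 s) (a2 s))); first exact: quot.
  by apply/funext => s; have [_ ->] := ath s.
exact: (cvg_unique _ c1 c2).
Qed.

End AngleTransfer.

Section LargeBox.
Variables (R : realType) (n : nat) (I : set R) (Omega : set R[i]^o).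
Variables (A : R -> R[i] -> 'M[R[i]]_n.+1) (Am Ap : R[i] -> 'M[R[i]]_n.+1).
Variables (muminus muplus : R[i] -> R[i]).
Variables (vm vp : R[i] -> 'cV[R[i]]_n.+1) (wm wp : R[i] -> 'rV[R[i]]_n.+1).
Hypothesis hIo : open I.
Hypothesis hA : assumption_A Omega I A.
Hypothesis hB : assumption_B Omega A Am Ap.
Hypothesis hC : assumption_C Omega I Am Ap muminus muplus vm vp wm wp.
Hypothesis hD : assumption_D Omega A Am Ap.
Variables (eta : R -> R -> 'cV[R]_n.+1) (y : 'I_n.+1 -> R -> R -> 'cV[R]_n.+1).
Hypothesis heta : forall l, I l -> is_eta A muminus vm eta l.
Hypothesis hy : forall l, I l -> is_ybasis A muplus wp y vp l.
Variable M : 'M[R]_n.+1.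
Hypothesis hM : M \in unitmx.

Local Notation z := (adj_row A y).
Local Notation w := (remx wp).
Local Notation v := (remx vm).
Local Notation psi1p := (psi1p wp eta).
Local Notation psi2p := (psi2p A muplus wp eta y M).
Local Notation psi1pm := (psi1pm wp eta).
Local Notation psi2pm := (psi2pm A muplus wp eta y M).
Local Notation F1 c x l := (form1 (z c l) (eta x l)).
Local Notation F2 c x l := (form2 M (z c l) (eta x l)).
Local Notation H1 l := (form1 (w l) (v l)).
Local Notation H2 l := (form2 M (w l) (v l)).

Lemma dot_gt0_neq0 (a1 a2 b1 b2 : R) : 0 < a1 * b1 + a2 * b2 -> ~ (a1 = 0 /\ a2 = 0).
Proof. by move=> d [e1 e2]; move: d; rewrite e1 e2 !mul0r addr0 ltxx. Qed.

Lemma forms_continuous_parameter (c x l : R) : I l ->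
  {for l, continuous (fun t : R => F1 c x t)} /\ {for l, continuous (fun t : R => F2 c x t)}.
Proof.
move=> Il; have [_ /(_ x) ce] := eta_asymptotics hIo hA hB hC hD heta Il.
have [_ /(_ c) cz] := adj_asymptotics hIo hA hB hC hD hy Il.
have ce' : (eta x) @ l --> eta x l by exact: (continuous_section_r ce).
have cz' : (z c) @ l --> z c l by exact: (continuous_section_r cz).
by split; [exact: cvg_form1 | exact: cvg_form2].
Qed.

Lemma forms_continuous_diagonal (c l : R) : I l ->
  {for (c, l), continuous (fun p : R * R => F1 p.1 p.1 p.2)} /\
  {for (c, l), continuous (fun p : R * R => F2 p.1 p.1 p.2)}.
Proof.
move=> Il; have [_ /(_ c) ce] := eta_asymptotics hIo hA hB hC hD heta Il.
have [_ /(_ c) cz] := adj_asymptotics hIo hA hB hC hD hy Il.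
by split; [exact: cvg_form1 | exact: cvg_form2].
Qed.

Lemma forms_continuous_x (c x l : R) : I l ->
  {for x, continuous (fun t : R => F1 c t l)} /\ {for x, continuous (fun t : R => F2 c t l)}.
Proof.
move=> Il; have ce : eta ^~ l @ x --> eta x l.
  by apply/differentiable_continuous/derivable1_diffP; case: ((heta Il).1 x).
have cz : (fun=> z c l) @ x --> z c l by exact: cvg_cst.
by split; [exact: cvg_form1 | exact: cvg_form2].
Qed.

(** The comparison side_corner for the vertical side at l.  The correction by
    the angles at the bottom corner is left in terms of arbitrary reference
    angles, to be cancelled against the bottom shelf. *)
Lemma side_index (l : R) : I l -> assumption_E_at A muplus wp eta y M l ->
  ~ (psi1pm l = 0 /\ psi2pm l = 0) ->
  \forall c \near +oo, forall (ths Ths : R) (ks : int),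
    is_angle (F1 c (- c) l) (F2 c (- c) l) ths -> is_angle (H1 l) (H2 l) Ths ->
    `|ths - Ths - 2 * pi * ks%:~R| < pi / 2 ->
    Ind_side eta y M l c (- c) c + Num.floor (ths / pi)
    = Ind_line A muplus wp eta y M l + Num.floor (Ths / pi) + 2 * ks.
Proof.
move=> Il hEl hEm; have pi0 := pi_gt0 R.
have [_ _ nz nzP] := hEl.
have e0 x : eta x l <> 0 by exact: eta_neq0_of_psi (nz x).
have [cN1 cN2] := psi_p_cvg_ninfty hA hB hC heta hy hM Il.
have [cP1 cP2] := psi_p_cvg_pinfty hEl.
have c1 : continuous (psi1p ^~ l) by move=> x; exact: (psi_p_continuous hA hB hC heta hy hM Il (e0 x)).1.
have c2 : continuous (psi2p ^~ l) by move=> x; exact: (psi_p_continuous hA hB hC heta hy hM Il (e0 x)).2.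
have [Th [tm [tp [cTh aTh lm lp]]]] := lift_line c1 c2 nz cN1 cN2 hEm cP1 cP2 nzP.
have LT : angle_lift setT (psi1p ^~ l) (psi2p ^~ l) Th.
  by split=> [|x _]; [exact: continuous_subspaceT | exact: aTh].
have atp : is_angle (psi1pp wp eta l) (psi2pp A muplus wp eta y M l) tp.
  exact: (is_angle_cvg aTh cP1 cP2 lp nzP).
have atm : is_angle (psi1pm l) (psi2pm l) tm by exact: (is_angle_cvg aTh cN1 cN2 lm hEm).
have [k k0 [k1 k2]] := psi_pm_forms hA hB hC heta hy hM Il.
have IL : Ind_line A muplus wp eta y M l = Num.floor (tp / pi) - Num.floor (tm / pi).
  exact: hyp_index_inftyE LT lm lp.
have pi2 : 0 < pi / 2 :> R by rewrite divr_gt0.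
have nm : \forall c \near +oo, `|Th (- c) - tm| < pi / 2.
  have lm' : (fun c => Th (- c)) @ +oo --> tm.
    apply: (@cvg_comp _ _ _ (fun c : R => - c) Th _ (-oo : set_system R)) => //.
    move=> P [a [_ aP]]; exists (- a); split; first exact: num_real.
    by move=> c ac; apply: aP; rewrite ltrNl.
  by move/cvgrPdist_lt: lm' => /(_ _ pi2); apply: filterS => c; rewrite distrC.
have np : \forall c \near +oo, `|Th c - tp| < pi / 2.
  by move/cvgrPdist_lt: lp => /(_ _ pi2); apply: filterS => c; rewrite distrC.
have nc := side_close hA hB hC heta hy hM Il hEl hEm.
have n0 : \forall c \near +oo, 0 <= c :> R by apply: nbhs_pinfty_ge; exact: num_real.
near=> c => ths Ths ks as_ aTs ds.
have cc0 : 0 <= c by near: c.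
have dot : forall x, 0 < F1 c x l * form1 (w l) (eta x l) + F2 c x l * form2 M (w l) (eta x l).
  by near: c.
have dotp x : 0 < F1 c x l * psi1p x l + F2 c x l * psi2p x l.
  have [j j0 [-> ->]] := psi_p_forms hA hB hC hy hM Il (e0 x).
  by rewrite mulrCA [X in _ + X]mulrCA -mulrDr mulr_gt0.
have nzF x : ~ (F1 c x l = 0 /\ F2 c x l = 0) by exact: dot_gt0_neq0 (dot x).
have cNc : - c <= c by lra.
have [th L] : exists th, angle_lift `[- c, c] (fun x => F1 c x l) (fun x => F2 c x l) th.
  by apply: lift_segment => // x _; exact: forms_continuous_x.
have Lp : angle_lift `[- c, c] (fun x => psi1c eta y c x l) (fun x => psi2c eta y M c x l) th.
  by apply: angle_lift_scale L _ => x _; exact: psi_c_forms_pos.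
rewrite /Ind_side (hyp_indexE cNc Lp) IL.
apply: (side_corner (h1 := psi1pm l) (h2 := psi2pm l) cc0 L LT _ as_ atm _ ds _ atp).
- by move=> x _; exact: dotp.
- by rewrite k1 k2; exact: is_angle_scale.
- by near: c.
- by near: c.
- by have := crossing_sign hA hB hC heta hy hM Il hEl; rewrite -(crossingE hA heta hy Il c).
Unshelve. all: by end_near. Qed.

Section Segment.
Variables l1 l2 : R.
Hypothesis hl : l1 < l2.
Hypothesis lI : forall l, l1 <= l <= l2 -> I l.
Hypothesis hE : assumption_E A muplus wp eta y M l1 l2.

Let l1P : l1 <= l1 <= l2. Proof. by rewrite lexx ltW. Qed.
Let l2P : l1 <= l2 <= l2. Proof. by rewrite lexx ltW. Qed.
Let seg1 : `[l1, l2]%classic l1. Proof. by rewrite /= in_itv. Qed.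
Let seg2 : `[l1, l2]%classic l2. Proof. by rewrite /= in_itv. Qed.

(** The angles on the bottom shelf and on its limit differ, up to less than
    pi / 2, by the same number k of full turns at both corners. *)
Lemma shelf_index : \forall c \near +oo, exists (t1 t2 T1 T2 : R) (k : int),
  [/\ is_angle (F1 c (- c) l1) (F2 c (- c) l1) t1 /\ is_angle (F1 c (- c) l2) (F2 c (- c) l2) t2,
      is_angle (H1 l1) (H2 l1) T1 /\ is_angle (H1 l2) (H2 l2) T2,
      `|t1 - T1 - 2 * pi * k%:~R| < pi / 2 /\ `|t2 - T2 - 2 * pi * k%:~R| < pi / 2,
      Ind_shelf eta y M (- c) c l1 l2 = Num.floor (t2 / pi) - Num.floor (t1 / pi) &
      Ind_minus A muplus wp eta y M l1 l2 = Num.floor (T2 / pi) - Num.floor (T1 / pi)].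
Proof.
have [_ _ nzm _] := hE; have l12 := ltW hl.
have nzH l : l1 <= l <= l2 -> ~ (H1 l = 0 /\ H2 l = 0).
  move=> lP [e1 e2]; have [k k0 [k1 k2]] := psi_pm_forms hA hB hC heta hy hM (lI lP).
  by apply: (nzm _ lP); rewrite k1 k2 e1 e2 !mulr0.
have [Th LT] : exists Th, angle_lift `[l1, l2] (fun l => H1 l) (fun l => H2 l) Th.
  apply: lift_segment => // l lP; have Il := lI lP.
  have [_ _ cw] := eigendata_continuous hA hC.2 Il.
  have [_ cv _] := eigendata_continuous hA hC.1 Il.
  by split; [exact: cvg_form1 | exact: cvg_form2].
have LTp : angle_lift `[l1, l2] psi1pm psi2pm Th.
  apply: angle_lift_scale LT _ => l; rewrite /= in_itv /= => lP.
  exact: (psi_pm_forms hA hB hC heta hy hM (lI lP)).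
have := shelf_close hIo hA hB hC hD heta hy hM lI nzm.
apply: filterS => c dot.
have nzF l : l1 <= l <= l2 -> ~ (F1 c (- c) l = 0 /\ F2 c (- c) l = 0).
  by move=> lP; exact: dot_gt0_neq0 (dot l lP).
have [th L] : exists th, angle_lift `[l1, l2] (fun l => F1 c (- c) l) (fun l => F2 c (- c) l) th.
  by apply: lift_segment => // l lP; exact: forms_continuous_parameter (lI lP).
have Lp : angle_lift `[l1, l2] (psi1c eta y c (- c)) (psi2c eta y M c (- c)) th.
  apply: angle_lift_scale L _ => l; rewrite /= in_itv /= => lP.
  by have := psi_c_forms_pos hM (nzF l lP).
have [|k kP] := close_lifts (@interval_is_interval _ _) seg1 L LT.
  by move=> l; rewrite /= in_itv /=; exact: dot.
exists (th l1), (th l2), (Th l1), (Th l2), k; split.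
- by split; [exact: L.2 seg1 | exact: L.2 seg2].
- by split; [exact: LT.2 seg1 | exact: LT.2 seg2].
- by split; [exact: kP seg1 | exact: kP seg2].
- exact: hyp_indexE Lp.
- exact: hyp_indexE LTp.
Qed.

(** In the alternating sum over the three sides the corner angles cancel, and so
    does the number k of full turns, which is common to both corners. *)
Lemma three_sides : \forall c \near +oo,
  Ind_shelf eta y M (- c) c l1 l2 + Ind_side eta y M l2 c (- c) c - Ind_side eta y M l1 c (- c) c
  = Ind_line A muplus wp eta y M l2 - Ind_line A muplus wp eta y M l1
    + Ind_minus A muplus wp eta y M l1 l2.
Proof.
have [E1 E2 nzm _] := hE.
near=> c.
have : exists (t1 t2 T1 T2 : R) (k : int),
  [/\ is_angle (F1 c (- c) l1) (F2 c (- c) l1) t1 /\ is_angle (F1 c (- c) l2) (F2 c (- c) l2) t2,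
      is_angle (H1 l1) (H2 l1) T1 /\ is_angle (H1 l2) (H2 l2) T2,
      `|t1 - T1 - 2 * pi * k%:~R| < pi / 2 /\ `|t2 - T2 - 2 * pi * k%:~R| < pi / 2,
      Ind_shelf eta y M (- c) c l1 l2 = Num.floor (t2 / pi) - Num.floor (t1 / pi) &
      Ind_minus A muplus wp eta y M l1 l2 = Num.floor (T2 / pi) - Num.floor (T1 / pi)].
  by near: c; exact: shelf_index.
move=> [t1 [t2 [T1 [T2 [k [[a1 a2] [b1 b2] [d1 d2] -> ->]]]]]].
have S1 : Ind_side eta y M l1 c (- c) c + Num.floor (t1 / pi)
    = Ind_line A muplus wp eta y M l1 + Num.floor (T1 / pi) + 2 * k.
  move: t1 T1 k a1 b1 d1 {t2 T2 a2 b2 d2}; near: c.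
  exact: side_index (lI l1P) E1 (nzm _ l1P).
have S2 : Ind_side eta y M l2 c (- c) c + Num.floor (t2 / pi)
    = Ind_line A muplus wp eta y M l2 + Num.floor (T2 / pi) + 2 * k.
  move: t2 T2 k a2 b2 d2 {t1 T1 a1 b1 d1 S1}; near: c.
  exact: side_index (lI l2P) E2 (nzm _ l2P).
lia.
Unshelve. all: by end_near. Qed.

(** On this shelf the first form is the Evans function, which does not depend on
    c; so its signs at the ends are fixed, the index is constant, and each of
    its passages gives an eigenvalue. *)
Lemma far_shelf : exists2 c0 : R, 0 < c0 & exists Q : int,
  (forall c, c0 <= c -> Ind_shelf eta y M c c l1 l2 = Q) /\
  ((`|Q|%:~R : R)%:E <= eigenvalue_count A eta y l1 l2)%E.
Proof.
have [_ _ _ [c0 c00 nz]] := hE; exists c0 => //; have l12 := ltW hl.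
have nzF c l : c0 <= c -> l1 <= l <= l2 -> ~ (F1 c c l = 0 /\ F2 c c l = 0).
  move=> hc lP [e1 e2]; have [k1 k2] := psi_c_forms A eta y hM c c l.
  by apply: (nz c l hc lP); rewrite k1 k2 e1 e2 !mulr0.
have lifts c : c0 <= c -> exists th, angle_lift `[l1, l2] (fun l => F1 c c l) (fun l => F2 c c l) th.
  move=> hc; apply: lift_segment => // l lP; last exact: nzF.
  exact: forms_continuous_parameter (lI lP).
have shelfE c : c0 <= c -> Ind_shelf eta y M c c l1 l2 = hyp_index (fun l => F1 c c l) (fun l => F2 c c l) l1 l2.
  move=> hc; have [th L] := lifts c hc; rewrite (hyp_indexE l12 L).
  apply: hyp_indexE l12 _; apply: angle_lift_scale L _ => l; rewrite /= in_itv /= => lP.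
  by have := psi_c_forms_pos hM (nzF c l hc lP).
exists (Ind_shelf eta y M c0 c0 l1 l2); split=> [c hc|].
  rewrite !shelfE //.
  apply: (@homotopy_index_constant _ c0 _ _ (fun c l => F1 c c l) (fun c l => F2 c c l)) => //.
    by move=> c' l _ lP; exact: forms_continuous_diagonal (lI lP).
  move=> c1 c2 l _ _ lP; have Il : I l by case: lP => ->; exact: lI.
  by rewrite !(crossingE hA heta hy Il); exact: same_sign_refl.
have [th L] := lifts c0 (lexx _); rewrite shelfE // (hyp_indexE l12 L).
apply: (index_le_counting l12 L) => l lP; rewrite (crossingE hA heta hy (lI lP)) => e.
by split=> //; apply: (crossing0_eigenvalue hA hB hC heta hy (lI lP)).
Qed.

(** The box index is eventually K - Q, with K the signed sum of the three indices
    at infinity; an eventual value is unique, so the boundary invariant is K - Q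
    and only Q remains to be bounded. *)
Lemma index_le_eigenvalue_count :
  ((`| Ind_line A muplus wp eta y M l2 - Ind_line A muplus wp eta y M l1
       + Ind_minus A muplus wp eta y M l1 l2
       - boundary_invariant eta y M l1 l2 |%:~R : R)%:E
   <= eigenvalue_count A eta y l1 l2)%E.
Proof.
have [c0 c00 [Q [shelf count]]] := far_shelf.
set K := Ind_line _ _ _ _ _ _ l2 - _ + _.
have [C [_ CP]] := three_sides; rewrite -/K in CP.
pose C1 := Num.max c0 (C + 1).
have boxE c : C1 <= c -> box_index eta y M l1 l2 c = K - Q.
  rewrite ge_max => /andP[hc hC1].
  have Cc : C < c by apply: lt_le_trans hC1; rewrite ltrDl.
  by rewrite /box_index (shelf c hc) -(CP c Cc); lia.
suff -> : boundary_invariant eta y M l1 l2 = K - Q by rewrite subKr.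
apply: xget_unique.
  by exists C1 => //; rewrite lt_max c00.
move=> m [C2 _ mP].
have mC1 : C1 <= Num.max C1 C2 by rewrite le_max lexx.
have mC2 : C2 <= Num.max C1 C2 by rewrite le_max lexx orbT.
by rewrite -(boxE _ mC1) (mP _ mC2).
Qed.

End Segment.
End LargeBox.

Theorem theorem1p1 (R : realType) (n : nat) (hn : (0 < n)%N)
  (I : set R) (Omega : set R[i]^o)
  (A : R -> R[i] -> 'M[R[i]]_n.+1) (Am Ap : R[i] -> 'M[R[i]]_n.+1)
  (muminus muplus : R[i] -> R[i])
  (vm vp : R[i] -> 'cV[R[i]]_n.+1) (wm wp : R[i] -> 'rV[R[i]]_n.+1)
  (hI : is_interval I) (hIo : open I)
  (hA : assumption_A Omega I A)
  (hB : assumption_B Omega A Am Ap)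
  (hC : assumption_C Omega I Am Ap muminus muplus vm vp wm wp)
  (hD : assumption_D Omega A Am Ap)
  (eta : R -> R -> 'cV[R]_n.+1) (y : 'I_n.+1 -> R -> R -> 'cV[R]_n.+1)
  (heta : forall l, I l -> is_eta A muminus vm eta l)
  (hy : forall l, I l -> is_ybasis A muplus wp y vp l)
  (M : 'M[R]_n.+1) (hM : M \in unitmx)
  (l1 l2 : R) (hl : l1 < l2) (hlI : `[l1, l2] `<=` I)
  (hE : assumption_E A muplus wp eta y M l1 l2) :
  ((`| Ind_line A muplus wp eta y M l2 - Ind_line A muplus wp eta y M l1
       + Ind_minus A muplus wp eta y M l1 l2
       - boundary_invariant eta y M l1 l2 |%:~R : R)%:E
   <= eigenvalue_count A eta y l1 l2)%E.
Proof.
have lI (l : R) : l1 <= l <= l2 -> I l by move=> lP; apply: hlI; rewrite /= in_itv.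
exact: (index_le_eigenvalue_count hIo hA hB hC hD heta hy hM hl lI hE).
Qed.
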